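(* Let $\nu$ be a symmetric Lévy measure on $\mathbb{R}$ with Lévy exponent $\psi(\theta)=\int_{\mathbb{R}}(1-\cos(\theta y))\,\nu(dy)$, let $\Lambda$ be the homogeneous Lévy basis on $\mathbb{R}^2$ corresponding to $\nu$, and let $g:[0,\infty)\to[0,\infty)$ be a trawl function satisfying Assumption (G) with parameter $\gamma\in(0,1)$. Assume that there exist $0<\alpha<1+\gamma$ and a finite constant $C_\alpha>0$ such that $$\lim_{x\to0}\frac{\psi(x)}{|x|^\alpha}=C_\alpha .$$ Furthermore, assume that there exist $C>0$ and $0\le\kappa<1+\gamma$ such that $$\psi(u)\le C\,(1\vee|u|^\kappa),\qquad u\in\mathbb{R}.$$ Let $$Y_T(t)=\frac{1}{F_T}\int_0^{Tt}X_s\,ds,\quad t\ge0,\qquad F_T=T^{\frac1\alpha},$$ where $X_s=\Lambda(A_s)$ is the trawl process determined by $\Lambda$ and $g$. Then, as $T\to\infty$, the processes $Y_T$ converge in the sense of finite-dimensional distributions to $K\xi^{(\alpha)}$, where $K$ is a positive constant and $\xi^{(\alpha)}$ is a symmetric $\alpha$-stable Lévy process.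
   Context: A symmetric Lévy measure on $\mathbb{R}$ is a symmetric Borel measure $\nu$ with $\nu(\{0\})=0$ and $\int_{\mathbb{R}}(1\wedge|y|^2)\,\nu(dy)<\infty$. The homogeneous Lévy basis $\Lambda$ on $\mathbb{R}^2$ corresponding to $\nu$ is a family $(\Lambda(B))_{B\in\mathcal{E}}$ of real random variables, where $\mathcal{E}$ is the class of Borel subsets of $\mathbb{R}^2$ with finite Lebesgue measure, such that: (1) $\Lambda$ is independently scattered, i.e. for pairwise disjoint $B_1,B_2,\ldots\in\mathcal{E}$ the variables $\Lambda(B_1),\Lambda(B_2),\ldots$ are independent, and if moreover $\bigcup_j B_j\in\mathcal{E}$ then $\Lambda(\bigcup_j B_j)=\sum_j\Lambda(B_j)$; (2) $\mathbb{E}\exp(i\theta\Lambda(B))=\exp(-|B|\psi(\theta))$ for all $B\in\mathcal{E}$, $\theta\in\mathbb{R}$, where $|B|$ is the Lebesgue measure of $B$ and $\psi(\theta)=\int_{\mathbb{R}}(1-\cos(\theta y))\,\nu(dy)$. Assumption (G): the trawl function $g:[0,\infty)\to[0,\infty)$ is continuous, integrable, strictly decreasing, continuously differentiable on $(0,\infty)$, and $\lim_{x\to\infty}x^{2+\gamma}|g'(x)|=C_g$ for some $\gamma\in(0,1)$ and $C_g>0$. Trawl sets and trawl process: $A_t=\{(x,y):x\le t,\ 0\le y\le g(t-x)\}$ and $X_t=\Lambda(A_t)$, $t\ge 0$. A symmetric $\alpha$-stable Lévy process is a Lévy process $\xi^{(\alpha)}$ with $\mathbb{E}\exp(i\theta\xi^{(\alpha)}_t)=\exp(-t|\theta|^\alpha)$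 (the normalization being immaterial because of the constant $K$). $a\vee b=\max(a,b)$. *)

(* Defs.v *)
From HB Require Import structures.
From mathcomp Require Import all_boot all_order all_algebra.
From mathcomp Require Import all_classical all_reals all_analysis.
From mathcomp Require Import complex.

Set Implicit Arguments.
Unset Strict Implicit.
Unset Printing Implicit Defensive.

Import Order.TTheory GRing.Theory Num.Theory.
Import numFieldNormedType.Exports.

Local Open Scope classical_set_scope.
Local Open Scope ring_scope.

Section probability_notions.
Context {R : realType} {d : measure_display} {Om : measurableType d}.
Variable P : probability Om R.

(* E exp(i theta X), given by its real and imaginary parts; the two expectations are finite when X is a random variable. *)
Definition charf (X : Om -> R) (theta : R) : R[i] :=
  Complex (fine 'E_P[fun w => cos (theta * X w)])
          (fine 'E_P[fun w => sin (theta * X w)]).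

Definition mutually_independent (I : eqType) (X : I -> Om -> R) : Prop :=
  forall (s : seq I) (A : I -> set R), uniq s ->
    (forall i, measurable (A i)) ->
    P (\big[setI/setT]_(i <- s) (X i @^-1` A i))
    = (\prod_(i <- s) P (X i @^-1` A i))%E.

Definition same_law (X Y : Om -> R) : Prop :=
  forall A : set R, measurable A -> P (X @^-1` A) = P (Y @^-1` A).

End probability_notions.

Section levy_basis.
Context {R : realType}.

Record symmetric_levy_measure (nu : {measure set R -> \bar R}) : Prop := {
  levy_measure_sym : forall A : set R, measurable A ->
    nu ((fun y => - y) @^-1` A) = nu A;
  levy_measure_at0 : nu [set 0] = 0%E;
  levy_measure_int : (\int[nu]_(y in setT) (Num.min 1 (`|y| ^+ 2))%:E < +oo)%E
}.

Definition levy_exponent (nu : {measure set R -> \bar R}) (theta : R) : R :=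
  \int[nu]_(y in setT) (1 - cos (theta * y)).

Definition area (B : set (R * R)) : \bar R :=
  (@lebesgue_measure R \x @lebesgue_measure R)%E B.

Definition finite_area : set (set (R * R)) :=
  [set B | measurable B /\ (area B < +oo)%E].

(* The class [finite_area] indexing a Levy basis is encoded by letting [Lambda]
   be defined on all sets and constraining only its values on [finite_area].
   Equalities between random variables, including the convergence of the
   series in [levy_basis_additive], are almost sure. *)
Record levy_basis d (Om : measurableType d) (P : probability Om R)
    (nu : {measure set R -> \bar R}) (Lambda : set (R * R) -> {RV P >-> R})
  : Prop := {
  levy_basis_indep : forall B : nat -> set (R * R),
    (forall j, finite_area (B j)) -> trivIset setT B ->
    mutually_independent P (fun j => Lambda (B j) : Om -> R);
  levy_basis_additive : forall B : nat -> set (R * R),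
    (forall j, finite_area (B j)) -> trivIset setT B ->
    finite_area (\bigcup_j B j) ->
    {ae P, forall w, series (fun j => Lambda (B j) w) @ \oo
                       --> Lambda (\bigcup_j B j) w};
  levy_basis_charf : forall (B : set (R * R)) (theta : R), finite_area B ->
    charf P (Lambda B) theta
    = (expR (- (fine (area B) * levy_exponent nu theta)))%:C%C
}.

(* The values of [g] on the negative half-line are irrelevant. *)
Record trawl_function (gamma : R) (g : R -> R) : Prop := {
  trawl_ge0 : forall x : R, 0 <= x -> 0 <= g x;
  trawl_continuous : {within `[0, +oo[, continuous g};
  trawl_integrable :
    (@lebesgue_measure R).-integrable `[0, +oo[ (EFin \o g);
  trawl_decreasing : forall x y : R, 0 <= x -> x < y -> g y < g x;
  trawl_derivable : forall x : R, 0 < x -> derivable g x 1;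
  trawl_derive_continuous : forall x : R, 0 < x -> {for x, continuous (derive1 g)};
  trawl_derive_asymptotics : exists2 Cg : R, 0 < Cg &
    x `^ (2 + gamma) * `|derive1 g x| @[x --> +oo] --> Cg
}.

Definition trawl_set (g : R -> R) (t : R) : set (R * R) :=
  [set p | [/\ p.1 <= t, 0 <= p.2 & p.2 <= g (t - p.1)]].

(* The Levy basis determines the trawl process only up to modification; a
   jointly measurable version is needed to integrate it in time.  The paths of
   such a version are almost surely locally integrable, so the default value of
   the integral of a non-integrable function in [integrated_process] is met
   with probability zero only. *)
Record trawl_process d (Om : measurableType d) (P : probability Om R)
    (Lambda : set (R * R) -> {RV P >-> R}) (g : R -> R) (X : R -> Om -> R)
  : Prop := {
  trawl_process_version : forall t : R, 0 <= t ->
    {ae P, forall w, X t w = Lambda (trawl_set g t) w};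
  trawl_process_measurable :
    measurable_fun [set p : R * Om | 0 <= p.1] (fun p : R * Om => X p.1 p.2)
}.

Definition integrated_process d (Om : measurableType d) (X : R -> Om -> R)
    (F : R -> R) (T t : R) (w : Om) : R :=
  (F T)^-1 * \int[@lebesgue_measure R]_(s in `[0, T * t]) X s w.

End levy_basis.

Section limit_process.
Context {R : realType}.

(* An infinite nondecreasing sequence of times covers the finite ones, which
   can be extended by repeating their last term. *)
Record levy_process d (Om : measurableType d) (P : probability Om R)
    (xi : R -> {RV P >-> R}) : Prop := {
  levy_process_start : {ae P, forall w, xi 0 w = 0};
  levy_process_indep : forall t : nat -> R, 0 <= t 0%N ->
    {homo t : i j / (i <= j)%N >-> i <= j} ->
    mutually_independent P (fun j w => xi (t j.+1) w - xi (t j) w);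
  levy_process_stationary : forall s t : R, 0 <= s -> s <= t ->
    same_law P (fun w => xi t w - xi s w) (xi (t - s));
  levy_process_cadlag : {ae P, forall w,
    (forall t : R, 0 <= t -> xi u w @[u --> t^'+] --> xi t w) /\
    (forall t : R, 0 < t -> cvg (xi u w @[u --> t^'-]))}
}.

Definition symmetric_stable_levy_process (alpha : R) d (Om : measurableType d)
    (P : probability Om R) (xi : R -> {RV P >-> R}) : Prop :=
  levy_process xi /\
  forall t theta : R, 0 <= t ->
    charf P (xi t) theta = (expR (- (t * `|theta| `^ alpha)))%:C%C.

(* Convergence in law, as T tends to infinity, of every vector
   (Y_T(t_1), ..., Y_T(t_n)) with nonnegative times. *)
Definition cvg_fdd d (Om : measurableType d) (P : probability Om R)
    (Y : R -> R -> Om -> R)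
    d' (Om' : measurableType d') (Q : probability Om' R)
    (Z : R -> Om' -> R) : Prop :=
  forall (n : nat) (t : 'I_n -> R) (f : 'rV[R]_n -> R),
    (forall i, 0 <= t i) -> continuous f ->
    (exists M : R, forall v, `|f v| <= M) ->
    ('E_P[fun w => f (\row_i Y T (t i) w)])%E @[T --> +oo]
      --> ('E_Q[fun w => f (\row_i Z (t i) w)])%E.

End limit_process.

(* Main.v *)
Require Import Defs.
From HB Require Import structures.
From mathcomp Require Import all_boot all_order all_algebra.
From mathcomp Require Import all_classical all_reals all_analysis.
From mathcomp Require Import complex measurable_realfun ring lra.
Import Order.TTheory GRing.Theory Num.Theory.
Import numFieldNormedType.Exports.
Local Open Scope classical_set_scope.
Local Open Scope ring_scope.
Set Implicit Arguments.
Unset Strict Implicit.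
Unset Printing Implicit Defensive.

(* Let [l_t p] be the length of the set of times [s] in [[0, t]] whose trawl set
   contains [p]. The integral of [X] over [[0, t]] is formally the integral of
   [l_t] against the Levy basis, so that
     E cos (a + sum_i theta_i Y_T(t_i))
       = cos a * exp (- \int psi (F_T^-1 * sum_i theta_i l_(T t_i) p) dp).
   For finitely many sampled values of [X] this holds by independence over the
   atoms of the trawl sets. To reach the integral itself, knowing only that [X]
   is jointly measurable, the sampling times are drawn independently, one
   uniformly in each cell of a grid: averaging over them turns the cosine of the
   sampled sum into a product of one-cell averages of [exp (i delta X_s)], which
   differs pathwise from the cosine of the integral by O(delta * \int X^2), and the
   paths are almost surely square integrable.

   Let [rho] be the inverse of [g]. After the substitution [x = T u], the function
   [l_(T t)] tends to [rho y] times the indicator of [0 <= u <= t], and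
   [T * psi (T^(-1/alpha) z)] tends to [Calpha * |z|^alpha] while being bounded by
   a multiple of [|z|^alpha + |z|^q] with [max 1 alpha kappa <= q < 1 + gamma].
   Since [g x = O(x^(-1-gamma))], the integral of [rho^p] is finite for
   [p < 1 + gamma], and dominated convergence yields the characteristic function
   of [K xi] with [K^alpha = Calpha * \int rho^alpha]. *)

(** Cosines with a free phase [a] stand in for complex exponentials: the phase recovers sines, a
    detached summand can be absorbed into it, and since all the exponents are real every
    characteristic function has the shape [cos a] times a positive number. The obstacle is weak
    information on [X]. Its values may have no second moment, its paths no regularity, and its
    identity with the Levy basis is almost sure only at each fixed time. Hence the estimate for a
    sampled sum is proved uniformly over all positions of the points in their cells, and averaging
    over the positions preserves it. Square integrability of the paths cannot be read off [E X^2];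
    it is extracted from the characteristic functions of finite samples. Near 0 the exponent may be
    much larger than a quadratic function. The working bound is therefore [psi v <= e + D * v ^+ 2]
    with [e] arbitrarily small, affordable because the kernels live, up to a null set, on a region
    of finite area. *)

Lemma ler_of_eq {disp} {T : porderType disp} (x y : T) : x = y -> (x <= y)%O.
Proof. by move->. Qed.

Lemma exists_nat_gt {R : realType} (x : R) : exists n : nat, x < n%:R.
Proof.
exists (Num.bound `|x|); rewrite (le_lt_trans (ler_norm x))//.
exact: archi_boundP.
Qed.

(** * Bounded measurable functions and their integrals *)

Section bounded_measurable.
Context {R : realType} {d : measure_display} {T : measurableType d}.
Implicit Types f g : T -> R.

Definition bdm f := measurable_fun setT f /\ exists M : R, forall x : T, `|f x| <= M.

Lemma bdm_measurable f : bdm f -> measurable_fun setT f.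
Proof. by case. Qed.

Lemma bdm_cst (c : R) : bdm (fun=> c).
Proof. by split; [exact: measurable_cst|exists `|c|]. Qed.

Lemma bdmD f g : bdm f -> bdm g -> bdm (fun x => f x + g x).
Proof.
move=> [mf [M fM]] [mg [N gN]]; split; first exact: measurable_funD.
by exists (M + N) => x; rewrite (le_trans (ler_normD _ _))// lerD.
Qed.

Lemma bdmM f g : bdm f -> bdm g -> bdm (fun x => f x * g x).
Proof.
move=> [mf [M fM]] [mg [N gN]]; split; first exact: measurable_funM.
by exists (M * N) => x; rewrite normrM ler_pM.
Qed.

Lemma bdmN f : bdm f -> bdm (fun x => - f x).
Proof.
move=> [mf [M fM]]; split; first exact: measurableT_comp.
by exists M => x; rewrite normrN.
Qed.

Lemma bdmB f g : bdm f -> bdm g -> bdm (fun x => f x - g x).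
Proof. by move=> bf bg; apply: bdmD => //; exact: bdmN. Qed.

Lemma bdm_sum I (s : seq I) (f : I -> T -> R) :
  (forall i, bdm (f i)) -> bdm (fun x => \sum_(i <- s) f i x).
Proof.
move=> bf; elim: s => [|i s ih].
  by under eq_fun do rewrite big_nil; exact: bdm_cst.
by under eq_fun do rewrite big_cons; exact: bdmD.
Qed.

Lemma bdm_prod I (s : seq I) (f : I -> T -> R) :
  (forall i, bdm (f i)) -> bdm (fun x => \prod_(i <- s) f i x).
Proof.
move=> bf; elim: s => [|i s ih].
  by under eq_fun do rewrite big_nil; exact: bdm_cst.
by under eq_fun do rewrite big_cons; exact: bdmM.
Qed.

Lemma bdm_cos f : measurable_fun setT f -> bdm (fun x => cos (f x)).
Proof.
move=> mf; split; last by exists 1 => x; rewrite ler_norml cos_geN1 cos_le1.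
by apply: measurableT_comp => //; apply: continuous_measurable_fun; exact: continuous_cos.
Qed.

Lemma bdm_sin f : measurable_fun setT f -> bdm (fun x => sin (f x)).
Proof.
move=> mf; split; last by exists 1 => x; rewrite ler_norml sin_geN1 sin_le1.
by apply: measurableT_comp => //; apply: continuous_measurable_fun; exact: continuous_sin.
Qed.

Lemma bdm_indic (A : set T) : measurable A -> bdm (\1_A : T -> R).
Proof.
move=> mA; split; first exact: measurable_indic.
by exists 1 => x; rewrite indicE; case: (_ \in _); rewrite ?normr1 ?normr0.
Qed.

Lemma bdm_boolr (b : T -> bool) : measurable_fun setT b ->
  bdm (fun x => (b x)%:R : R).
Proof.
move=> mb; have := @bdm_indic (b @^-1` [set true]).
rewrite (_ : (\1_(b @^-1` [set true]) : T -> R) = fun x => (b x)%:R).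
  by apply; rewrite -[X in measurable X]setTI; exact: mb.
apply/funext => x; rewrite indicE; congr (_%:R); congr nat_of_bool.
by apply/idP/idP; rewrite inE.
Qed.

End bounded_measurable.

Lemma bdm_comp {R : realType} d d' (T : measurableType d) (T' : measurableType d')
    (f : T -> R) (h : T' -> T) :
  bdm f -> measurable_fun setT h -> bdm (fun x => f (h x)).
Proof.
by move=> [mf [M fM]] mh; split; [exact: measurableT_comp|exists M => x].
Qed.

Section bounded_integral.
Context {R : realType} {d : measure_display} {T : measurableType d}.
Variable mu : {finite_measure set T -> \bar R}.
Implicit Types f g : T -> R.

Lemma bdm_integrable f (D : set T) : measurable D -> bdm f -> mu.-integrable D (EFin \o f).
Proof.
move=> mD [mf [M fM]]; apply/integrableP; split.
  by apply/measurable_EFinP; exact: measurable_funTS.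
apply: (@le_lt_trans _ _ (\int[mu]_(x in D) M%:E)%E).
  apply: ge0_le_integral => //.
  - apply: measurableT_comp => //; apply/measurable_EFinP.
    exact: measurable_funTS.
  by move=> x _; rewrite abse_EFin lee_fin.
rewrite integral_cst//.
have : (mu D < +oo)%E by rewrite ltey_eq fin_num_measure.
have M0 (x : T) : 0 <= M by rewrite (le_trans _ (fM x)).
have [->|/set0P[x Dx]] := eqVneq D set0; first by rewrite !measure0 => _; rewrite mule0 ltry.
by move=> muD; rewrite lte_mul_pinfty// lee_fin (M0 x).
Qed.

Lemma expectD f g : bdm f -> bdm g ->
  \int[mu]_x (f x + g x) = \int[mu]_x f x + \int[mu]_x g x.
Proof. by move=> bf bg; rewrite RintegralD//; exact: bdm_integrable. Qed.

Lemma expectB f g : bdm f -> bdm g ->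
  \int[mu]_x (f x - g x) = \int[mu]_x f x - \int[mu]_x g x.
Proof. by move=> bf bg; rewrite RintegralB//; exact: bdm_integrable. Qed.

Lemma expectZl f (c : R) : bdm f -> \int[mu]_x (c * f x) = c * \int[mu]_x f x.
Proof. by move=> bf; rewrite RintegralZl//; exact: bdm_integrable. Qed.

Lemma expect_sum I (s : seq I) (f : I -> T -> R) : (forall i, bdm (f i)) ->
  \int[mu]_x (\sum_(i <- s) f i x) = \sum_(i <- s) \int[mu]_x f i x.
Proof.
move=> bf; elim: s => [|i s ih].
  under eq_Rintegral do rewrite big_nil.
  by rewrite big_nil Rintegral_cst// mul0r.
under eq_Rintegral do rewrite big_cons.
by rewrite big_cons expectD// ?ih//; exact: bdm_sum.
Qed.

Lemma le_expect f g : bdm f -> bdm g -> (forall x, f x <= g x) ->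
  \int[mu]_x f x <= \int[mu]_x g x.
Proof. by move=> bf bg fg; apply: le_Rintegral => //; exact: bdm_integrable. Qed.

Lemma le_norm_expect f : bdm f -> `|\int[mu]_x f x| <= \int[mu]_x `|f x|.
Proof. by move=> bf; apply: le_normr_Rintegral => //; exact: bdm_integrable. Qed.

End bounded_integral.

Lemma expect_cst {R : realType} d (T : measurableType d) (P : probability T R) (c : R) :
  \int[P]_x c = c.
Proof.
have := Rintegral_cst P (@measurableT _ T) c => ->.
by have /= -> := probability_setT P; rewrite mulr1.
Qed.

Lemma bdm_abs {R : realType} d (T : measurableType d) (f : T -> R) :
  bdm f -> bdm (fun x => `|f x|).
Proof.
move=> [mf [M fM]]; split; first exact: measurableT_comp.
by exists M => x; rewrite normr_id.
Qed.

Lemma expect_diff_le {R : realType} d (T : measurableType d) (P : probability T R)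
    (f g : T -> R) (e : R) : bdm f -> bdm g -> (forall x, `|f x - g x| <= e) ->
  `|\int[P]_x f x - \int[P]_x g x| <= e.
Proof.
move=> bf bg fg; rewrite -expectB// (le_trans (le_norm_expect _ (bdmB bf bg)))//.
by rewrite -[leRHS](expect_cst P); apply: le_expect => //; [exact/bdm_abs/bdmB|exact: bdm_cst].
Qed.

(** * Counting sample points in an interval *)

Lemma telescope_min {R : realType} (n : nat) (delta b : R) :
  \sum_(k < n) (Num.min b (delta * k.+1%:R) - Num.min b (delta * k%:R)) =
  Num.min b (delta * n%:R) - Num.min b 0.
Proof.
rewrite -(big_mkord xpredT (fun k => Num.min b (delta * k.+1%:R) - Num.min b (delta * k%:R))).
by rewrite (telescope_sumr (fun k => Num.min b (delta * k%:R)))// mulr0.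
Qed.

Lemma clip_up {R : realType} (delta b x y : R) (c : bool) :
  0 < delta -> x <= y -> (c -> y <= b) ->
  delta * c%:R <= Num.min (b + delta) (x + delta) - Num.min (b + delta) x.
Proof.
move=> d0 xy; case: c => [/(_ isT) yb|_]; rewrite ?mulr1 ?mulr0.
  have -> : Num.min (b + delta) (x + delta) = x + delta by apply/min_idPr; lra.
  have -> : Num.min (b + delta) x = x by apply/min_idPr; lra.
  by lra.
by rewrite subr_ge0 le_min !ge_min lexx/= lerDl (ltW d0) orbT.
Qed.

Lemma clip_down {R : realType} (delta b x y : R) (c : bool) :
  0 < delta -> y <= x + delta -> (~~ c -> b <= y) ->
  Num.min (b - delta) (x + delta) - Num.min (b - delta) x <= delta * c%:R.
Proof.
move=> d0 xy; case: c => [_|/(_ isT) yb]; rewrite ?mulr1 ?mulr0.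
  have m1 : Num.min (b - delta) (x + delta) <= x + delta by rewrite ge_min lexx orbT.
  have m2 : Num.min (b - delta) (x + delta) <= b - delta by rewrite ge_min lexx.
  by rewrite lerBlDr -lerBlDl le_min; apply/andP; split; lra.
have -> : Num.min (b - delta) (x + delta) = b - delta by apply/min_idPl; lra.
have -> : Num.min (b - delta) x = b - delta by apply/min_idPl; lra.
by rewrite subrr.
Qed.

(* The increments of [Num.min (b + delta)] and [Num.min (b - delta)] over the
   cells bound the indicators from above and below, and their sums telescope. *)
Lemma count_bounds {R : realType} (n : nat) (delta b : R) (u : nat -> R) (c : nat -> bool) :
  0 < delta -> (forall k, (k < n)%N -> delta * k%:R <= u k <= delta * k.+1%:R) ->
  (forall k, u k < b -> c k) -> (forall k, c k -> u k <= b) -> 0 <= b <= delta * n%:R ->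
  `|delta * (\sum_(k < n) (c k)%:R) - b| <= delta.
Proof.
move=> d0 hu uc cu /andP[b0 bn].
have S k : delta * k.+1%:R = delta * k%:R + delta by rewrite -natr1; ring.
have upper : delta * (\sum_(k < n) (c k)%:R) <= b + delta.
  have m0 : Num.min (b + delta) 0 = 0 by apply/min_idPr; lra.
  have := telescope_min n delta (b + delta); rewrite m0 subr0 => e.
  apply: (@le_trans _ _ (Num.min (b + delta) (delta * n%:R))); last by rewrite ge_min lexx.
  rewrite -e mulr_sumr; apply: ler_sum => k _.
  have /andP[uk1 _] := hu _ (ltn_ord k); rewrite S.
  exact: clip_up uk1 (cu k).
have lower : b - delta <= delta * (\sum_(k < n) (c k)%:R).
  have e := telescope_min n delta (b - delta).
  apply: (@le_trans _ _ (Num.min (b - delta) (delta * n%:R) - Num.min (b - delta) 0)).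
    have -> : Num.min (b - delta) (delta * n%:R) = b - delta by apply/min_idPl; lra.
    by rewrite lerBrDr gerDl ge_min lexx orbT.
  rewrite -e mulr_sumr; apply: ler_sum => k _.
  have /andP[_] := hu _ (ltn_ord k); rewrite S => uk2.
  by apply: clip_down uk2 _ => //; rewrite leNgt; apply: contra; exact: uc.
by rewrite ler_norml; lra.
Qed.

(** * Characteristic functions of independent variables *)

Section independence.
Context {R : realType} {d : measure_display} {T : measurableType d}.
Variable P : probability T R.

Lemma expect_indic (A : set T) : measurable A -> \int[P]_w (\1_A w) = fine (P A).
Proof. by move=> mA; rewrite /Rintegral integral_indic// setIT. Qed.

(** Layer cake: after a shift by a constant, [h] takes values in [[0, N]], and [h (V w)] is within
    [1 / (n + 1)] of the normalized number of thresholds [(k + 1) / (n + 1)] that it reaches. This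
    is a uniform approximation by sums of indicators of preimages under [V], for which the product
    rule is assumed. *)
Lemma indep_expect (G V : T -> R) (h : R -> R) :
  bdm G -> measurable_fun setT V -> bdm h ->
  (forall B, measurable B ->
    \int[P]_w (G w * \1_(V @^-1` B) w) = \int[P]_w G w * fine (P (V @^-1` B))) ->
  \int[P]_w (G w * h (V w)) = \int[P]_w G w * \int[P]_w h (V w).
Proof.
move=> bG mV; wlog : h / exists N : nat, forall x, 0 <= h x <= N%:R.
  move=> H bh hB; have [mh [M hM]] := bh.
  have [N /ltW MN] := exists_nat_gt M.
  have bhV : bdm (fun w => h (V w)) by exact: (bdm_comp bh).
  have e : \int[P]_w (G w * (h (V w) + N%:R)) = \int[P]_w (G w * h (V w)) + N%:R * \int[P]_w G w.
    rewrite -expectZl// -expectD; [|exact: bdmM|by apply: bdmM => //; exact: bdm_cst].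
    by apply: eq_Rintegral => w _; ring.
  have := H (fun x => h x + N%:R); rewrite e expectD//; last exact: bdm_cst.
  rewrite expect_cst mulrDr [_ * N%:R]mulrC => H'; apply: (addIr (N%:R * \int[P]_w G w)).
  apply: H' => //; last by apply: bdmD => //; exact: bdm_cst.
  exists (2 * N)%N => x; rewrite natrM; have := hM x; rewrite ler_norml => /andP[? ?].
  by apply/andP; split; lra.
move=> [N h01] bh hB; have [mh _] := bh; have [mG [M GM]] := bG.
have bhV : bdm (fun w => h (V w)) by exact: (bdm_comp bh).
pose D n (k : nat) := V @^-1` (h @^-1` `[n.+1%:R^-1 * k.+1%:R, +oo[).
have mB (n k : nat) : measurable (h @^-1` `[n.+1%:R^-1 * k.+1%:R, +oo[).
  by rewrite -[X in measurable X]setTI; apply: mh.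
have mD n k : measurable (D n k).
  by rewrite -[X in measurable X]setTI; apply: mV.
pose S n w := n.+1%:R^-1 * \sum_(k < N * n.+1) (\1_(D n k) w : R).
have bS n : bdm (S n).
  apply: bdmM; first exact: bdm_cst.
  by apply: bdm_sum => k; exact: bdm_indic.
have Sh n w : `|S n w - h (V w)| <= n.+1%:R^-1.
  have -> : S n w = n.+1%:R^-1 * \sum_(k < N * n.+1) (n.+1%:R^-1 * k.+1%:R <= h (V w))%R%:R.
    rewrite /S; congr (_ * _); apply: eq_bigr => k _; rewrite indicE; congr (_%:R).
    congr nat_of_bool; apply/idP/idP; rewrite /D inE/= in_itv/= andbT//.
  apply: (count_bounds (u := fun k => n.+1%:R^-1 * k.+1%:R)
    (c := fun k => n.+1%:R^-1 * k.+1%:R <= h (V w))) => //.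
  - by move=> k _; rewrite lexx andbT ler_pM2l ?invr_gt0// ler_nat.
  - by move=> k /ltW.
  by rewrite natrM mulrCA mulVf// mulr1.
have GS n : \int[P]_w (G w * S n w) = \int[P]_w G w * \int[P]_w S n w.
  have -> : \int[P]_w (G w * S n w) =
      \int[P]_w (n.+1%:R^-1 * \sum_(k < N * n.+1) G w * \1_(D n k) w).
    by apply: eq_Rintegral => w _; rewrite /S mulrCA mulr_sumr.
  rewrite expectZl; last first.
    by apply: bdm_sum => k; apply: bdmM => //; exact: bdm_indic.
  rewrite expectZl; last by apply: bdm_sum => k; exact: bdm_indic.
  rewrite expect_sum; last by move=> k; apply: bdmM => //; exact: bdm_indic.
  rewrite expect_sum; last by move=> k; exact: bdm_indic.
  rewrite mulrCA; congr (_ * _); rewrite mulr_sumr; apply: eq_bigr => k _.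
  by rewrite hB// expect_indic.
apply/eqP; rewrite -subr_eq0 -normr_le0.
apply/ler_addgt0Pr => e e0; rewrite add0r.
have [n ne] : exists n : nat, (2 * `|M|) / e < n.+1%:R.
  have [n nM] := exists_nat_gt (2 * `|M| / e); exists n.
  by rewrite (lt_le_trans nM)// ler_nat.
have e1 : `|\int[P]_w (G w * h (V w)) - \int[P]_w (G w * S n w)| <= `|M| * n.+1%:R^-1.
  apply: expect_diff_le; [exact: bdmM|exact: bdmM|move=> w].
  rewrite -mulrBr normrM distrC; apply: ler_pM (normr_ge0 _) (normr_ge0 _) _ (Sh n w).
  exact: le_trans (GM w) (ler_norm M).
have e2 : `|\int[P]_w G w * \int[P]_w S n w - \int[P]_w G w * \int[P]_w h (V w)| <= `|M| * n.+1%:R^-1.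
  rewrite -mulrBr normrM.
  apply: ler_pM (normr_ge0 _) (normr_ge0 _) _ (expect_diff_le P (bS n) bhV (Sh n)).
  have := @expect_diff_le _ _ _ P G (fun=> 0) `|M| bG (bdm_cst _).
  rewrite expect_cst subr0; apply => w; rewrite subr0.
  by rewrite (le_trans (GM w))// ler_norm.
rewrite (le_trans (ler_distD (\int[P]_w (G w * S n w)) _ _))//.
rewrite {2}GS (le_trans (lerD e1 e2))// -mulrDr.
move: ne; rewrite ltr_pdivrMr// => ne.
have n0 : 0 < n.+1%:R :> R by [].
rewrite -(ler_pM2r n0) -mulrA mulrDl mulVf ?gt_eqF//.
by rewrite -[1 + 1]/2%:R mulrC [e * _]mulrC ltW.
Qed.

Variables (I : eqType) (X : I -> T -> R).
Hypothesis mX : forall i, measurable_fun setT (X i).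
Hypothesis hX : mutually_independent P X.

Let mXi i (A : set R) : measurable A -> measurable (X i @^-1` A).
Proof. by move=> mA; rewrite -[X in measurable X]setTI; apply: mX. Qed.

Lemma prod_indic (s : seq I) (A : I -> set T) w :
  \prod_(i <- s) (\1_(A i) w : R) = \1_(\big[setI/setT]_(i <- s) A i) w.
Proof.
elim: s => [|i s ih]; first by rewrite !big_nil indicE in_setT.
by rewrite !big_cons ih indicI.
Qed.

(** The list [s2] still carries indicators so that the induction hypothesis, applied with one more
    index in [s2], supplies exactly the product rule that [indep_expect] demands for the next
    factor. *)
Lemma mutually_independent_expect_indic (s1 s2 : seq I) (f : I -> R -> R) (A : I -> set R) :
  uniq (s1 ++ s2) -> (forall i, bdm (f i)) -> (forall i, measurable (A i)) ->
  \int[P]_w ((\prod_(i <- s1) f i (X i w)) * \prod_(i <- s2) (\1_(X i @^-1` A i) w)) =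
  (\prod_(i <- s1) \int[P]_w (f i (X i w))) * \prod_(i <- s2) fine (P (X i @^-1` A i)).
Proof.
move=> + bf; elim: s1 s2 A => [|i s1 ih] s2 A us mA.
  rewrite big_nil mul1r; under eq_Rintegral do rewrite big_nil mul1r prod_indic.
  rewrite expect_indic; last by apply: bigsetI_measurable => i _; exact: mXi.
  rewrite (hX us mA); elim: (s2) => [|j s ih]; first by rewrite !big_nil.
  rewrite !big_cons fineM ?ih//; first by rewrite fin_num_measure//; exact: mXi.
  rewrite prode_fin_num// => k _; rewrite fin_num_measure//; exact: mXi.
have /andP[inin us'] : (i \notin s1 ++ s2) && uniq (s1 ++ s2) by [].
have bfX j : bdm (fun w => f j (X j w)) by exact: bdm_comp (bf j) (mX j).
have bI j : bdm (\1_(X j @^-1` A j) : T -> R) by apply: bdm_indic; exact: mXi.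
have b1 s : bdm (fun w => \prod_(j <- s) f j (X j w)) by exact: bdm_prod.
have b2 s : bdm (fun w => \prod_(j <- s) (\1_(X j @^-1` A j) w : R)).
  by apply: bdm_prod.
transitivity (\int[P]_w (((\prod_(j <- s1) f j (X j w)) *
    \prod_(j <- s2) (\1_(X j @^-1` A j) w)) * f i (X i w))).
  by apply: eq_Rintegral => w _; rewrite big_cons; ring.
rewrite indep_expect//; [|exact: bdmM|].
  by rewrite ih// big_cons; ring.
move=> B mB; pose A' j := if j == i then B else A j.
have A'E j : j \in s1 ++ s2 -> A' j = A j.
  by rewrite /A'; case: eqP => // -> ; rewrite (negbTE inin).
have mA' j : measurable (A' j) by rewrite /A'; case: eqP.
have := ih (i :: s2) A' _ mA'; rewrite big_cons {2}/A' eqxx => H.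
transitivity (\int[P]_w ((\prod_(j <- s1) f j (X j w)) * \prod_(j <- i :: s2) (\1_(X j @^-1` A' j) w))).
  apply: eq_Rintegral => w _; rewrite big_cons {1}/A' eqxx -mulrA; congr (_ * _).
  rewrite mulrC; congr (_ * _); apply: eq_big_seq => j js.
  by rewrite A'E// mem_cat js orbT.
rewrite H; last by rewrite uniq_catC/= mem_cat orbC -mem_cat inin uniq_catC.
rewrite ih// -mulrA; congr (_ * _); rewrite mulrC; congr (_ * _).
by apply: eq_big_seq => j js; rewrite A'E// mem_cat js orbT.
Qed.

Lemma mutually_independent_expect (s : seq I) (f : I -> R -> R) :
  uniq s -> (forall i, bdm (f i)) ->
  \int[P]_w (\prod_(i <- s) f i (X i w)) = \prod_(i <- s) \int[P]_w (f i (X i w)).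
Proof.
move=> us bf; have := @mutually_independent_expect_indic s [::] f (fun=> setT).
rewrite cats0 big_nil mulr1 => <-//.
by apply: eq_Rintegral => w _; rewrite big_nil mulr1.
Qed.

Lemma bdm_cosZ (c : R) : bdm (fun x : R => cos (c * x)).
Proof. by apply: bdm_cos; exact: mulrl_measurable. Qed.

Lemma bdm_sinZ (c : R) : bdm (fun x : R => sin (c * x)).
Proof. by apply: bdm_sin; exact: mulrl_measurable. Qed.

Lemma measurable_linear_comb (s : seq I) (c : I -> R) :
  measurable_fun setT (fun w => \sum_(i <- s) c i * X i w).
Proof. by apply: measurable_sum => i; exact: measurable_funM. Qed.

(** A coordinate leaves the sum by the addition formula. The sine of the remaining sum is a cosine
    with phase [a - pi / 2], so the induction must quantify over all phases; the term containing
    [sin (c i * X i)] vanishes by independence and a zero expected sine. The factors over [s2]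
    receive the detached cosines and sines. *)
Lemma sum_charf_aux (c phi : I -> R) :
  (forall i, \int[P]_w cos (c i * X i w) = phi i) ->
  (forall i, \int[P]_w sin (c i * X i w) = 0) ->
  forall (s1 s2 : seq I) (f : I -> R -> R) (a : R),
  uniq (s1 ++ s2) -> (forall i, bdm (f i)) ->
  \int[P]_w (cos (a + \sum_(i <- s1) c i * X i w) * \prod_(i <- s2) f i (X i w)) =
  cos a * \prod_(i <- s1) phi i * \prod_(i <- s2) \int[P]_w (f i (X i w)).
Proof.
move=> hc hs; elim=> [|i s1 ih] s2 f a us bf.
  rewrite big_nil mulr1 -mutually_independent_expect// -expectZl.
    by apply: eq_Rintegral => w _; rewrite big_nil addr0.
  by apply: bdm_prod => i; exact: bdm_comp (bf i) (mX i).
have /andP[inin us'] : (i \notin s1 ++ s2) && uniq (s1 ++ s2) by [].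
pose f' h j := if j == i then h else f j.
have bf' h j : bdm h -> bdm (f' h j) by rewrite /f'; case: eqP.
have f'E h j : j \in s2 -> f' h j = f j.
  by rewrite /f'; case: eqP => // -> js; move: inin; rewrite mem_cat js orbT.
pose C := f' (fun x => cos (c i * x)); pose S := f' (fun x => sin (c i * x)).
have us2 : uniq (s1 ++ i :: s2) by rewrite uniq_catC/= mem_cat orbC -mem_cat inin uniq_catC.
have bC j : bdm (C j) by apply: bf'; exact: bdm_cosZ.
have bS j : bdm (S j) by apply: bf'; exact: bdm_sinZ.
have hC := ih (i :: s2) C a us2 bC; have hS := ih (i :: s2) S (a - pi / 2) us2 bS.
have prodE h : \prod_(j <- i :: s2) \int[P]_w (f' h j (X j w)) =
    (\int[P]_w h (X i w)) * \prod_(j <- s2) \int[P]_w (f j (X j w)).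
  rewrite big_cons {1}/f' eqxx; congr (_ * _); apply: eq_big_seq => j js.
  by rewrite f'E.
have prodE' h w : \prod_(j <- i :: s2) (f' h j (X j w)) =
    (h (X i w)) * \prod_(j <- s2) (f j (X j w)).
  rewrite big_cons {1}/f' eqxx; congr (_ * _); apply: eq_big_seq => j js.
  by rewrite f'E.
move: hC hS; rewrite !prodE hc hs mul0r mulr0 => hC hS.
have mL := measurable_linear_comb s1 c.
transitivity (\int[P]_w (cos (a + \sum_(i <- s1) c i * X i w) * \prod_(j <- i :: s2) C j (X j w)
   - cos (a - pi / 2 + \sum_(i <- s1) c i * X i w) * \prod_(j <- i :: s2) S j (X j w))).
  apply: eq_Rintegral => w _; rewrite !prodE' big_cons.
  set r := \sum_(j <- s1) _; rewrite addrCA (cosD (c i * X i w)) (addrAC a).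
  rewrite (cosB (a + r) (pi / 2)) cos_pihalf sin_pihalf; ring.
rewrite expectB.
- by rewrite hC hS subr0 big_cons; ring.
- apply: bdmM; first by apply: bdm_cos; apply: measurable_funD => //; exact: measurable_cst.
  by apply: bdm_prod => j; exact: bdm_comp (bC j) (mX j).
- apply: bdmM; first by apply: bdm_cos; apply: measurable_funD => //; exact: measurable_cst.
  by apply: bdm_prod => j; exact: bdm_comp (bS j) (mX j).
Qed.

Lemma sum_charf (c phi : I -> R) :
  (forall i, \int[P]_w cos (c i * X i w) = phi i) ->
  (forall i, \int[P]_w sin (c i * X i w) = 0) ->
  forall (s : seq I) (a : R), uniq s ->
  \int[P]_w (cos (a + \sum_(i <- s) c i * X i w)) = cos a * \prod_(i <- s) phi i.
Proof.
move=> hc hs s a us.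
have := @sum_charf_aux c phi hc hs s [::] (fun _ _ => 0) a.
rewrite cats0 => /(_ us (fun=> bdm_cst 0)) H.
transitivity (\int[P]_w (cos (a + \sum_(i <- s) c i * X i w) * \prod_(i <- [::] : seq I) 0)).
  by apply: eq_Rintegral => w _; rewrite big_nil mulr1.
by rewrite H [X in _ * X]big_nil mulr1.
Qed.

End independence.

Lemma expect_ae_eq {R : realType} d (T : measurableType d) (P : probability T R) (f g : T -> R) :
  measurable_fun setT f -> measurable_fun setT g ->
  {ae P, forall w, f w = g w} -> \int[P]_w f w = \int[P]_w g w.
Proof.
move=> mf mg fg; congr fine; apply: ae_eq_integral => //; try exact/measurable_EFinP.
by apply: filterS fg => w /= -> _.
Qed.

(** * Finite sums of values of the Levy basis *)

Section exponent.
Context {R : realType}.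
Variable nu : {measure set R -> \bar R}.
Local Notation psi := (levy_exponent nu).

Lemma levy_exponent_ge0 x : 0 <= psi x.
Proof. by apply: Rintegral_ge0 => y _; rewrite subr_ge0 cos_le1. Qed.

Lemma levy_exponent0 : psi 0 = 0.
Proof.
rewrite /levy_exponent /Rintegral integral0_eq// => y _.
by rewrite mul0r cos0 subrr.
Qed.

End exponent.

Definition energy {R : realType} (nu : {measure set R -> \bar R}) (f : R * R -> R) : \bar R :=
  (\int[(@lebesgue_measure R \x @lebesgue_measure R)]_p (levy_exponent nu (f p))%:E)%E.

Section levy_basis_sums.
Context {R : realType}.
Variable nu : {measure set R -> \bar R}.
Context d (Om : measurableType d) (P : probability Om R).
Variable Lambda : set (R * R) -> {RV P >-> R}.
Hypothesis hLambda : levy_basis nu Lambda.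
Local Notation psi := (levy_exponent nu).
Local Notation lam2 := (@lebesgue_measure R \x @lebesgue_measure R)%E.

Lemma levy_basis_cos B c : finite_area B ->
  \int[P]_w cos (c * Lambda B w) = expR (- (fine (area B) * psi c)).
Proof.
move=> fB; have := levy_basis_charf hLambda c fB.
by rewrite /charf unlock => /eqP; rewrite eq_complex /= => /andP[/eqP<-].
Qed.

Lemma levy_basis_sin B c : finite_area B -> \int[P]_w sin (c * Lambda B w) = 0.
Proof.
move=> fB; have := levy_basis_charf hLambda c fB.
by rewrite /charf unlock => /eqP; rewrite eq_complex /= => /andP[_ /eqP<-].
Qed.

Lemma finite_area0 : finite_area (set0 : set (R * R)).
Proof. by split => //; rewrite /area measure0. Qed.

Lemma finite_areaS (A B : set (R * R)) : measurable A -> A `<=` B -> finite_area B -> finite_area A.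
Proof.
move=> mA AB [mB aB]; split => //; apply: le_lt_trans aB.
by apply: le_measure => //; rewrite inE.
Qed.

(** A sequence of empty sets is disjoint with empty union, so additivity makes the series with
    constant term [Lambda set0 w] converge, which forces that term to vanish. *)
Lemma levy_basis_set0 : {ae P, forall w, Lambda set0 w = 0}.
Proof.
have := levy_basis_additive hLambda (B := fun=> set0) (fun=> finite_area0).
rewrite bigcup0// => /(_ _ finite_area0) H; apply: filterS (H _); last first.
  by apply/trivIsetP => i j _ _ _; rewrite set0I.
move=> w /= cw; apply/esym.
have c0 := @cvg_series_cvg_0 _ _ (fun=> Lambda set0 w : R^o) (cvgP _ cw).
exact: (cvg_unique _ c0 (cvg_cst _)).
Qed.

(** The selector [J] replaces the unwanted sets by [set0], so that one partition serves for every
    set that is a union of its cells. *)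
Lemma levy_basis_finite_additive (N : nat) (D : nat -> set (R * R)) (J : nat -> bool) :
  (forall n, (n < N)%N -> finite_area (D n)) -> trivIset [set n | (n < N)%N] D ->
  {ae P, forall w, Lambda [set p | exists n, [/\ (n < N)%N, J n & D n p]] w =
    \sum_(0 <= n < N | J n) Lambda (D n) w}.
Proof.
move=> fD tD.
pose B n := if (n < N)%N && J n then D n else set0.
have fB n : finite_area (B n).
  by rewrite /B; case: ifP => [/andP[? _]|_]; [exact: fD|exact: finite_area0].
have tB : trivIset setT B.
  apply/trivIsetP => i j _ _ ij; rewrite /B.
  case: ifP => [/andP[iN _]|_]; last by rewrite set0I.
  case: ifP => [/andP[jN _]|_]; last by rewrite setI0.
  by move/trivIsetP : tD; apply.
have UB : \bigcup_n B n = [set p | exists n, [/\ (n < N)%N, J n & D n p]].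
  apply/seteqP; split => p /=.
    by move=> [n _]; rewrite /B; case: ifP => // /andP[? ?] ?; exists n.
  by move=> [n [nN Jn Dn]]; exists n => //; rewrite /B nN Jn.
have fU : finite_area (\bigcup_n B n).
  split; first by apply: bigcup_measurable => n _; exact: (fB n).1.
  have -> : \bigcup_n B n = \big[setU/set0]_(n < N) B n.
    rewrite -bigcup_mkord; apply/seteqP; split => p [n _ Bn]; exists n => //=.
    by move: Bn; rewrite /B; case: ifP => // /andP[].
  apply: (@le_lt_trans _ _ (\sum_(n < N) area (B n))%E).
    by apply: Boole_inequality => n _; exact: (fB n).1.
  by apply: lte_sum_pinfty => n _; exact: (fB n).2.
have := levy_basis_additive hLambda fB tB fU; rewrite UB => add.
apply: filterS2 levy_basis_set0 add => w /= L0 cw.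
apply: (cvg_unique _ cw) => //.
rewrite (_ : \sum_(0 <= n < N | J n) _ = series (fun j => Lambda (B j) w) N); last first.
  rewrite /series/= [LHS]big_mkcond/= big_nat [RHS]big_nat; apply: eq_bigr => n /andP[_ nN].
  by rewrite /B nN/=; case: ifP.
apply: cvg_near_cst; exists N => //= n /= Nn.
rewrite /series/= (@big_cat_nat _ _ _ N)//= [X in _ + X]big_nat [X in _ + X]big1 ?addr0//.
by move=> k /andP[Nk _]; rewrite /B ltnNge Nk/=.
Qed.

Section atoms.
Variables (J : finType) (B : J -> set (R * R)).
Hypothesis fB : forall j, finite_area (B j).

(** The condition on [S] discards the common complement of all [B j], which has infinite area and on
    which the linear combination [h] below is zero. *)
Definition atom (S : {set J}) := [set p | S != finset.set0 /\ forall j, (j \in S) = `[< B j p >]].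

Lemma atom_finite_area S : finite_area (atom S).
Proof.
have mA : measurable (atom S).
  have -> : atom S = [set p | S != finset.set0] `&`
      \bigcap_(j in [set: J]) (if j \in S then B j else ~` B j).
    apply/seteqP; split => p /=.
      move=> [S0 SB]; split => // j _; rewrite SB; case: asboolP => //.
    move=> [S0 SB]; split => // j; have := SB j I; case: (j \in S) => //= Bj.
      by rewrite asboolT.
    by rewrite asboolF.
  apply: measurableI; first by case: (S != finset.set0); rewrite ?set_true ?set_false.
  apply: fin_bigcap_measurable => // j _; case: ifP => _; first exact: (fB j).1.
  by apply: measurableC; exact: (fB j).1.
have [->|/finset.set0Pn[j jS]] := eqVneq S finset.set0.
  rewrite (_ : atom _ = set0); first exact: finite_area0.
  by apply/seteqP; split => p //= [/eqP].
apply: finite_areaS (fB j) => // p [_ /(_ j)]; rewrite jS => /esym.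
by move/asboolP.
Qed.

Lemma atom_inj S S' p : atom S p -> atom S' p -> S = S'.
Proof. by move=> [_ Sp] [_ S'p]; apply/finset.setP => j; rewrite Sp S'p. Qed.

Let e := enum {set J}.
Let D n := atom (nth finset.set0 e n).

Let tD : trivIset [set n | (n < size e)%N] D.
Proof.
move=> n m /= nN mN [p [Dn Dm]]; have := atom_inj Dn Dm.
by move/eqP; rewrite nth_uniq ?enum_uniq// => /eqP.
Qed.

Let BE j : B j = [set p | exists n, [/\ (n < size e)%N, j \in nth finset.set0 e n & D n p]].
Proof.
apply/seteqP; split => p /=; last first.
  by move=> [n [_ jn [_ /(_ j)]]]; rewrite jn => /esym/asboolP.
move=> Bj; pose S := finset.finset (fun j => `[< B j p >]).
have Se : S \in e by rewrite mem_enum.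
exists (index S e); rewrite index_mem Se nth_index// /D nth_index//.
have jS : j \in S by rewrite finset.inE asboolT.
split => //; split; first by apply/finset.set0Pn; exists j.
by move=> i; rewrite finset.inE.
Qed.

Variable b : J -> R.
Let c n := \sum_(j in nth finset.set0 e n) b j.
Let h p := \sum_j b j * \1_(B j) p.

Let psih p : psi (h p) = \sum_(n < size e) psi (c n) * \1_(D n) p.
Proof.
pose S := finset.finset (fun j => `[< B j p >]).
have hE : h p = \sum_(j in S) b j.
  rewrite [RHS]big_mkcond; apply: eq_bigr => j _; rewrite indicE finset.inE.
  rewrite (_ : (p \in B j) = `[< B j p >]).
    by case: asboolP => _; rewrite ?mulr1 ?mulr0.
  by apply/idP/asboolP; rewrite inE.
have [S0|S0] := eqVneq S finset.set0.
  rewrite hE S0 big_set0 levy_exponent0 big1// => n _.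
  rewrite indicE memNset ?mulr0// => -[n0 Dn].
  have : nth finset.set0 e n = S by apply/finset.setP => j; rewrite Dn finset.inE.
  by move=> nS; move: n0; rewrite nS S0 eqxx.
have Se : S \in e by rewrite mem_enum.
have iS : (index S e < size e)%N by rewrite index_mem.
rewrite (bigD1 (Ordinal iS))//= big1 ?addr0.
  rewrite /c nth_index// -hE indicE mem_set ?mulr1// /D nth_index//; split => // j.
  by rewrite finset.inE.
move=> n nS; rewrite indicE memNset ?mulr0// => -[n0 Dn].
have nE : nth finset.set0 e n = S by apply/finset.setP => j; rewrite Dn finset.inE.
by move/eqP: nS; apply; apply/val_inj => /=; rewrite -nE index_uniq// enum_uniq.
Qed.

Lemma energy_simple : energy nu h = (\sum_(n < size e) (psi (c n))%:E * area (D n))%E.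
Proof.
rewrite /energy.
transitivity (\int[lam2]_p (\sum_(n < size e) (psi (c n))%:E * (\1_(D n) p)%:E))%E.
  apply: eq_integral => p _; rewrite psih -sumEFin.
  by apply: eq_bigr => n _; rewrite EFinM.
rewrite ge0_integral_sum//; last 2 first.
- move=> n; apply/measurable_funeM/measurable_EFinP.
  by apply: measurable_indic; exact: (atom_finite_area _).1.
- by move=> n p _; rewrite mule_ge0// lee_fin// levy_exponent_ge0.
apply: eq_bigr => n _; rewrite ge0_integralZl//; last 2 first.
- apply/measurable_EFinP; apply: measurable_indic; exact: (atom_finite_area _).1.
- by rewrite lee_fin levy_exponent_ge0.
by rewrite integral_indic ?setIT//; exact: (atom_finite_area _).1.
Qed.

(** Splitting each [B j] into atoms turns the combination into a sum of independent variables, where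
    the atom of index set [S] has as coefficient the sum of [b j] over [j] in [S]. That coefficient
    is also the constant value of [h] on the atom, so the exponents add up to [energy]. *)
Lemma levy_basis_simple_charf a :
  \int[P]_w cos (a + \sum_j b j * Lambda (B j) w) = cos a * expR (- fine (energy nu h)).
Proof.
have addL j : {ae P, forall w, Lambda (B j) w =
    \sum_(0 <= n < size e | j \in nth finset.set0 e n) Lambda (D n) w}.
  have := levy_basis_finite_additive (fun k => j \in nth finset.set0 e k)
    (fun n _ => atom_finite_area (nth finset.set0 e n)) tD.
  by apply: filterS => w; rewrite -BE.
have aeL : {ae P, forall w, forall j, Lambda (B j) w =
    \sum_(0 <= n < size e | j \in nth finset.set0 e n) Lambda (D n) w}.
  have [s sJ] : exists s : seq J, forall j, j \in s by exists (enum J) => j; rewrite mem_enum.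
  suff : {ae P, forall w, forall j, j \in s -> Lambda (B j) w =
    \sum_(0 <= n < size e | j \in nth finset.set0 e n) Lambda (D n) w}.
    by apply: filterS => w H j; exact/H/sJ.
  elim: (s) => [|i r ih]; first by apply: aeW.
  apply: filterS2 ih (addL i) => w H1 H2 j; rewrite inE => /predU1P[->//|]; exact: H1.
(* Independence is available for infinite sequences of sets, so the finite list of atoms is
   continued by empty sets. *)
pose B' n := if (n < size e)%N then D n else set0.
have fB' n : finite_area (B' n).
  by rewrite /B'; case: ifP => _; [exact: atom_finite_area|exact: finite_area0].
have tB' : trivIset setT B'.
  apply/trivIsetP => i j _ _ ij; rewrite /B'.
  case: ifP => iN; last by rewrite set0I.
  case: ifP => jN; last by rewrite setI0.
  by move/trivIsetP : tD; apply.
have ind := levy_basis_indep hLambda fB' tB'.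
have mL A : measurable_fun setT (Lambda A : Om -> R) by [].
transitivity (\int[P]_w cos (a + \sum_(0 <= n < size e) c n * Lambda (B' n) w)).
  apply: expect_ae_eq.
  - apply: (bdm_measurable (bdm_cos _)); apply: measurable_funD => //.
    by apply: measurable_sum => j; exact: measurable_funM.
  - apply: (bdm_measurable (bdm_cos _)); apply: measurable_funD => //.
    by apply: measurable_sum => j; exact: measurable_funM.
  apply: filterS aeL => w H; congr (cos (a + _)).
  transitivity (\sum_j \sum_(0 <= n < size e | j \in nth finset.set0 e n) b j * Lambda (D n) w).
    by apply: eq_bigr => j _; rewrite H mulr_sumr.
  rewrite (exchange_big_dep xpredT)//= [RHS]big_seq [LHS]big_seq; apply: eq_bigr => n.
  rewrite mem_index_iota => /andP[_ nN]; rewrite /B' nN /c mulr_suml//.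
rewrite (sum_charf (fun n => mL (B' n)) ind (c := c)
  (phi := fun n => expR (- (fine (area (B' n)) * psi (c n)))))//.
- rewrite -expR_sum sumrN; congr (_ * expR (- _)); rewrite energy_simple.
  rewrite (_ : (\sum_(n < _) _)%E = (\sum_(n < size e) (fine (area (D n)) * psi (c n)))%:E).
    rewrite /= big_mkord; apply: eq_bigr => n _.
    by rewrite /B' ltn_ord.
  rewrite -sumEFin; apply: eq_bigr => n _; rewrite EFinM muleC; congr (_ * _)%E.
  have [? ?] := atom_finite_area (nth finset.set0 e n).
  by rewrite fineK// ge0_fin_numE.
- by move=> n; exact: levy_basis_cos.
- by move=> n; exact: levy_basis_sin.
- exact: iota_uniq.
Qed.

End atoms.
End levy_basis_sums.

(** * The Levy exponent *)

Section trigo_bounds.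
Context {R : realType}.
Implicit Types x y a b : R.

Lemma sin_norm_le x : `|sin x| <= `|x|.
Proof.
wlog x0 : x / 0 < x => [H|].
  have [x0|x0|<-] := ltgtP 0 x; [exact: H| |by rewrite sin0].
  by rewrite -(normrN x) -(normrN (sin x)) -sinN; apply: H; rewrite oppr_gt0.
have [c _] := @MVT R sin cos 0 x x0 (fun y _ => is_derive_sin y)
  (continuous_subspaceT (@continuous_sin R)).
rewrite sin0 !subr0 => ->; rewrite normrM ler_piMl// ler_norml.
by rewrite cos_geN1 cos_le1.
Qed.

Lemma one_minus_cosE x : 1 - cos x = 2 * sin (x / 2) ^+ 2.
Proof.
by rewrite {1}(_ : x = (x / 2) *+ 2) ?cos_mulr2n ?cos2sin2; [ring|rewrite mulr2n -splitr].
Qed.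

Lemma one_minus_cos_ge0 x : 0 <= 1 - cos x.
Proof. by rewrite subr_ge0 cos_le1. Qed.

Lemma sin_sqr_le x : sin x ^+ 2 <= x ^+ 2.
Proof. by rewrite -ler_sqrt ?sqr_ge0// !sqrtr_sqr sin_norm_le. Qed.

Lemma one_minus_cos_le x : 1 - cos x <= x ^+ 2 / 2.
Proof. by rewrite one_minus_cosE; have := sin_sqr_le (x / 2); lra. Qed.

Lemma one_minus_cos_le2 x : 1 - cos x <= 2.
Proof. by have := cos_geN1 x; lra. Qed.

Lemma sin_minus_id_le x : `|sin x - x| <= x ^+ 2.
Proof.
wlog x0 : x / 0 < x => [H|].
  have [x0|x0|<-] := ltgtP 0 x; [exact: H| |by rewrite sin0 subrr normr0 expr0n].
  have := H (- x); rewrite oppr_gt0 sinN sqrrN opprK => /(_ x0).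
  by rewrite addrC distrC.
have [c] := @MVT R sin cos 0 x x0 (fun y _ => is_derive_sin y)
  (continuous_subspaceT (@continuous_sin R)).
rewrite in_itv/= sin0 !subr0 => /andP[c0 cx] ->.
rewrite -[X in _ - X]mul1r -mulrBl normrM expr2 (gtr0_norm x0) ler_pM2r//.
rewrite distrC ger0_norm ?one_minus_cos_ge0// one_minus_cosE.
have := sin_norm_le (c / 2); have := sin_max (c / 2); rewrite (ger0_norm (_ : 0 <= c / 2)).
  rewrite -(real_normK (num_real (sin _))); have := normr_ge0 (sin (c / 2)).
  by nra.
by rewrite divr_ge0// ltW.
Qed.

Lemma cos_taylor_le b x : `|cos (b + x) - cos b + x * sin b| <= 2 * x ^+ 2.
Proof.
rewrite cosD (_ : _ + _ = - (cos b * (1 - cos x)) - sin b * (sin x - x)); last by ring.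
have h1 : `|cos b * (1 - cos x)| <= x ^+ 2 / 2.
  rewrite normrM (le_trans _ (one_minus_cos_le x))// [X in _ * X]ger0_norm ?one_minus_cos_ge0//.
  by rewrite ler_piMl ?one_minus_cos_ge0// ler_norml cos_geN1 cos_le1.
have h2 : `|sin b * (sin x - x)| <= x ^+ 2.
  by rewrite normrM (le_trans _ (sin_minus_id_le x))// ler_piMl// sin_max.
rewrite (le_trans (ler_normB _ _))// normrN; have := sqr_ge0 x; lra.
Qed.

Lemma sin_ge_half x : 0 <= x <= 1 -> x / 2 <= sin x.
Proof.
move=> /andP[]; rewrite le_eqVlt => /predU1P[<-|x0 x1]; first by rewrite sin0 mul0r.
have [c] := @MVT R sin cos 0 x x0 (fun y _ => is_derive_sin y)
  (continuous_subspaceT (@continuous_sin R)).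
rewrite in_itv/= sin0 !subr0 => /andP[c0 cx] ->.
by have := one_minus_cos_le c; nra.
Qed.

Lemma sin_sqr_ge x : `|x| <= 1 -> x ^+ 2 / 4 <= sin x ^+ 2.
Proof.
move=> x1; have := @sin_ge_half `|x|; rewrite normr_ge0 x1 => /(_ isT) h.
rewrite -(real_normK (num_real x)) (_ : sin x ^+ 2 = sin `|x| ^+ 2).
  by have := normr_ge0 x; nra.
by have [_|_] := ger0P x => //; rewrite sinN sqrrN.
Qed.

(** With [s] and [t] the sines of half the sum and half the difference, [cos a - cos b = - 2 s t],
    and [2 |s t| <= lam s^2 + t^2 / lam]. Both squares are again of the form [1 - cos], so the bound
    integrates against [nu] to values of the exponent. *)
Lemma cos_diff_le (lam a b : R) : 0 < lam ->
  `|cos a - cos b| <= (lam * (1 - cos (a + b)) + lam^-1 * (1 - cos (a - b))) / 2.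
Proof.
move=> l0; rewrite !one_minus_cosE.
set s := sin ((a + b) / 2); set t := sin ((a - b) / 2).
have -> : cos a - cos b = - (2 * (s * t)).
  have -> : cos a = cos ((a + b) / 2 + (a - b) / 2) by congr cos; lra.
  have -> : cos b = cos ((a + b) / 2 - (a - b) / 2) by congr cos; lra.
  by rewrite cosD cosB -/s -/t; ring.
have := sqr_ge0 (lam * s - t); have := sqr_ge0 (lam * s + t).
have -> : (lam * (2 * s ^+ 2) + lam^-1 * (2 * t ^+ 2)) / 2 =
  lam^-1 * ((lam * s) ^+ 2 + t ^+ 2) by field; rewrite gt_eqF.
rewrite normrN ler_pdivlMl// => h1 h2.
rewrite -{1}(gtr0_norm l0) -normrM ler_norml; apply/andP; split.
  by move: h1; rewrite -subr_ge0 => h1; nra.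
by move: h2; rewrite -subr_ge0 => h2; nra.
Qed.

End trigo_bounds.

Section powR_limits.
Context {R : realType}.
Variables (a : R) (a0 : 0 < a).

Lemma norm_powR_continuous : continuous (fun x : R => `|x| `^ a).
Proof.
move=> x; have [->|x0] := eqVneq x 0.
  apply/cvgrPdist_lt => e e0; near=> y.
  rewrite normr0 powR0 ?gt_eqF// sub0r normrN ger0_norm ?powR_ge0//.
  rewrite -[ltRHS](_ : (e `^ a^-1) `^ a = e); last by rewrite -powRrM mulVf ?gt_eqF// powRr1// ltW.
  rewrite gt0_ltr_powR ?nnegrE ?powR_ge0//; near: y.
  by apply: cvgr0_norm_lt => //; rewrite powR_gt0.
have nx : 0 < `|x| by rewrite normr_gt0.
have h : expR (a * ln `|y|) @[y --> x] --> expR (a * ln `|x|).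
  apply: continuous_cvg; first exact: continuous_expR.
  apply: cvgM; first exact: cvg_cst.
  apply: continuous_cvg; first exact: continuous_ln.
  exact: norm_continuous.
have hx : `|x| `^ a = expR (a * ln `|x|) by rewrite /powR gt_eqF.
rewrite /continuous_at hx; apply: cvg_trans h; apply: near_eq_cvg; near=> y.
have : 0 < `|y| by near: y; apply: (cvgr_gt `|x|) => //; exact: norm_continuous.
by rewrite /powR => y0; rewrite gt_eqF.
Unshelve. all: by end_near. Qed.

Lemma powR_cvgy (T : R ^nat) : T n @[n --> \oo] --> +oo ->
  T n `^ a @[n --> \oo] --> +oo.
Proof.
move=> Too; apply/cvgryPge => A; pose B := Num.max A 1.
near=> n; apply: (@le_trans _ _ B); first by rewrite le_max lexx.
have B0 : 0 < B by rewrite lt_max ltr01 orbT.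
rewrite [leLHS](_ : B = (B `^ a^-1) `^ a); last by rewrite -powRrM mulVf ?gt_eqF// powRr1// ltW.
have : B `^ a^-1 <= T n by near: n; exact: cvgry_ge.
move=> BT; apply: ge0_ler_powR; rewrite ?nnegrE ?powR_ge0 ?(ltW a0)//.
by rewrite (le_trans _ BT)// powR_ge0.
Unshelve. all: by end_near. Qed.

End powR_limits.

Section integrable_real.
Context {R : realType} {d : measure_display} {T : measurableType d}.
Variable mu : {measure set T -> \bar R}.
Implicit Types (D : set T) (f g : T -> R).

Lemma integrable_addr D f g : measurable D -> mu.-integrable D (EFin \o f) ->
  mu.-integrable D (EFin \o g) -> mu.-integrable D (EFin \o (fun x => f x + g x)).
Proof. by move=> mD If Ig; exact: (integrableD mD If Ig). Qed.

Lemma integrable_subr D f g : measurable D -> mu.-integrable D (EFin \o f) ->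
  mu.-integrable D (EFin \o g) -> mu.-integrable D (EFin \o (fun x => f x - g x)).
Proof. by move=> mD If Ig; exact: (integrableB mD If Ig). Qed.

Lemma integrable_mull D f (c : R) : measurable D -> mu.-integrable D (EFin \o f) ->
  mu.-integrable D (EFin \o (fun x => c * f x)).
Proof. by move=> mD If; exact: (integrableZl mD c If). Qed.

Lemma integrable_normr D f : measurable D -> mu.-integrable D (EFin \o f) ->
  mu.-integrable D (EFin \o (fun x => `|f x|)).
Proof. by move=> mD If; exact: (integrable_abse If). Qed.

End integrable_real.

Section exponent_bounds.
Context {R : realType}.
Variable nu : {measure set R -> \bar R}.
Hypothesis hnu : symmetric_levy_measure nu.
Local Notation psi := (levy_exponent nu).

(** The factor [2 + x ^+ 2] merges the bounds [1 - cos z <= 2] and [1 - cos z <= z ^+ 2 / 2], used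
    for large and for small [y] respectively. *)
Lemma integrable_one_minus_cos (x : R) :
  nu.-integrable setT (fun y => (1 - cos (x * y))%:E).
Proof.
have i1 : nu.-integrable setT (fun y => ((2 + x ^+ 2) * Num.min 1 (`|y| ^+ 2))%:E).
  under eq_fun do rewrite EFinM.
  apply: integrableZl => //; apply/integrableP; split.
    apply/measurable_EFinP; apply: measurable_minr => //.
    by apply: measurable_funX; exact: normr_measurable.
  under eq_integral.
    move=> y _; rewrite gee0_abs; last by rewrite lee_fin le_min ler01 exprn_ge0.
    over.
  exact: levy_measure_int hnu.
apply: le_integrable i1 => //.
  apply/measurable_EFinP; apply: measurable_funB => //.
  by apply: (bdm_measurable (bdm_cos _)); exact: mulrl_measurable.
move=> y _; rewrite lee_fin ger0_norm ?one_minus_cos_ge0// ger0_norm; last first.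
  by rewrite mulr_ge0 ?addr_ge0 ?sqr_ge0// le_min ler01 exprn_ge0.
have h1 := one_minus_cos_le (x * y); have h2 := one_minus_cos_le2 (x * y).
rewrite real_normK ?num_real//; case: (leP 1 (y ^+ 2)) => y1.
  rewrite mulr1 (le_trans h2)// lerDl sqr_ge0//.
by move: h1; rewrite exprMn; have := sqr_ge0 x; have := sqr_ge0 y; nra.
Qed.

(** The oscillation of [psi] is bounded by values of [psi] itself, so continuity everywhere follows
    from smallness near 0 without any moment of [nu]; [lam] balances a bounded term against a small
    one. *)
Lemma levy_exponent_diff (lam p q : R) : 0 < lam ->
  `|psi p - psi q| <= (lam * psi (p + q) + lam^-1 * psi (p - q)) / 2.
Proof.
move=> l0; rewrite /levy_exponent.
rewrite -RintegralB//; [|exact: integrable_one_minus_cos|exact: integrable_one_minus_cos].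
rewrite -!RintegralZl//; [|exact: integrable_one_minus_cos|exact: integrable_one_minus_cos].
have i1 (c x : R) : nu.-integrable setT (EFin \o (fun y => c * (1 - cos (x * y)))).
  by apply: integrable_mull => //; exact: integrable_one_minus_cos.
rewrite -RintegralD//.
have iD : nu.-integrable setT (EFin \o (fun y => lam * (1 - cos ((p + q) * y)) +
    lam^-1 * (1 - cos ((p - q) * y)))).
  by apply: integrable_addr => //; exact: i1.
rewrite -RintegralZr//.
have iB : nu.-integrable setT (EFin \o (fun y => (1 - cos (p * y)) - (1 - cos (q * y)))).
  by apply: integrable_subr => //; exact: integrable_one_minus_cos.
rewrite (le_trans (le_normr_Rintegral _ iB))//.
apply: le_Rintegral => //.
- exact: integrable_normr.
- have := integrable_mull 2^-1 measurableT iD.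
  by under eq_fun do rewrite mulrC.
move=> y _; have := cos_diff_le (p * y) (q * y) l0; rewrite -mulrDl -mulrBl.
by rewrite (_ : 1 - _ - (1 - _) = - (cos (p * y) - cos (q * y))) ?normrN//; ring.
Qed.

Variables (alpha : R) (halpha0 : 0 < alpha) (Calpha : R) (hCalpha : 0 < Calpha).
Hypothesis hpsi0 : psi x / `|x| `^ alpha @[x --> 0^'] --> Calpha.

Lemma levy_exponent_near0 (e : R) : 0 < e ->
  exists2 r : R, 0 < r < 1 & forall x, x != 0 -> `|x| < r ->
    `|psi x / `|x| `^ alpha - Calpha| < e.
Proof.
move=> e0; move/cvgrPdist_lt : hpsi0 => /(_ e e0).
rewrite near_withinE => /nbhs_ballP[r /= r0 H].
exists (Num.min r (1 / 2)); first by rewrite lt_min r0/= gt_min; apply/andP; split; lra.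
move=> x x0; rewrite lt_min => /andP[xr _]; rewrite distrC; apply: H => //.
by rewrite /ball/= sub0r normrN.
Qed.

Variables (C kappa : R) (hC : 0 < C) (hkappa0 : 0 <= kappa).
Hypothesis hpsi : forall u, psi u <= C * Num.max 1 (`|u| `^ kappa).

Lemma levy_exponent_tail (r q : R) : 0 < r < 1 -> kappa <= q ->
  exists2 M : R, 0 < M & forall v, r <= `|v| -> psi v <= M * `|v| `^ q.
Proof.
move=> /andP[r0 r1] kq; have q0 := le_trans hkappa0 kq.
have rq : 0 < r `^ q by rewrite powR_gt0.
exists (C * (1 + (r `^ q)^-1)).
  by rewrite mulr_gt0// addr_gt0// invr_gt0.
move=> v rv; have v0 : 0 < `|v| by exact: lt_le_trans rv.
rewrite (le_trans (hpsi v))// -mulrA ler_pM2l// ge_max.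
have vq : r `^ q <= `|v| `^ q by rewrite ge0_ler_powR// nnegrE ltW.
have h1 : 1 <= (r `^ q)^-1 * `|v| `^ q by rewrite ler_pdivlMl// mulr1.
rewrite mulrDl mul1r; apply/andP; split.
  by rewrite (le_trans h1)// lerDr powR_ge0.
have [v1|/ltW v1] := leP 1 `|v|.
  rewrite (le_trans (ler_powR v1 kq))// lerDl mulr_ge0 ?powR_ge0// invr_ge0 ltW//.
rewrite (@le_trans _ _ 1)//; last by rewrite (le_trans h1)// lerDr powR_ge0.
have := @ge0_ler_powR _ kappa hkappa0 `|v| 1.
by rewrite !nnegrE powR1; apply.
Qed.

Lemma levy_exponent_le_powR (q : R) : kappa <= q ->
  exists2 D : R, 0 < D & forall v, psi v <= D * (`|v| `^ alpha + `|v| `^ q).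
Proof.
move=> kq.
have [r r01 hr] := levy_exponent_near0 ltr01.
have [M M0 hM] := levy_exponent_tail r01 kq.
exists (Calpha + 1 + M); first by rewrite !addr_gt0.
move=> v; have [->|v0] := eqVneq v 0.
  by rewrite levy_exponent0 mulr_ge0 ?addr_ge0 ?powR_ge0// ltW.
have va : 0 < `|v| `^ alpha by rewrite powR_gt0// normr_gt0.
have vq : 0 < `|v| `^ q by rewrite powR_gt0// normr_gt0.
have [rv|vr] := leP r `|v|.
  by rewrite (le_trans (hM _ rv))//; have := hCalpha; nra.
have := hr v v0 vr; rewrite ltr_norml => /andP[_].
rewrite ltrBlDr ltr_pdivrMr// => h; have := hCalpha; nra.
Qed.

(** Near 0 the exponent is of order [|v|^alpha], which may exceed every multiple of [v ^+ 2]; the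
    constant [e] absorbs it on a small ball. Outside that ball the growth of order [kappa < 2] is
    below a multiple of [v ^+ 2]. *)
Lemma levy_exponent_le_sqr : kappa < 2 -> forall e : R, 0 < e ->
  exists2 D : R, 0 < D & forall v, psi v <= e + D * v ^+ 2.
Proof.
move=> k2 e e0.
have [r /andP[r0 r1] hr] := levy_exponent_near0 ltr01.
have Ca0 : 0 < Calpha + 1 by rewrite addr_gt0.
(* [s] solves [(Calpha + 1) * s^alpha = e], so the bound coming from the limit at 0 stays below [e]
   on the ball of radius [r']. *)
pose s := (e / (Calpha + 1)) `^ alpha^-1.
have s0 : 0 < s by rewrite powR_gt0// divr_gt0.
pose r' := Num.min r s.
have r'01 : 0 < r' < 1 by rewrite lt_min r0 s0/= gt_min r1.
have [M M0 hM] := levy_exponent_tail r'01 (ltW k2).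
exists M => // v.
have v20 := sqr_ge0 v.
have [rv|vr] := leP r' `|v|.
  move: (hM _ rv); rewrite powR_mulrn// real_normK ?num_real//; lra.
have [->|v0] := eqVneq v 0; first by rewrite levy_exponent0; nra.
move: vr; rewrite lt_min => /andP[vr vs].
have va : 0 < `|v| `^ alpha by rewrite powR_gt0// normr_gt0.
have vsa : `|v| `^ alpha <= e / (Calpha + 1).
  rewrite (_ : e / _ = s `^ alpha); first by rewrite ge0_ler_powR ?nnegrE// ltW.
  by rewrite -powRrM mulVf ?powRr1 ?gt_eqF// ltW// divr_gt0.
have := hr v v0 vr; rewrite ltr_norml => /andP[_].
rewrite ltrBlDr ltr_pdivrMr// => h.
move: vsa; rewrite ler_pdivlMr// => vsa; nra.
Qed.

Lemma levy_exponent_continuous : kappa < 2 -> continuous psi.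
Proof.
move=> k2 x; apply/cvgrPdist_le => /= e e0.
have [D D0 hD] := levy_exponent_le_sqr k2 ltr01.
pose L := 1 + D * (2 * `|x| + 1) ^+ 2.
have L0 : 0 < L by rewrite ltr_pwDl// mulr_ge0 ?sqr_ge0// ltW.
(* [L] bounds [psi (x + y)] for [|x - y| < 1], so the first term of [levy_exponent_diff] is at most
   [lam * L = e]. It remains to reach [psi (x - y) <= lam * e], which fixes [r]. *)
pose lam := e / L; have lam0 : 0 < lam by rewrite divr_gt0.
have le20 : 0 < lam * e / 2 by rewrite divr_gt0// mulr_gt0.
have [D' D'0 hD'] := levy_exponent_le_sqr k2 le20.
pose r := Num.min 1 (Num.sqrt (lam * e / 2 / D')).
have r0 : 0 < r by rewrite lt_min ltr01 sqrtr_gt0 !divr_gt0// mulr_gt0.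
near=> y; have xy : `|x - y| < r.
  by near: y; apply/nbhs_ballP; exists r.
move: xy; rewrite lt_min => /andP[xy1 xy2].
rewrite (le_trans (levy_exponent_diff _ _ lam0))//.
have h1 : psi (x + y) <= L.
  rewrite (le_trans (hD _))// lerD2l ler_pM2l//.
  rewrite -(real_normK (num_real (x + y))) ler_sqr ?nnegrE ?addr_ge0// ?mulr_ge0//.
  have := ler_normB (2 * x) (x - y); rewrite (_ : 2 * x - (x - y) = x + y); last by ring.
  rewrite normrM ger0_norm// => h; rewrite (le_trans h)// lerD2l ltW//.
have h2 : psi (x - y) <= lam * e.
  rewrite (le_trans (hD' _))// {2}[lam * e]splitr lerD2l -ler_pdivlMl// mulrC.
  rewrite -ler_sqrt; last by rewrite ltW// divr_gt0.
  by rewrite sqrtr_sqr ltW.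
have h3 : lam * psi (x + y) <= e by rewrite /lam mulrAC ler_pdivrMr// ler_pM2l.
have h4 : lam^-1 * psi (x - y) <= e by rewrite ler_pdivrMl.
lra.
Unshelve. all: by end_near. Qed.

Lemma levy_exponent_measurable : kappa < 2 -> measurable_fun setT psi.
Proof. by move=> k2; apply: continuous_measurable_fun; exact: levy_exponent_continuous. Qed.

(** The scaling turns the [alpha] term into itself and multiplies the [q] term by
    [T^(1 - q / alpha)], at most 1 because [1 <= T] and [alpha <= q]. *)
Lemma levy_exponent_scaled_le (q : R) : kappa <= q -> alpha <= q ->
  exists2 D : R, 0 < D & forall T z, 1 <= T ->
    T * psi ((T `^ alpha^-1)^-1 * z) <= D * (`|z| `^ alpha + `|z| `^ q).
Proof.
move=> kq aq; have [D D0 hD] := levy_exponent_le_powR kq; exists D => // T z T1.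
have T0 : 0 < T := lt_le_trans ltr01 T1.
rewrite -ler_pdivlMl// (le_trans (hD _))// mulrCA ler_pM2l// mulrDr.
have Ta p : `|(T `^ alpha^-1)^-1 * z| `^ p = T `^ (- (p / alpha)) * `|z| `^ p.
  rewrite normrM powRM// ger0_norm ?invr_ge0 ?powR_ge0//.
  by congr (_ * _); rewrite -powRN -powRrM mulNr [_ * p]mulrC.
have e1 : T `^ (- (alpha / alpha)) = T^-1 by rewrite divff ?gt_eqF// powR_inv1// ltW.
rewrite !Ta e1 lerD2l ler_wpM2r ?powR_ge0// -(powR_inv1 (ltW T0)) ler_powR// lerN2.
by rewrite ler_pdivlMr// mul1r.
Qed.

Lemma levy_exponent_scaled_cvg (T z : R ^nat) (l : R) :
  T n @[n --> \oo] --> +oo -> z n @[n --> \oo] --> l ->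
  T n * psi ((T n `^ alpha^-1)^-1 * z n) @[n --> \oo] --> Calpha * `|l| `^ alpha.
Proof.
move=> Too zl.
(* Filling in the value [Calpha] at 0 makes the ratio continuous there, so the indices with
   [z n = 0] need no separate limit. *)
pose r x := if x == 0 then Calpha else psi x / `|x| `^ alpha.
have rc : r @ 0 --> r 0.
  apply/cvgrPdist_lt => e e0; have [d /andP[d0 _] hd] := levy_exponent_near0 e0.
  near=> x; rewrite /r eqxx; case: eqVneq => [_|x0]; first by rewrite subrr normr0.
  rewrite distrC hd//; near: x; exact: cvgr0_norm_lt.
have Tinv : (T n `^ alpha^-1)^-1 @[n --> \oo] --> 0.
  apply/gtr0_cvgV0; last by apply: powR_cvgy => //; rewrite invr_gt0.
  by near=> n; rewrite powR_gt0//; near: n; exact: cvgry_gt.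
have arg0 : (T n `^ alpha^-1)^-1 * z n @[n --> \oo] --> 0.
  by rewrite -(mul0r l); exact: cvgM.
have h : r ((T n `^ alpha^-1)^-1 * z n) * `|z n| `^ alpha @[n --> \oo] --> Calpha * `|l| `^ alpha.
  apply: cvgM.
    have -> : Calpha = r 0 by rewrite /r eqxx.
    exact: (cvg_comp _ _ arg0 rc).
  exact: (continuous_cvg _ (norm_powR_continuous halpha0 (x := l)) zl).
apply: cvg_trans h; apply: near_eq_cvg; near=> n.
have T0 : 0 < T n by near: n; exact: cvgry_gt.
rewrite /r mulf_eq0 invr_eq0 gt_eqF ?powR_gt0//=; case: eqVneq => [->|z0].
  by rewrite mulr0 levy_exponent0 normr0 powR0 ?gt_eqF// !mulr0.
rewrite normrM powRM// ger0_norm ?invr_ge0 ?powR_ge0// -powRN -powRrM.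
rewrite [_ `^ (- alpha^-1 * alpha)](_ : _ = (T n)^-1); last first.
  by rewrite mulNr mulVf ?gt_eqF// powR_inv1// ltW.
rewrite invfM invrK.
have za : `|z n| `^ alpha != 0 by rewrite gt_eqF// powR_gt0// normr_gt0.
by rewrite mulrA divfK// mulrC.
Unshelve. all: by end_near. Qed.

End exponent_bounds.

(** * Trawl functions and trawl sets *)

Section dyadic.
Context {R : realType}.

(** A dyadic layer cake: it reduces the integral of a power of [trawl_inv] to the lengths of the
    sets where [trawl_inv] is at least [2 ^+ k]. *)
Lemma powR_dyadic_le (x p : R) (N : nat) : 0 <= x -> 0 <= p -> x < 2 ^+ N ->
  x `^ p <= 1 + \sum_(k < N) (2 ^+ k.+1) `^ p * (2 ^+ k <= x)%R%:R.
Proof.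
move=> x0 p0; elim: N => [|N ih] xN.
  rewrite big_ord0 addr0; have := @ge0_ler_powR _ p p0 x 1.
  by rewrite !nnegrE powR1; apply => //; rewrite ltW.
rewrite big_ord_recr/= addrA; have [Nx|xN'] := leP (2 ^+ N) x; last first.
  by rewrite mulr0 addr0 ih.
rewrite mulr1 -[leLHS]add0r lerD//.
  by rewrite addr_ge0// sumr_ge0// => k _; rewrite mulr_ge0// powR_ge0.
by rewrite ge0_ler_powR ?nnegrE// ltW.
Qed.

Lemma exists_pow2_gt (x : R) : exists N : nat, x < 2 ^+ N.
Proof.
have [N xN] := exists_nat_gt x; exists N; rewrite (lt_trans xN)//.
by rewrite -natrX ltr_nat ltn_expl.
Qed.

Lemma geometric_nneseries_lty (a z : R) (u : nat -> \bar R) : 0 <= a -> 0 < z < 1 ->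
  (forall k, (0 <= u k)%E) -> (forall k, (u k <= (a * z ^+ k)%:E)%E) ->
  (\sum_(0 <= k <oo) u k < +oo)%E.
Proof.
move=> a0 /andP[z0 z1] u0 uz.
apply: (@le_lt_trans _ _ (a / (1 - z))%:E); last exact: ltry.
apply: lime_le; first by apply: is_cvg_nneseries => k _ _; exact: u0.
near=> n; apply: (@le_trans _ _ (\sum_(0 <= k < n) (a * z ^+ k)%:E)%E).
  by apply: lee_sum => k _.
rewrite sumEFin lee_fin; apply: (@geometric_le_lim _ n a z) => //.
by rewrite gtr0_norm.
Unshelve. all: by end_near. Qed.

End dyadic.

Section trawl.
Context {R : realType}.
Variables (gamma : R) (g : R -> R).
Hypotheses (hgamma : 0 < gamma) (hg : trawl_function gamma g).
Local Notation mu := (@lebesgue_measure R).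

Lemma trawl_nonincreasing x y : 0 <= x -> x <= y -> g y <= g x.
Proof.
move=> x0; rewrite le_eqVlt => /predU1P[->//|xy].
by rewrite ltW//; exact: trawl_decreasing hg _ _ x0 xy.
Qed.

Lemma trawl_gt0 x : 0 <= x -> 0 < g x.
Proof.
move=> x0; apply: (@le_lt_trans _ _ (g (x + 1))).
  by apply: (trawl_ge0 hg); rewrite addr_ge0.
by apply: (trawl_decreasing hg) => //; rewrite ltrDl.
Qed.

(** The clamp at 0 extends [g] to a nonincreasing function on the line, whatever its values at
    negative arguments. *)
Lemma trawl_clamp_measurable (D : set R) : measurable D ->
  measurable_fun D (fun x => g (Num.max 0 x)).
Proof.
move=> mD; apply: nonincreasing_measurable => // x y xy.
apply: trawl_nonincreasing; first by rewrite le_max lexx.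
by rewrite ge_max le_max lexx/= le_max xy orbT.
Qed.

(** Since [g] decreases, [x * g x] is at most the integral of [g] over [[0, x]]. This rough decay
    shows that [g] tends to 0 and that its superlevel sets at positive heights are bounded. *)
Lemma trawl_le_inv : exists I : R, forall x : R, 0 < x -> x * g x <= I.
Proof.
have /integrableP[mg ig] := trawl_integrable hg.
exists (fine (\int[mu]_(x in `[0%R, +oo[) `|(g x)%:E|)%E) => x x0.
rewrite -lee_fin fineK; last by rewrite ge0_fin_numE//; exact: integral_ge0.
apply: (@le_trans _ _ (\int[mu]_(y in `[0%R, x]) (g x)%:E)%E).
  rewrite integral_cst//= lebesgue_measure_itv/= lte_fin x0 -EFinD subr0.
  by rewrite -EFinM mulrC.
apply: (@le_trans _ _ (\int[mu]_(y in `[0%R, x]) `|(g y)%:E|)%E).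
  apply: ge0_le_integral => //.
  - by move=> y _; rewrite lee_fin (trawl_ge0 hg)// ltW.
  - apply: measurableT_comp => //; apply: measurable_funS mg => //.
    by move=> y/=; rewrite !in_itv/= => /andP[->].
  - move=> y; rewrite /= in_itv/= => /andP[y0 yx]; rewrite lee_fin.
    by rewrite (le_trans (trawl_nonincreasing y0 yx))// ler_norm.
apply: ge0_subset_integral => //; first exact: measurableT_comp.
by move=> y/=; rewrite !in_itv/= => /andP[->].
Qed.

Lemma trawl_is_derive (x : R) : 0 < x -> is_derive x 1 g (derive1 g x).
Proof.
by move=> x0; split; [exact: (trawl_derivable hg)|rewrite derive1E].
Qed.

(** The asymptotics of the derivative is integrated by monotonicity: beyond [x0] the difference [h]
    of [g] and [c1 * x^(- (1 + gamma))] is nondecreasing, and it lies below [g], which tends to 0,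
    so it is nonpositive. *)
Lemma trawl_le_powR : exists2 c : R, 0 < c & forall x : R, 1 <= x -> g x <= c * x `^ (- (1 + gamma)).
Proof.
have [Cg Cg0 hC] := trawl_derive_asymptotics hg.
have [I hI] := trawl_le_inv.
have [M [_ hM]] : \forall x \near +oo, x `^ (2 + gamma) * `|derive1 g x| < Cg + 1.
  by move/cvgr_lt : hC; apply; rewrite ltrDl.
pose x0 := Num.max M 1 + 1.
have x01 : 1 < x0 by rewrite /x0 ltrDr lt_max ltr01 orbT.
have x00 : 0 < x0 by exact: lt_trans x01.
have e0 : 0 < 1 + gamma by rewrite addr_gt0.
(* With this [c1] the comparison function has derivative [- (Cg + 1) * x^(- (2 + gamma))], which is
   below the derivative of [g] beyond [M]. *)
pose c1 := (Cg + 1) / (1 + gamma).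
have c10 : 0 < c1 by rewrite divr_gt0// addr_gt0.
pose h (x : R) : R := g x - c1 * x `^ (- (1 + gamma)).
pose dh (x : R) : R := derive1 g x - c1 * (- (1 + gamma) * x `^ (- (1 + gamma) - 1)).
have hder (x : R) : 0 < x -> is_derive x 1 h (dh x).
  move=> xp; apply: is_deriveB; first exact: trawl_is_derive.
  have := is_deriveZ (V := R^o) c1 (is_derive1_powR (- (1 + gamma)) xp); exact.
have dh0 (x : R) : x0 <= x -> 0 <= dh x.
  move=> xx0; have xp : 0 < x := lt_le_trans x00 xx0.
  have : x `^ (2 + gamma) * `|derive1 g x| < Cg + 1.
    apply: hM; apply: lt_le_trans xx0; rewrite /x0.
    by rewrite (@le_lt_trans _ _ (Num.max M 1))// ?le_max ?lexx// ltrDl.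
  rewrite mulrC -ltr_pdivlMr ?powR_gt0// => /ltW.
  rewrite ler_norml => /andP[h1 _].
  rewrite /dh mulNr mulrN opprK mulrA /c1 divfK ?gt_eqF//.
  rewrite (_ : - (1 + gamma) - 1 = - (2 + gamma)); last by ring.
  by rewrite powRN; move: h1; lra.
have hmono (x y : R) : x0 <= x -> x < y -> h x <= h y.
  move=> xx0 xy.
  have hd z : z \in `]x, y[ -> is_derive z 1 h (dh z).
    by rewrite in_itv/= => /andP[xz _]; apply: hder; rewrite (lt_trans _ xz)// (lt_le_trans x00).
  have hc : {within `[x, y], continuous h}.
    apply: derivable_within_continuous => z; rewrite in_itv/= => /andP[xz _].
    by have /hder[] : 0 < z by rewrite (lt_le_trans _ xz)// (lt_le_trans x00).
  have [z] := MVT xy hd hc; rewrite in_itv/= => /andP[xz _].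
  move/eqP; rewrite subr_eq addrC => /eqP ->; rewrite lerDl mulr_ge0//.
    by rewrite dh0// (le_trans xx0)// ltW.
  by rewrite subr_ge0 ltW.
have hle0 (x : R) : x0 <= x -> h x <= 0.
  move=> xx0; apply/ler_addgt0Pr => e ep; rewrite add0r.
  pose y := Num.max (x + 1) (`|I| / e).
  have y0 : 0 < y by rewrite lt_max addr_gt0// (lt_le_trans x00).
  apply: (@le_trans _ _ (h y)); first by rewrite hmono// lt_max ltrDl ltr01.
  apply: (@le_trans _ _ (g y)).
    by rewrite /h gerBl// mulr_ge0 ?powR_ge0// ltW.
  rewrite -(ler_pM2l y0) (le_trans (hI _ y0))// (le_trans (ler_norm _))//.
  by rewrite -ler_pdivrMr// le_max lexx orbT.
have K0 : 0 < x0 `^ (1 + gamma) by rewrite powR_gt0.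
have g00 : 0 < g 0 by exact: trawl_gt0.
(* The second summand takes care of [1 <= x < x0], where [g x <= g 0]. *)
exists (c1 + g 0 * x0 `^ (1 + gamma)); first by rewrite addr_gt0// mulr_gt0.
move=> x x1; have xp : 0 < x by exact: lt_le_trans x1.
have [xx0|xx0] := leP x0 x.
  have := hle0 _ xx0; rewrite subr_le0 => /le_trans; apply.
  by rewrite ler_wpM2r ?powR_ge0// lerDl mulr_ge0// ltW.
apply: (@le_trans _ _ (g 0)); first by rewrite trawl_nonincreasing// ltW.
rewrite powRN ler_pdivlMr ?powR_gt0//.
apply: (@le_trans _ _ (g 0 * x0 `^ (1 + gamma))); last by rewrite lerDr ltW.
by rewrite ler_pM2l// ge0_ler_powR// ?nnegrE ltW.
Qed.

(** For [y] above [g 0] the set is empty and for [y <= 0] it is unbounded. The default 0 is the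
    length of a horizontal section of a trawl set at any height without points; the single height 0
    is a null set. *)
Definition trawl_inv (y : R) : R :=
  if 0 < y <= g 0 then sup [set r | 0 <= r /\ y <= g r] else 0.
Local Notation rho := trawl_inv.

Let inv_set_has_sup y : 0 < y <= g 0 -> has_sup [set r | 0 <= r /\ y <= g r].
Proof.
move=> /andP[y0 yg]; split; first by exists 0.
have [I hI] := trawl_le_inv.
exists (`|I| / y) => r/= [r0 yr]; rewrite ler_pdivlMr//.
move: r0; rewrite le_eqVlt => /predU1P[<-|r0]; first by rewrite mul0r.
by rewrite (le_trans _ (ler_norm _))// (le_trans _ (hI _ r0))// ler_pM2l.
Qed.

(** If [g r < y], continuity keeps [g] below [y] on a left neighbourhood of [r], so the supremum
    cannot reach [r]. Such an [r] is positive because [g r < y <= g 0], and there differentiability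
    gives the continuity. *)
Lemma trawl_invP y r : 0 < y <= g 0 -> 0 <= r -> (r <= rho y) = (y <= g r).
Proof.
move=> yg r0; have hs := inv_set_has_sup yg; rewrite /rho yg.
set S := [set r | _]; apply/idP/idP => [rS|yr]; last exact: sup_upper_bound.
rewrite leNgt; apply/negP => gy.
have rp : 0 < r.
  rewrite lt_neqAle r0 andbT; apply/negP => /eqP r00.
  by move: yg gy; rewrite -r00 => /andP[_]; rewrite leNgt => /negP.
have cg : {for r, continuous g}.
  by apply: differentiable_continuous; apply/derivable1_diffP; exact: (trawl_derivable hg).
have /nbhs_ballP[e e0 he] : \forall z \near r, g z < y by exact: cvgr_lt cg _ gy.
pose e' := Num.min (e / 2) r.
have e'0 : 0 < e' by rewrite lt_min rp divr_gt0.
have [s [s0 ys] sS] := sup_adherent e'0 hs.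
have : g (r - e') < y.
  apply: he; rewrite /ball/= opprB addrC subrK gtr0_norm//.
  by rewrite gt_min; apply/orP; left; rewrite ltr_pdivrMr// mulr2n mulrDr mulr1 ltrDl.
rewrite ltNge => /negP; apply; apply: (le_trans ys); apply: trawl_nonincreasing.
  by rewrite subr_ge0 ge_min lexx orbT.
by rewrite (le_trans _ (ltW sS))// lerD2r.
Qed.

Lemma trawl_inv_ge0 y : 0 <= rho y.
Proof.
rewrite /rho; case: ifPn => // /inv_set_has_sup hs.
have [[r [r0 yr]] _] := hs; apply: (le_trans r0).
exact: sup_upper_bound.
Qed.

Lemma trawl_inv_out y : ~~ (0 < y <= g 0) -> rho y = 0.
Proof. by rewrite /rho => /negbTE ->. Qed.

Lemma trawl_inv_ge (a : R) : 0 < a -> [set y | a <= rho y] = [set` `]0, g a]].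
Proof.
move=> a0; apply/seteqP; split => y /=; rewrite in_itv/=.
  have [yg|/trawl_inv_out ->] := boolP (0 < y <= g 0); last by rewrite leNgt a0.
  by rewrite trawl_invP//; [case/andP: yg => -> | rewrite ltW].
move=> /andP[y0 ya]; rewrite trawl_invP//; last by rewrite ltW.
by rewrite y0 (le_trans ya)// trawl_nonincreasing// ltW.
Qed.

Lemma measurable_trawl_inv : measurable_fun setT rho.
Proof.
apply: (measurability (@RGenCInfty.G R)) => [|/= _ [_] [a] -> <-].
  exact: RGenCInfty.measurableE.
rewrite setTI; have [a0|a0] := leP a 0.
  rewrite (_ : _ @^-1` _ = setT)//; apply/seteqP; split => // y _ /=.
  by rewrite in_itv/= andbT (le_trans a0)// trawl_inv_ge0.
rewrite (_ : _ @^-1` _ = [set y | a <= rho y]).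
  by rewrite trawl_inv_ge//; exact: measurable_itv.
by apply/seteqP; split => y /=; rewrite in_itv/= andbT.
Qed.

(** The set where [rho] is at least [2 ^+ k] is []0, g (2 ^+ k)]], of length
    [O(2^(- k (1 + gamma)))], so the dyadic sum is geometric with ratio
    [2^(p - (1 + gamma)) < 1]. *)
Lemma trawl_inv_powR_lty (p : R) : 0 <= p -> p < 1 + gamma ->
  (\int[mu]_(y in `]0%R, g 0]) (rho y `^ p)%:E < +oo)%E.
Proof.
move=> p0 p1; have [c c0 hc] := trawl_le_powR.
have g0 := trawl_gt0 (lexx 0).
pose u k (y : R) : \bar R := ((2 ^+ k.+1) `^ p * (2 ^+ k <= rho y)%R%:R)%:E.
have u0 k y : (0 <= u k y)%E by rewrite lee_fin mulr_ge0// powR_ge0.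
have uE k : u k = fun y => (((2 ^+ k.+1) `^ p)%:E * (\1_(`]0, g (2 ^+ k)]) y)%:E)%E.
  apply/funext => y; rewrite /u EFinM indicE -trawl_inv_ge ?exprn_gt0//.
  congr (_ * (nat_of_bool _)%:R%:E)%E; apply/idP/idP; by rewrite inE.
have mu_ k : measurable_fun setT (u k).
  by rewrite uE; apply/measurable_funeM/measurable_EFinP; exact: measurable_indic.
have ik k : (\int[mu]_(y in `]0%R, g 0%R]) u k y <= (c * 2 `^ p * (2 `^ (p - (1 + gamma))) ^+ k)%:E)%E.
  rewrite uE ge0_integralZl; [|exact: measurable_itv| | |]; last 3 first.
  - by apply/measurable_EFinP; apply: measurable_funTS; exact: measurable_indic.
  - by move=> y _; rewrite lee_fin.
  - by rewrite lee_fin powR_ge0.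
  rewrite integral_indic//.
  have k1 : 1 <= 2 ^+ k :> R by rewrite exprn_ege1// ler1n.
  have k0 : 0 < 2 ^+ k :> R by rewrite exprn_gt0.
  apply: (@le_trans _ _ (((2 ^+ k.+1) `^ p)%:E * (g (2 ^+ k))%:E)%E).
    apply: lee_wpmul2l; first by rewrite lee_fin powR_ge0.
    apply: (@le_trans _ _ (mu `]0, g (2 ^+ k)])).
      by apply: le_measure => //; rewrite inE; [exact: measurableI|exact: measurable_itv].
    have gk := trawl_gt0 (ltW k0).
    by rewrite lebesgue_measure_itv/= lte_fin gk -EFinD subr0.
  rewrite -EFinM lee_fin.
  apply: (@le_trans _ _ ((2 ^+ k.+1) `^ p * (c * (2 ^+ k) `^ (- (1 + gamma))))).
    by rewrite ler_wpM2l ?powR_ge0// hc.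
  rewrite exprS powRM ?exprn_ge0// mulrCA [2 `^ p * _]mulrC -!mulrA mulrCA.
  apply: ler_of_eq.
  rewrite -[(2 `^ (p - (1 + gamma))) ^+ k]powR_mulrn ?powR_ge0//.
  rewrite -!powR_mulrn// -!powRrM !(mulrC k%:R) mulrBl powRD; last first.
    by apply/implyP => _; rewrite pnatr_eq0.
  by rewrite mulNr; ring.
apply: (@le_lt_trans _ _ (\int[mu]_(y in `]0%R, g 0%R]) (1 + \sum_(0 <= k <oo) u k y))%E).
  apply: ge0_le_integral => //.
  - by move=> y _; rewrite lee_fin powR_ge0.
  - apply/measurable_EFinP; apply: measurable_funTS.
    by apply: (measurableT_comp (measurable_powR _)); exact: measurable_trawl_inv.
  - apply: emeasurable_funD => //; apply: ge0_emeasurable_sum => // k _.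
    by apply: measurable_funTS; exact: mu_.
  - move=> y _; have [N hN] := exists_pow2_gt (rho y).
    apply: (@le_trans _ _ (1%:E + \sum_(0 <= k < N) u k y)%E).
      rewrite sumEFin -EFinD lee_fin big_mkord.
      exact: powR_dyadic_le (trawl_inv_ge0 y) p0 hN.
    by rewrite leeD2l//; exact: nneseries_lim_ge.
rewrite ge0_integralD//; last 2 first.
- by move=> y _; exact: nneseries_ge0.
- apply: ge0_emeasurable_sum => // k _; apply: measurable_funTS; exact: mu_.
rewrite integral_cst// lte_add_pinfty//.
  by rewrite /= lebesgue_measure_itv/= lte_fin g0 -EFinD mul1e ltry.
rewrite integral_nneseries//; last by move=> k; apply: measurable_funTS; exact: mu_.
apply: geometric_nneseries_lty ik.
- by rewrite mulr_ge0 ?powR_ge0// ltW.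
- rewrite powR_gt0//= /powR pnatr_eq0/= -[ltRHS]expR0 ltr_expR.
  by rewrite nmulr_rlt0 ?subr_lt0// ln_gt0// ltr1n.
- by move=> k; exact: integral_ge0.
Qed.

End trawl.

Section uniform_modulus.
Context {R : realType}.
Variable nu : {measure set R -> \bar R}.
Hypothesis hnu : symmetric_levy_measure nu.
Local Notation psi := (levy_exponent nu).
Hypothesis psi_sqr : forall e : R, 0 < e ->
  exists2 D : R, 0 < D & forall v, psi v <= e + D * v ^+ 2.

(** The balancing argument for continuity, now with [L] bounding [psi (a + b)] over the whole ball
    of radius [M], which makes [eta] independent of the points. *)
Lemma levy_exponent_uniform (M e : R) : 0 < e ->
  exists2 eta : R, 0 < eta & forall a b, `|a| <= M -> `|b| <= M -> `|a - b| <= eta ->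
    `|psi a - psi b| <= e.
Proof.
move=> e0; have [D D0 hD] := psi_sqr ltr01.
pose L := 1 + D * (2 * M) ^+ 2.
have L0 : 0 < L by rewrite ltr_pwDl// mulr_ge0 ?sqr_ge0// ltW.
pose lam := e / L; have lam0 : 0 < lam by rewrite divr_gt0.
have le20 : 0 < lam * e / 2 by rewrite divr_gt0// mulr_gt0.
have [D' D'0 hD'] := psi_sqr le20.
exists (Num.sqrt (lam * e / 2 / D')); first by rewrite sqrtr_gt0 divr_gt0.
move=> a b aM bM ab; rewrite (le_trans (levy_exponent_diff hnu _ _ lam0))//.
have h1 : psi (a + b) <= L.
  rewrite (le_trans (hD _))// lerD2l ler_pM2l//.
  rewrite -(real_normK (num_real (a + b))) ler_sqr ?nnegrE//.
    by rewrite (le_trans (ler_normD _ _))// mulr2n mulrDl mul1r lerD.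
  by rewrite mulr_ge0// (le_trans _ aM).
have h2 : psi (a - b) <= lam * e.
  rewrite (le_trans (hD' _))// {2}[lam * e]splitr lerD2l -ler_pdivlMl// mulrC.
  rewrite -ler_sqrt; last by rewrite ltW// divr_gt0.
  by rewrite sqrtr_sqr.
have h3 : lam * psi (a + b) <= e by rewrite /lam mulrAC ler_pdivrMr// ler_pM2l.
have h4 : lam^-1 * psi (a - b) <= e by rewrite ler_pdivrMl.
lra.
Qed.

End uniform_modulus.

(** * Horizontal sections of trawl sets and overlap lengths *)

Section trawl_geometry.
Context {R : realType}.
Variables (gamma : R) (g : R -> R).
Hypotheses (hgamma : 0 < gamma) (hg : trawl_function gamma g).
Local Notation mu := (@lebesgue_measure R).
Local Notation lam2 := (@lebesgue_measure R \x @lebesgue_measure R)%E.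
Local Notation rho := (trawl_inv g).

Lemma trawl_setP (t x y : R) : 0 < y ->
  trawl_set g t (x, y) <-> y <= g 0 /\ x <= t <= x + rho y.
Proof.
move=> y0; split => [[/= xt _ ygt]|[yg /andP[xt txr]]].
  have tx0 : 0 <= t - x by rewrite subr_ge0.
  have yg : y <= g 0 by rewrite (le_trans ygt)// (trawl_nonincreasing hg).
  split => //; rewrite xt/= -lerBlDl.
  by rewrite (trawl_invP hg) ?y0.
split => //=; first exact: ltW.
by rewrite -(trawl_invP hg) ?y0 ?subr_ge0// lerBlDl.
Qed.

Lemma measurable_fun_trawl_clamp (h : R * R -> R) : measurable_fun setT h ->
  measurable_fun setT (fun p => g (Num.max 0 (h p))).
Proof.
by move=> mh; apply: (measurableT_comp (trawl_clamp_measurable hg measurableT)).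
Qed.

Lemma measurable_ler_set d (T : measurableType d) (f h : T -> R) :
  measurable_fun setT f -> measurable_fun setT h -> measurable [set p | f p <= h p].
Proof.
move=> mf mh; rewrite -[X in measurable X]setTI.
exact: (measurable_fun_ler mf mh measurableT (Y := [set true])).
Qed.

Lemma measurable_trawl_set t : measurable (trawl_set g t).
Proof.
have m1 : measurable_fun setT (fun p : R * R => p.1) by exact: measurable_fst.
have m2 : measurable_fun setT (fun p : R * R => p.2) by exact: measurable_snd.
rewrite (_ : trawl_set g t = [set p | p.1 <= t] `&` ([set p | 0 <= p.2] `&`
    [set p | p.2 <= g (Num.max 0 (t - p.1))])).
  apply: measurableI; first exact: measurable_ler_set.
  apply: measurableI; first exact: measurable_ler_set.
  apply: measurable_ler_set => //; apply: measurable_fun_trawl_clamp.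
  exact: measurable_funB.
apply/seteqP; split => -[x y] /=.
  by move=> [/= xt y0 yg]; split => //; split => //; rewrite max_r// subr_ge0.
by move=> [xt [y0]]; rewrite max_r ?subr_ge0// => yg; split.
Qed.

(* Up to the null horizontal axis, all trawl sets [trawl_set g s] with [0 <= s <= tau] lie in this set. *)
Definition trawl_halo (tau : R) : set (R * R) :=
  [set p | p.1 <= tau /\ 0 < p.2 <= g (Num.max 0 (- p.1))].

Lemma trawl_haloP tau x y : 0 < y <= g 0 ->
  trawl_halo tau (x, y) <-> - rho y <= x <= tau.
Proof.
move=> yg; have /andP[y0 _] := yg; rewrite /trawl_halo/= y0/=.
rewrite -(trawl_invP hg yg) ?le_max ?lexx// ge_max (trawl_inv_ge0 hg)//= lerNl.
by split => [[-> ->]//|/andP[]].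
Qed.

Lemma trawl_halo_y tau x y : trawl_halo tau (x, y) -> 0 < y <= g 0.
Proof.
move=> [/= _ /andP[-> yg]]; rewrite (le_trans yg)//.
by rewrite (trawl_nonincreasing hg)// le_max lexx.
Qed.

Lemma measurable_trawl_halo tau : measurable (trawl_halo tau).
Proof.
have m1 : measurable_fun setT (fun p : R * R => p.1) by exact: measurable_fst.
have m2 : measurable_fun setT (fun p : R * R => p.2) by exact: measurable_snd.
rewrite (_ : trawl_halo tau = [set p | p.1 <= tau] `&` (~` [set p | p.2 <= 0] `&`
    [set p | p.2 <= g (Num.max 0 (- p.1))])).
  apply: measurableI; first exact: measurable_ler_set.
  apply: measurableI; first by apply: measurableC; exact: measurable_ler_set.
  apply: measurable_ler_set => //; apply: measurable_fun_trawl_clamp.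
  exact: measurable_funN.
apply/seteqP; split => -[x y] /=.
  by move=> [/= xt /andP[y0 yg]]; split => //; split => //; apply/negP; rewrite -ltNge.
by move=> [xt [/negP]]; rewrite -ltNge => y0 yg; split => //=; rewrite y0.
Qed.

(** A trawl set contains a whole half-line of this axis, where membership is not described by [rho].
    Having zero area, the axis is discarded throughout, whence the conditions [p.2 != 0]. *)
Definition horizontal_axis : set (R * R) := setT `*` [set 0].

Lemma measurable_horizontal_axis : measurable horizontal_axis.
Proof. exact: measurableX. Qed.

Lemma horizontal_axis_null : lam2 horizontal_axis = 0%E.
Proof.
by rewrite product_measure1E//= lebesgue_measure_set1 mule0.
Qed.

Lemma ae_off_axis (Q : R * R -> Prop) : (forall p, p.2 != 0 -> Q p) -> {ae lam2, forall p, Q p}.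
Proof.
move=> H; exists horizontal_axis; split.
- exact: measurable_horizontal_axis.
- exact: horizontal_axis_null.
- move=> p /= nQ; split => //=; apply/eqP; apply/negP => /negP p0; apply: nQ; exact: H.
Qed.

Lemma area_fubini (A : set (R * R)) : measurable A ->
  area A = (\int[mu]_y \int[mu]_x (\1_A (x, y))%:E)%E.
Proof.
move=> mA; transitivity (\int[lam2]_p (\1_A p)%:E)%E.
  by rewrite integral_indic// setIT.
by rewrite fubini_tonelli2//; apply/measurable_EFinP; apply: measurable_indic.
Qed.

Lemma area_trawl_halo tau : 0 <= tau ->
  area (trawl_halo tau) = (\int[mu]_(y in `]0%R, g 0%R]) (tau + rho y)%:E)%E.
Proof.
move=> t0; rewrite area_fubini; last exact: measurable_trawl_halo.
rewrite [RHS]integral_mkcond; apply: eq_integral => y _; rewrite patchE.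
case: ifPn => [|ny].
  rewrite inE/= in_itv/= => yg.
  transitivity (\int[mu]_x (\1_(`[- rho y, tau]) x)%:E)%E.
    apply: eq_integral => x _; rewrite !indicE; congr (_%:R%:E); congr nat_of_bool.
    by apply/idP/idP; rewrite !inE/= in_itv/=; [move/trawl_haloP; apply|move/trawl_haloP; apply].
  rewrite integral_indic//= setIT lebesgue_measure_itv/= lte_fin.
  have := trawl_inv_ge0 hg y; case: ltP => [_ _|h r0]; first by rewrite -EFinD opprK.
  by congr EFin; lra.
rewrite integral0_eq// => x _; rewrite indicE memNset// => /trawl_halo_y yg.
by move/negP : ny; apply; rewrite inE/= in_itv/=.
Qed.

(** The area is the integral of [tau + rho y] over the heights in []0, g 0]], finite by the power
    bound with exponent [1 < 1 + gamma]. *)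
Lemma finite_area_trawl_halo tau : 0 <= tau -> finite_area (trawl_halo tau).
Proof.
move=> t0; split; first exact: measurable_trawl_halo.
rewrite area_trawl_halo//.
have g0 := trawl_gt0 hg (lexx 0).
under eq_integral do rewrite EFinD.
rewrite ge0_integralD//; last 2 first.
- by move=> y _; rewrite lee_fin (trawl_inv_ge0 hg).
- apply/measurable_EFinP; apply: measurable_funTS; exact: (measurable_trawl_inv hg).
apply: lte_add_pinfty.
  by rewrite integral_cst//= lebesgue_measure_itv/= lte_fin g0 -EFinD -EFinM ltry.
have := @trawl_inv_powR_lty _ gamma g hgamma hg 1 ler01.
rewrite ltrDl => /(_ hgamma); apply: le_lt_trans.
apply: ler_of_eq; apply: eq_integral => y _.
by rewrite powRr1// (trawl_inv_ge0 hg).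
Qed.

Lemma trawl_set_halo tau s p : 0 <= s <= tau -> p.2 != 0 ->
  trawl_set g s p -> trawl_halo tau p.
Proof.
case: p => x y /andP[s0 st] /= y0 Asp; have [/= _ yge0 _] := Asp.
have yp : 0 < y by rewrite lt_neqAle eq_sym y0.
have [yg /andP[xs sx]] := (trawl_setP s x yp).1 Asp.
apply/trawl_haloP; first by rewrite yp.
by rewrite (le_trans xs st) andbT; lra.
Qed.

Lemma finite_area_trawl_set s : 0 <= s -> finite_area (trawl_set g s).
Proof.
move=> s0; have [mh fh] := finite_area_trawl_halo s0.
have mA := measurable_trawl_set s; split => //.
apply: (@le_lt_trans _ _ (lam2 (trawl_halo s `|` horizontal_axis))).
  apply: le_measure; rewrite ?inE//.
    by apply: measurableU => //; exact: measurable_horizontal_axis.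
  move=> p Ap; have [p0|p0] := eqVneq p.2 0; first by right; split.
  by left; apply: trawl_set_halo Ap => //; rewrite lexx s0.
apply: (le_lt_trans (measureU2 _ _ _)) => //; first exact: measurable_horizontal_axis.
have h0 : (lam2 horizontal_axis < +oo)%E by rewrite horizontal_axis_null.
exact: lte_add_pinfty.
Qed.

(* The length of [{s in [0, tau] | p \in trawl_set g s}]. *)
Definition trawl_overlap (tau : R) (p : R * R) : R :=
  Num.max 0 (Num.min tau (p.1 + rho p.2) - Num.max 0 p.1).

Lemma trawl_overlap_ge0 tau p : 0 <= trawl_overlap tau p.
Proof. by rewrite le_max lexx. Qed.

Lemma trawl_overlap_le_tau tau p : 0 <= tau -> trawl_overlap tau p <= tau.
Proof.
move=> t0; rewrite ge_max t0/= lerBlDr.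
rewrite (@le_trans _ _ tau)//; first by rewrite ge_min lexx.
by rewrite lerDl le_max lexx.
Qed.

Lemma trawl_overlap_le_inv tau p : trawl_overlap tau p <= rho p.2.
Proof.
rewrite ge_max (trawl_inv_ge0 hg)//= lerBlDr.
rewrite (@le_trans _ _ (p.1 + rho p.2))//; first by rewrite ge_min lexx orbT.
by rewrite addrC lerD2l le_max lexx orbT.
Qed.

Lemma trawl_overlap_out tau tau' p : tau <= tau' -> ~ trawl_halo tau' p -> trawl_overlap tau p = 0.
Proof.
case: p => x y tt np; apply/max_idPl => /=; rewrite subr_le0.
have [yg|/trawl_inv_out ->] := boolP (0 < y <= g 0); last first.
  by rewrite addr0 ge_min [X in _ || X]le_max lexx !orbT.
have := contra_not (trawl_haloP tau' x yg).2 np.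
move=> /negP; rewrite negb_and -!ltNge => /orP[xr|tx].
  rewrite ge_min; apply/orP; right; rewrite le_max; apply/orP; left; lra.
rewrite ge_min; apply/orP; left; rewrite le_max; apply/orP; right; lra.
Qed.

Lemma measurable_trawl_overlap tau : measurable_fun setT (trawl_overlap tau).
Proof.
have m1 : measurable_fun setT (fun p : R * R => p.1) by exact: measurable_fst.
have m2 : measurable_fun setT (fun p : R * R => p.2) by exact: measurable_snd.
apply: measurable_maxr => //; apply: measurable_funB; last exact: measurable_maxr.
apply: measurable_minr => //; apply: measurable_funD => //.
exact: (measurableT_comp (measurable_trawl_inv hg) m2).
Qed.

(** Off the axis, the times in [[0, tau]] whose trawl set contains [p] form an interval [[a, b]],
    possibly empty. The sample points in it are those [<= b] minus those [< a], and each count,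
    times [delta], is off by at most [delta], wherever the points sit in their cells. *)
Lemma trawl_overlap_riemann (n : nat) (delta tau : R) (u : nat -> R) (p : R * R) :
  0 < delta -> (forall k, (k < n)%N -> delta * k%:R <= u k <= delta * k.+1%:R) ->
  0 <= tau <= delta * n%:R -> p.2 != 0 ->
  `|delta * (\sum_(k < n) (u k <= tau)%R%:R * \1_(trawl_set g (u k)) p) - trawl_overlap tau p|
    <= 2 * delta.
Proof.
move=> d0 hu /andP[t0 tn] p0.
have u0 k : (k < n)%N -> 0 <= u k.
  by move=> kn; have /andP[h _] := hu _ kn; rewrite (le_trans _ h)// mulr_ge0// ltW.
have dd : 0 <= 2 * delta by rewrite mulr_ge0// ltW.
case: p p0 => x y /= y0; have [yg|nyg] := boolP (0 < y <= g 0); last first.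
  rewrite big1 ?mulr0; last first.
    move=> k _; rewrite indicE memNset ?mulr0// => A.
    have hs : 0 <= u k <= u k by rewrite lexx u0.
    by have := trawl_halo_y (trawl_set_halo (p := (x, y)) hs y0 A); rewrite (negbTE nyg).
  rewrite (@trawl_overlap_out tau tau)// ?subr0 ?normr0// => /trawl_halo_y.
  by rewrite (negbTE nyg).
have /andP[yp yg0] := yg.
pose a := Num.max 0 x; pose b := Num.min tau (x + rho y).
have indE k : (k < n)%N -> (u k <= tau)%R%:R * \1_(trawl_set g (u k)) (x, y) =
    (a <= u k <= b)%R%:R :> R.
  move=> kn; rewrite indicE -natrM mulnb; congr (_%:R); congr nat_of_bool.
  rewrite /a /b ge_max le_min u0//=.
  have -> : ((x, y) \in trawl_set g (u k)) = (x <= u k <= x + rho y).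
    by apply/idP/idP; rewrite inE; [move/(trawl_setP _ _ yp) => []|move=> h; apply/trawl_setP].
  by rewrite andbCA andbA [X in X && _]andbC -andbA.
have -> : \sum_(k < n) (u k <= tau)%R%:R * \1_(trawl_set g (u k)) (x, y) =
    \sum_(k < n) (a <= u k <= b)%R%:R :> R.
  by apply: eq_bigr => k _; rewrite indE.
rewrite /trawl_overlap/= -/a -/b.
have [ab|ba] := leP a b; last first.
  rewrite max_l ?subr_le0 ?(ltW ba)// big1 ?mulr0 ?subr0 ?normr0// => k _.
  by case: (boolP (_ <= _ <= _)) => // /andP[h1 h2]; have := le_trans h1 h2; rewrite leNgt ba.
rewrite max_r ?subr_ge0//.
have a0 : 0 <= a by rewrite le_max lexx.
have bt : b <= tau by rewrite ge_min lexx.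
have hb := @count_bounds R n delta b u (fun k => u k <= b) d0 hu (fun k => @ltW _ _ _ _) (fun k h => h).
have ha := @count_bounds R n delta a u (fun k => u k < a) d0 hu (fun k h => h) (fun k => @ltW _ _ _ _).
have -> : \sum_(k < n) (a <= u k <= b)%R%:R = \sum_(k < n) (u k <= b)%R%:R - \sum_(k < n) (u k < a)%R%:R :> R.
  rewrite -sumrB; apply: eq_bigr => k _.
  by case: (leP a (u k)) => h /=; rewrite ?subr0// (le_trans (ltW h) ab) subrr.
have {}hb := hb _; have {}ha := ha _.
have e1 : 0 <= b <= delta * n%:R by rewrite (le_trans a0 ab) (le_trans bt tn).
have e2 : 0 <= a <= delta * n%:R by rewrite a0 (le_trans ab)// (le_trans bt tn).
move: (hb e1) (ha e2); rewrite !ler_norml => /andP[? ?] /andP[? ?].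
by apply/andP; split; lra.
Qed.

End trawl_geometry.

Lemma expect_bounded_cvg {R : realType} d (T : measurableType d) (P : probability T R)
    (f : nat -> T -> R) (h : T -> R) (M : R) :
  (forall n, measurable_fun setT (f n)) -> measurable_fun setT h ->
  (forall n x, `|f n x| <= M) -> {ae P, forall x, f n x @[n --> \oo] --> h x} ->
  \int[P]_x f n x @[n --> \oo] --> \int[P]_x h x.
Proof.
move=> mf mh fM fh.
have iM : P.-integrable setT (EFin \o (fun=> M)) by apply: bdm_integrable => //; exact: bdm_cst.
have h1 n : measurable_fun setT (EFin \o f n) by apply/measurable_EFinP.
have h2 : measurable_fun setT (EFin \o h) by apply/measurable_EFinP.
have h3 : {ae P, forall x, setT x -> (EFin \o f n) x @[n --> \oo] --> (EFin \o h) x}.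
  by apply: filterS fh => x H _; apply: cvg_EFin => //; exact: nearW.
have h4 : {ae P, forall x n, setT x -> (`|(EFin \o f n) x| <= (EFin \o (fun=> M)) x)%E}.
  by apply: aeW => x n _; rewrite /= lee_fin.
have [ih _ H] := dominated_convergence measurableT h1 h2 h3 iM h4.
apply/fine_cvg; rewrite fineK; first exact: H.
exact: integrable_fin_num.
Qed.

(** * Stratified random sampling *)

Section fubini_bounded.
Context {R : realType} {d1 d2 : measure_display} {S : measurableType d1} {T : measurableType d2}.
Variables (Q : probability S R) (P : probability T R).
Variable f : S * T -> R.
Hypothesis bf : bdm f.

Let If : (Q \x P)%E.-integrable setT (EFin \o f).
Proof. exact: (@bdm_integrable R _ _ ((Q \x P)%E : probability _ R) f setT measurableT bf). Qed.

Let bf1 x : bdm (fun y => f (x, y)).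
Proof. exact: (bdm_comp bf (pair1_measurable x)). Qed.

Let bf2 y : bdm (fun x => f (x, y)).
Proof. exact: (bdm_comp bf (pair2_measurable y)). Qed.

Lemma bdm_average : bdm (fun y => \int[Q]_x f (x, y)).
Proof.
split.
  apply: (measurableT_comp (fine_measurable measurableT)).
  exact: (measurable_fubini_G If).
have [_ [M fM]] := bf; exists M => y.
have := @expect_diff_le _ _ _ Q _ (fun=> 0) M (bf2 y) (bdm_cst _).
by rewrite expect_cst subr0; apply => x; rewrite subr0.
Qed.

Lemma fubini_bounded : \int[P]_y \int[Q]_x f (x, y) = \int[Q]_x \int[P]_y f (x, y).
Proof.
have e1 : (\int[Q]_x \int[P]_y (f (x, y))%:E = \int[P]_y \int[Q]_x (f (x, y))%:E)%E := Fubini If.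
rewrite /Rintegral.
have a1 y : (fine (\int[Q]_x (f (x, y))%:E))%:E = (\int[Q]_x (f (x, y))%:E)%E.
  by rewrite fineK// integrable_fin_num//; exact: bdm_integrable.
have a2 x : (fine (\int[P]_y (f (x, y))%:E))%:E = (\int[P]_y (f (x, y))%:E)%E.
  by rewrite fineK// integrable_fin_num//; exact: bdm_integrable.
under eq_integral do rewrite a1.
by under [in RHS]eq_integral do rewrite a2; rewrite e1.
Qed.

End fubini_bounded.

Lemma expect_between {R : realType} d (T : measurableType d) (P : probability T R) (f : T -> R) (t e : R) :
  bdm f -> (forall x, `|f x - t| <= e) -> `|\int[P]_x f x - t| <= e.
Proof.
move=> bf H; rewrite -{1}(expect_cst P t); apply: expect_diff_le => //; exact: bdm_cst.
Qed.

Section sampling_average.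
Context {R : realType} {d1 d2 : measure_display} {S : measurableType d1} {T : measurableType d2}.
Variable P : probability T R.
Variables (Q : nat -> probability S R) (V : nat -> S * T -> R).
Hypothesis mV : forall k, measurable_fun setT (V k).
Variable delta : R.

Let c k w := \int[Q k]_u cos (delta * V k (u, w)).
Let s k w := \int[Q k]_u sin (delta * V k (u, w)).

(* [avg_cossin k w] is the pair of the real and imaginary parts of
   [\prod_(i < k) \int[Q i]_u exp (i delta V_i(u, w))]. *)
Fixpoint avg_cossin (k : nat) (w : T) : R * R :=
  if k is k'.+1 then
    let z := avg_cossin k' w in (z.1 * c k' w - z.2 * s k' w, z.2 * c k' w + z.1 * s k' w)
  else (1, 0).

(** The real part of [exp (i a)] times the product held in [avg_cossin]. *)
Definition avg_cos (k : nat) (a : R) (w : T) : R :=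
  cos a * (avg_cossin k w).1 - sin a * (avg_cossin k w).2.

Let bc k : bdm (c k).
Proof. by apply: (@bdm_average _ _ _ _ _ (Q k) P (fun p => cos (delta * V k p))); apply: bdm_cos; exact: measurable_funM. Qed.

Let bs k : bdm (s k).
Proof. by apply: (@bdm_average _ _ _ _ _ (Q k) P (fun p => sin (delta * V k p))); apply: bdm_sin; exact: measurable_funM. Qed.

Lemma bdm_avg_cossin k : bdm (fun w => (avg_cossin k w).1) /\ bdm (fun w => (avg_cossin k w).2).
Proof.
elim: k => [|k [h1 h2]] /=; first by split; exact: bdm_cst.
by split; [apply: bdmB|apply: bdmD]; exact: bdmM.
Qed.

Let mVw k w : measurable_fun setT (fun u => V k (u, w)).
Proof. exact: (measurableT_comp (mV k) (pair2_measurable w)). Qed.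

(** Averaging over one more sampling point acts on the phase alone; this allows the points to be
    frozen or averaged one at a time. *)
Lemma avg_cosS k a w :
  avg_cos k.+1 a w = \int[Q k]_u avg_cos k (a + delta * V k (u, w)) w.
Proof.
rewrite /avg_cos/=; set z := avg_cossin k w.
have bcos : bdm (fun u => cos (delta * V k (u, w))) by apply: bdm_cos; exact: measurable_funM.
have bsin : bdm (fun u => sin (delta * V k (u, w))) by apply: bdm_sin; exact: measurable_funM.
transitivity (\int[Q k]_u ((cos a * z.1 - sin a * z.2) * cos (delta * V k (u, w)) -
   (sin a * z.1 + cos a * z.2) * sin (delta * V k (u, w)))).
  rewrite expectB; [|by apply: bdmM => //; exact: bdm_cst|by apply: bdmM => //; exact: bdm_cst].
  by rewrite !expectZl// -/(c k w) -/(s k w); ring.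
by apply: eq_Rintegral => u _; rewrite cosD sinD; ring.
Qed.

Lemma measurable_avg_cos k (h : T -> R) : measurable_fun setT h ->
  bdm (fun w => avg_cos k (h w) w).
Proof.
move=> mh; have [h1 h2] := bdm_avg_cossin k.
by apply: bdmB; apply: bdmM => //; [exact: bdm_cos|exact: bdm_sin].
Qed.

Lemma bdm_avg_cos_param k w (h : S -> R) : measurable_fun setT h ->
  bdm (fun u => avg_cos k (h u) w).
Proof.
by move=> mh; apply: bdmB; apply: bdmM; try exact: bdm_cst; [exact: bdm_cos|exact: bdm_sin].
Qed.

Lemma avg_cos_le1 k a w : `|avg_cos k a w| <= 1.
Proof.
elim: k a => [|k ih] a.
  by rewrite /avg_cos/= mulr1 mulr0 subr0 ler_norml cos_geN1 cos_le1.
rewrite avg_cosS -[X in `|X|]subr0; apply: expect_between => [|u]; last by rewrite subr0.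
by apply: bdm_avg_cos_param; apply: measurable_funD => //; exact: measurable_funM.
Qed.

Variables (n : nat) (a t e : R).
Hypothesis sampled : forall u : nat -> S,
  `|\int[P]_w cos (a + delta * \sum_(k < n) V k (u k, w)) - t| <= e.

(* Replaces the averages [Q k] one at a time, from the last cell, by fixed points. *)
Lemma avg_cos_expectation : `|\int[P]_w avg_cos n a w - t| <= e.
Proof.
have mVu k u : measurable_fun setT (fun w => V k (u, w)).
  exact: (measurableT_comp (mV k) (pair1_measurable u)).
suff H i j : (i + j)%N = n -> forall u : nat -> S,
    `|\int[P]_w avg_cos i (a + delta * \sum_(i <= k < n) V k (u k, w)) w - t| <= e.
  have [u _] : exists u : nat -> S, True.
    by exists (fun=> point).
  have := H n 0%N (addn0 n) u; apply: le_trans.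
  apply: ler_of_eq; congr (`|_ - _|).
  by apply: eq_Rintegral => w _; rewrite big_geq// mulr0 addr0.
elim: i j => [|i ih] j ijn u.
  have := sampled u; apply: le_trans; apply: ler_of_eq.
  congr (`|_ - _|); apply: eq_Rintegral => w _.
  by rewrite /avg_cos/= mulr1 mulr0 subr0 big_mkord.
have iN : (i < n)%N by rewrite -ijn addSn ltnS leq_addr.
have mS : measurable_fun setT (fun w => \sum_(i.+1 <= k < n) V k (u k, w)).
  by apply: measurable_sum => k; exact: mVu.
pose F (p : S * T) := avg_cos i (a + delta * \sum_(i.+1 <= k < n) V k (u k, p.2) + delta * V i p) p.2.
have bF : bdm F.
  have [h1 h2] := bdm_avg_cossin i.
  have h3 := bdm_comp h1 (@measurable_snd _ _ S T).
  have h4 := bdm_comp h2 (@measurable_snd _ _ S T).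
  have mA : measurable_fun setT (fun p : S * T =>
      a + delta * \sum_(i.+1 <= k < n) V k (u k, p.2) + delta * V i p).
    apply: measurable_funD; last exact: measurable_funM.
    apply: measurable_funD => //; apply: measurable_funM => //.
    exact: (measurableT_comp mS (@measurable_snd _ _ S T)).
  by apply: bdmB; apply: bdmM => //; [exact: bdm_cos|exact: bdm_sin].
have -> : \int[P]_w avg_cos i.+1 (a + delta * \sum_(i.+1 <= k < n) V k (u k, w)) w =
    \int[Q i]_x \int[P]_w F (x, w).
  by rewrite -fubini_bounded//; apply: eq_Rintegral => w _; rewrite avg_cosS.
apply: expect_between => [|x].
  apply: (@bdm_average _ _ _ _ _ P (Q i) (fun p => F (p.2, p.1))).
  exact: (bdm_comp bF (@measurable_swap _ _ T S)).
pose u' k := if k == i then x else u k.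
have ij1 : (i + j.+1)%N = n by rewrite addnS -addSn.
have := ih j.+1 ij1 u'; apply: le_trans.
apply: ler_of_eq; congr (`|_ - _|).
apply: eq_Rintegral => w _; rewrite /F/=; congr avg_cos.
rewrite [in RHS]big_ltn// {1}/u' eqxx mulrDr [X in _ = _ + X]addrC addrA; congr (_ + _ * _ + _).
by apply: eq_big_nat => k /andP[ik _]; rewrite /u' gtn_eqF.
Qed.

End sampling_average.

Section sampling_pathwise.
Context {R : realType} {d1 d2 : measure_display} {S : measurableType d1} {T : measurableType d2}.
Variables (Q : nat -> probability S R) (V : nat -> S * T -> R).
Hypothesis mV : forall k, measurable_fun setT (V k).
Variable delta : R.

Lemma integrable_of_sqr (Q0 : probability S R) (v : S -> R) : measurable_fun setT v ->
  Q0.-integrable setT (EFin \o (fun u => v u ^+ 2)) -> Q0.-integrable setT (EFin \o v).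
Proof.
move=> mv iv; have i1 : Q0.-integrable setT (EFin \o (fun u => 1 + v u ^+ 2)).
  by apply: integrable_addr => //; apply: bdm_integrable => //; exact: bdm_cst.
apply: le_integrable i1 => //; first exact/measurable_EFinP.
move=> u _; rewrite /= lee_fin [leRHS]ger0_norm ?addr_ge0 ?sqr_ge0//.
rewrite -(real_normK (num_real (v u))).
by have := sqr_ge0 (`|v u| - 1); have := normr_ge0 (v u); nra.
Qed.

Lemma sqr_average_le (Q0 : probability S R) (v : S -> R) : measurable_fun setT v ->
  Q0.-integrable setT (EFin \o (fun u => v u ^+ 2)) ->
  (\int[Q0]_u v u) ^+ 2 <= \int[Q0]_u (v u ^+ 2).
Proof.
move=> mv iv; have i1 := integrable_of_sqr mv iv; set m := \int[Q0]_u v u.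
have : 0 <= \int[Q0]_u ((v u - m) ^+ 2) by apply: Rintegral_ge0 => u _; exact: sqr_ge0.
have -> : \int[Q0]_u ((v u - m) ^+ 2) = \int[Q0]_u (v u ^+ 2 + ((- (2 * m)) * v u + m ^+ 2)).
  by apply: eq_Rintegral => u _; ring.
have ic c : Q0.-integrable setT (EFin \o (fun=> c)) by apply: bdm_integrable => //; exact: bdm_cst.
rewrite RintegralD//; last by apply: integrable_addr => //; exact: integrable_mull.
rewrite RintegralD//; last exact: integrable_mull.
by rewrite RintegralZl// expect_cst -/m; lra.
Qed.

(** Both cosines are compared with the same first-order expansion at [b]. The linear terms agree
    because [v] and its mean have the same average, and each remainder is at most [2 * delta ^+ 2]
    times the mean of [v ^+ 2], for the second one by [sqr_average_le]. *)
Lemma average_cos_taylor (Q0 : probability S R) (v : S -> R) (b : R) : measurable_fun setT v ->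
  Q0.-integrable setT (EFin \o (fun u => v u ^+ 2)) ->
  `|\int[Q0]_u cos (b + delta * v u) - cos (b + delta * \int[Q0]_u v u)| <=
  4 * delta ^+ 2 * \int[Q0]_u (v u ^+ 2).
Proof.
move=> mv iv; have i1 := integrable_of_sqr mv iv; set m := \int[Q0]_u v u.
have bc : bdm (fun u => cos (b + delta * v u)).
  by apply: bdm_cos; apply: measurable_funD => //; exact: measurable_funM.
have ic c : Q0.-integrable setT (EFin \o (fun=> c)) by apply: bdm_integrable => //; exact: bdm_cst.
have icos : Q0.-integrable setT (EFin \o (fun u => cos (b + delta * v u))) by exact: bdm_integrable.
have h1 : `|\int[Q0]_u cos (b + delta * v u) - cos b + delta * m * sin b| <=
    2 * delta ^+ 2 * \int[Q0]_u (v u ^+ 2).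
  have -> : \int[Q0]_u cos (b + delta * v u) - cos b + delta * m * sin b =
      \int[Q0]_u (cos (b + delta * v u) - cos b + (delta * sin b) * v u).
    rewrite RintegralD//; [|exact: integrable_subr|exact: integrable_mull].
    by rewrite RintegralB// RintegralZl// expect_cst -/m; ring.
  apply: (le_trans (le_normr_Rintegral _ _)) => //.
    by apply: integrable_addr => //; [exact: integrable_subr|exact: integrable_mull].
  rewrite -RintegralZl//; apply: le_Rintegral => //.
  - apply: integrable_normr => //.
    by apply: integrable_addr => //; [exact: integrable_subr|exact: integrable_mull].
  - exact: integrable_mull.
  - move=> u _; have := cos_taylor_le b (delta * v u).
    by rewrite exprMn mulrA (mulrAC delta).
have h2 := cos_taylor_le b (delta * m).
have h3 := sqr_average_le mv iv; rewrite -/m in h3.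
have h4 : 2 * (delta * m) ^+ 2 <= 2 * delta ^+ 2 * \int[Q0]_u (v u ^+ 2).
  by rewrite exprMn mulrA ler_wpM2l// mulr_ge0// sqr_ge0.
rewrite (_ : _ - _ = (\int[Q0]_u cos (b + delta * v u) - cos b + delta * m * sin b)
   - (cos (b + delta * m) - cos b + delta * m * sin b)); last by ring.
rewrite (le_trans (ler_normB _ _))// (le_trans (lerD h1 (le_trans h2 h4)))//.
by apply: ler_of_eq; ring.
Qed.

Let mVw k w : measurable_fun setT (fun u => V k (u, w)).
Proof. exact: (measurableT_comp (mV k) (pair2_measurable w)). Qed.

(** The last cell is replaced by its mean with an error of order [delta ^+ 2], the others by
    induction under a shifted phase. For cells of length [delta] the total is [delta] times an
    integral of the square, which vanishes as the grid is refined. *)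
Lemma avg_cos_pathwise (n : nat) (a : R) (w : T) :
  (forall k, (k < n)%N -> (Q k).-integrable setT (EFin \o (fun u => V k (u, w) ^+ 2))) ->
  `|avg_cos Q V delta n a w - cos (a + delta * \sum_(k < n) \int[Q k]_u V k (u, w))| <=
  4 * delta ^+ 2 * \sum_(k < n) \int[Q k]_u (V k (u, w) ^+ 2).
Proof.
elim: n a => [|n ih] a iV.
  by rewrite !big_ord0 !mulr0 addr0 /avg_cos/= mulr1 mulr0 !subr0 subrr normr0.
have iVn : (Q n).-integrable setT (EFin \o (fun u => V n (u, w) ^+ 2)) by exact: iV.
have {}ih b := ih b (fun k kn => iV k (ltnW kn)).
rewrite !big_ord_recr/= avg_cosS//; set J := \sum_(k < n) _.
have bc : bdm (fun u => cos (a + J * delta + delta * V n (u, w))).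
  by apply: bdm_cos; apply: measurable_funD => //; exact: measurable_funM.
rewrite (le_trans (ler_distD (\int[Q n]_u cos (a + J * delta + delta * V n (u, w))) _ _))//.
rewrite [in leRHS]mulrDr lerD//.
  apply: expect_diff_le => //.
    by apply: bdm_avg_cos_param => //; apply: measurable_funD => //; exact: measurable_funM.
  move=> u; have := ih (a + delta * V n (u, w)).
  by rewrite -/J (_ : a + _ + delta * J = a + J * delta + delta * V n (u, w))//; ring.
have := @average_cos_taylor (Q n) (fun u => V n (u, w)) (a + J * delta) (mVw n w) iVn.
by rewrite mulrDr addrA [J * _]mulrC.
Qed.

End sampling_pathwise.

(** * Square integrability of paths from finite samples *)

Section square_integrable_paths.
Context {R : realType} {d1 d2 : measure_display} {S : measurableType d1} {T : measurableType d2}.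
Variables (Q : probability S R) (P : probability T R) (V : S * T -> R).
Hypothesis mV : measurable_fun setT V.

Let mVw w : measurable_fun setT (fun u => V (u, w)).
Proof. exact: (measurableT_comp mV (pair2_measurable w)). Qed.

Let mVu u : measurable_fun setT (fun w => V (u, w)).
Proof. exact: (measurableT_comp mV (pair1_measurable u)). Qed.

Lemma bdmX d (T0 : measurableType d) (f : T0 -> R) n : bdm f -> bdm (fun x => f x ^+ n).
Proof.
move=> bf; elim: n => [|n ih]; first by under eq_fun do rewrite expr0; exact: bdm_cst.
by under eq_fun do rewrite exprS; exact: bdmM.
Qed.

Let cos2 (c : R) (p : S * T) := cos (c * V p) ^+ 2.

Let bcos2 c : bdm (cos2 c).
Proof. by apply: bdmX; apply: bdm_cos; exact: measurable_funM. Qed.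

Let m c w := \int[Q]_u cos2 c (u, w).

Let bm c : bdm (m c).
Proof. exact: bdm_average. Qed.

(** The lower bound holds for every choice of the points, so it survives integrating them one by one
    against [Q]; each integrated point contributes a factor [m c w]. *)
Lemma expectation_power_average (c : R) (N : nat) (e : R) :
  (forall s : nat -> S, 1 - e <= \int[P]_w \prod_(k < N) cos (c * V (s k, w)) ^+ 2) ->
  1 - e <= \int[P]_w (m c w ^+ N).
Proof.
move=> H.
have bp u : bdm (fun w => cos2 c (u, w)) by exact: (bdm_comp (bcos2 c) (pair1_measurable u)).
suff K i j : (i + j)%N = N -> forall s : nat -> S,
    1 - e <= \int[P]_w ((\prod_(k < j) cos2 c (s k, w)) * m c w ^+ i).
  have := K N 0%N (addn0 N) (fun=> point); move/le_trans; apply.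
  apply: ler_of_eq.
  by apply: eq_Rintegral => w _; rewrite big_ord0 mul1r.
elim: i j => [|i ih] j ijN s.
  rewrite (le_trans (H s))// le_eqVlt; apply/orP; left; apply/eqP.
  by apply: eq_Rintegral => w _; rewrite expr0 mulr1 -ijN.
have bprod j' s' : bdm (fun w => \prod_(k < j') cos2 c (s' k, w)) by exact: bdm_prod.
pose F (p : S * T) := (\prod_(k < j) cos2 c (s k, p.2)) * m c p.2 ^+ i * cos2 c p.
have bF : bdm F.
  apply: bdmM => //; apply: bdmM; last exact: (bdm_comp (bdmX i (bm c)) (@measurable_snd _ _ S T)).
  exact: (bdm_comp (bprod j s) (@measurable_snd _ _ S T)).
have -> : \int[P]_w ((\prod_(k < j) cos2 c (s k, w)) * m c w ^+ i.+1) = \int[Q]_x \int[P]_w F (x, w).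
  rewrite -fubini_bounded//; apply: eq_Rintegral => w _; rewrite /F/= expectZl.
    by rewrite exprSr mulrA.
  exact: (bdm_comp (bcos2 c) (pair2_measurable w)).
rewrite -[leLHS](expect_cst Q); apply: le_expect; first exact: bdm_cst.
  apply: (@bdm_average _ _ _ _ _ P Q (fun p => F (p.2, p.1))).
  exact: (bdm_comp bF (@measurable_swap _ _ T S)).
move=> x; pose s' k := if k == j then x else s k.
have ij1 : (i + j.+1)%N = N by rewrite addnS -addSn.
have := ih j.+1 ij1 s'; rewrite /F/=; under eq_Rintegral do rewrite big_ord_recr/= {2}/s' eqxx.
move/le_trans; apply; apply: ler_of_eq.
apply: eq_Rintegral => w _; rewrite mulrAC; congr (_ * _ * _).
by apply: eq_bigr => k _; rewrite /s' ltn_eqF.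
Qed.


(** A Bernoulli-type inequality, used in the form: if [n * (1 - x) >= 1] then [x ^+ n <= 1 / 2]. *)
Lemma powerM_le (x : R) (n : nat) : 0 <= x <= 1 -> x ^+ n * (1 + n%:R * (1 - x)) <= 1.
Proof.
move=> /andP[x0 x1]; elim: n => [|n ih]; first by rewrite expr0 mul0r addr0 mulr1.
rewrite exprSr -mulrA; apply: le_trans ih; rewrite ler_wpM2l ?exprn_ge0//.
have -> : 1 + n%:R * (1 - x) = x * (1 + n.+1%:R * (1 - x)) + (1 - x) ^+ 2 * n.+1%:R.
  by rewrite -natr1; ring.
by rewrite lerDl mulr_ge0// sqr_ge0.
Qed.

(** The cutoff is the range where [sin z ^+ 2 >= z ^+ 2 / 4] is available for
    [z = theta * V / sqrt N.+1]. As [N] grows the truncation increases to [(theta * V) ^+ 2 / 4]. *)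
Let trunc (theta : R) (N : nat) (p : S * T) :=
  (theta * V p) ^+ 2 / 4 * ((theta * V p) ^+ 2 <= N.+1%:R)%R%:R.

Let trunc_ge0 theta N p : 0 <= trunc theta N p.
Proof. by rewrite mulr_ge0// divr_ge0// sqr_ge0. Qed.

Let btrunc theta N : bdm (trunc theta N).
Proof.
have mt : measurable_fun setT (fun p => (theta * V p) ^+ 2).
  by apply: measurable_funX; exact: measurable_funM.
split.
  apply: measurable_funM; first exact: measurable_funM.
  by apply: (bdm_measurable (bdm_boolr _)); exact: measurable_fun_ler.
exists N.+1%:R => p; rewrite ger0_norm// /trunc.
case: (leP ((theta * V p) ^+ 2)) => h; rewrite ?mulr1 ?mulr0//.
by rewrite (le_trans _ h)// ler_piMr ?sqr_ge0//; lra.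
Qed.

Let Gt theta N w := \int[Q]_u trunc theta N (u, w).

Let sqrt_scale (theta : R) (N : nat) v :
  (theta / Num.sqrt N.+1%:R * v) ^+ 2 = (theta * v) ^+ 2 / N.+1%:R.
Proof. by rewrite mulrAC expr_div_n sqr_sqrtr. Qed.

Let average_le theta N w :
  Gt theta N w <= N.+1%:R * (1 - m (theta / Num.sqrt N.+1%:R) w).
Proof.
set c := theta / _.
have b1 : bdm (fun u => cos2 c (u, w)) by exact: (bdm_comp (bcos2 c) (pair2_measurable w)).
have b2 : bdm (fun u => trunc theta N (u, w)) by exact: (bdm_comp (btrunc theta N) (pair2_measurable w)).
have -> : 1 - m c w = \int[Q]_u (1 - cos2 c (u, w)).
  by rewrite expectB ?expect_cst//; exact: bdm_cst.
rewrite -expectZl; last by apply: bdmB => //; exact: bdm_cst.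
apply: le_expect => //.
  by apply: bdmM; [exact: bdm_cst|apply: bdmB => //; exact: bdm_cst].
move=> u; rewrite /cos2 -sin2cos2 /trunc.
case: (leP ((theta * V (u, w)) ^+ 2)) => h; last first.
  by rewrite mulr0 mulr_ge0// sqr_ge0.
have h1 : `|c * V (u, w)| <= 1.
  rewrite -ler_sqr ?nnegrE// real_normK ?num_real// sqrt_scale expr1n.
  by rewrite ler_pdivrMr// mul1r.
have := sin_sqr_ge h1; rewrite sqrt_scale mulr1 => h2.
have n0 : 0 < N.+1%:R :> R by [].
rewrite -ler_pdivrMl//; apply: le_trans h2; apply: ler_of_eq.
by ring.
Qed.

(* Drawing the [s k] independently from [Q], the product averages to the [N.+1]-st
   power of [\int cos (theta / sqrt N.+1 * V) ^+ 2], which becomes small with [N]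
   where [V ^+ 2] has infinite integral. *)
Lemma square_integrable_paths :
  (forall e : R, 0 < e -> exists2 theta : R, 0 < theta &
    forall (N : nat) (s : nat -> S),
    1 - e <= \int[P]_w \prod_(k < N.+1) cos (theta / Num.sqrt N.+1%:R * V (s k, w)) ^+ 2) ->
  {ae P, forall w, Q.-integrable setT (EFin \o (fun u => V (u, w) ^+ 2))}.
Proof.
move=> H.
pose I w : \bar R := (\int[Q]_u ((V (u, w)) ^+ 2)%:E)%E.
have mV2 : measurable_fun setT (fun p => (V p ^+ 2)%:E).
  by apply/measurable_EFinP; exact: measurable_funX.
have mI : measurable_fun setT I.
  by apply: (measurable_fun_fubini_tonelli_G (fun p => (V p ^+ 2)%:E)) => // p; rewrite lee_fin sqr_ge0.
pose Bad := [set w | I w = +oo%E].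
have mBad : measurable Bad by rewrite -[Bad]setTI; exact: (mI measurableT [set +oo%E]).
suff PB : P Bad = 0%E.
  exists Bad; split => // w /= nI; apply: contrapT => Ioo; apply: nI.
  apply/integrableP; split.
    by apply/measurable_EFinP; apply: measurable_funX.
  under eq_integral do rewrite /= ger0_norm ?sqr_ge0//.
  by rewrite ltey; apply/eqP.
suff Pe e : 0 < e -> (P Bad <= (2 * e)%:E)%E.
  apply/eqP; rewrite eq_le measure_ge0 andbT; apply/lee_addgt0Pr => e e0; rewrite add0e.
  by rewrite (_ : e = 2 * (e / 2)); [exact/Pe/divr_gt0|rewrite mulrC divfK].
move=> e0; have [theta th0 Hth] := H e e0.
have bG N : bdm (Gt theta N) by exact: (@bdm_average _ _ _ _ _ Q P _ (btrunc theta N)).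
(* On [A N], [average_le] gives [N.+1 * (1 - m) >= 1], hence [m ^+ N.+1 <= 1 / 2], and the lower
   bound on the mean of this power leaves the event a probability of at most [2 * e]. The events
   increase with [N] and cover [Bad] by monotone convergence, so the bound passes to [Bad]. *)
pose A N := [set w | 1 <= Gt theta N w].
have mA N : measurable (A N).
  rewrite -[X in measurable X]setTI.
  exact: (measurable_fun_ler (measurable_cst _) (bdm_measurable (bG N)) measurableT (Y := [set true])).
have btr N w : bdm (fun u => trunc theta N (u, w)).
  exact: (bdm_comp (btrunc theta N) (pair2_measurable w)).
have trnd N M p : (N <= M)%N -> trunc theta N p <= trunc theta M p.
  move=> NM; rewrite ler_wpM2l ?divr_ge0 ?sqr_ge0//.
  case: (leP ((theta * V p) ^+ 2) N.+1%:R) => h //=.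
  by rewrite (le_trans h) ?ler_nat.
have ndA : nondecreasing_seq A.
  move=> N M NM; apply/subsetPset => w; rewrite /A/= => /le_trans; apply.
  by apply: le_expect => // u; exact: trnd.
have PA N : (P (A N) <= (2 * e)%:E)%E.
  have := expectation_power_average (Hth N); set c := theta / _ => h.
  have bmc : bdm (fun w => m c w ^+ N.+1) by exact: bdmX.
  have m01 w : 0 <= m c w <= 1.
    have b1 : bdm (fun u => cos2 c (u, w)) by exact: (bdm_comp (bcos2 c) (pair2_measurable w)).
    apply/andP; split; first by apply: Rintegral_ge0 => u _; exact: sqr_ge0.
    rewrite -[leRHS](expect_cst Q); apply: le_expect => //; first exact: bdm_cst.
    by move=> u; rewrite /cos2 cos2sin2 gerBl sqr_ge0.
  have h2 : \int[P]_w (\1_(A N) w) <= \int[P]_w (2 * (1 - m c w ^+ N.+1)).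
    apply: le_expect; first exact: bdm_indic.
      by apply: bdmM; [exact: bdm_cst|apply: bdmB => //; exact: bdm_cst].
    move=> w; have /andP[m0 m1] := m01 w; rewrite indicE; case: (boolP (w \in A N)) => [|_] /=.
      rewrite inE => /= Gw; have := average_le theta N w; rewrite -/c => /(le_trans Gw) k1.
      have := powerM_le N.+1 (m01 w); have := exprn_ge0 N.+1 m0; nra.
    by rewrite mulr_ge0// subr_ge0 exprn_ile1.
  move: h2; rewrite expect_indic// expectZl; last by apply: bdmB => //; exact: bdm_cst.
  rewrite expectB//; last exact: bdm_cst.
  rewrite expect_cst => h2; rewrite -[leLHS]fineK ?fin_num_measure// lee_fin; lra.
have sub : Bad `<=` \bigcup_N A N.
  move=> w Iw; apply: contrapT => nA.
  have G1 N : Gt theta N w < 1.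
    by rewrite ltNge; apply/negP => h; apply: nA; exists N.
  have lim1 : (\int[Q]_u ((theta * V (u, w)) ^+ 2 / 4)%:E <= 1)%E.
    have cv : (\int[Q]_u (trunc theta N (u, w))%:E)%E @[N --> \oo] -->
        (\int[Q]_u (limn (fun N => (trunc theta N (u, w))%:E)))%E.
      apply: cvg_monotone_convergence => //.
      - by move=> N; apply/measurable_EFinP; exact: (bdm_measurable (btr N w)).
      - by move=> N u _; rewrite lee_fin.
      - by move=> u _ N M NM; rewrite lee_fin; exact: trnd.
    rewrite (eq_integral (fun u => limn (fun N => (trunc theta N (u, w))%:E))); last first.
      move=> u _; apply/esym/cvg_lim => //.
      have [M hM] := exists_nat_gt ((theta * V (u, w)) ^+ 2).
      apply: cvg_near_cst; exists M => //= N /= MN; rewrite /trunc.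
      by rewrite (le_trans (ltW hM)) ?ler_nat ?mulr1// (leq_trans MN).
    rewrite -(cvg_lim _ cv)//; apply: lime_le; first exact: (cvgP _ cv).
    apply: nearW => N; have := G1 N; rewrite /Gt /Rintegral => h.
    rewrite -[leLHS]fineK; first by rewrite lee_fin ltW.
    by apply: integrable_fin_num => //; exact: bdm_integrable.
  move: Iw; rewrite /Bad/=; apply/eqP; rewrite -ltey.
  have -> : I w = ((4 / theta ^+ 2)%:E * \int[Q]_u ((theta * V (u, w)) ^+ 2 / 4)%:E)%E.
    rewrite -ge0_integralZl//.
    - apply: eq_integral => u _; rewrite -EFinM; congr EFin; field.
      by rewrite gt_eqF.
    - by apply/measurable_EFinP; apply: measurable_funM => //; apply: measurable_funX; exact: measurable_funM.
    - by move=> u _; rewrite lee_fin divr_ge0// sqr_ge0.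
    - by rewrite lee_fin divr_ge0// sqr_ge0.
  rewrite lte_mul_pinfty//; first by rewrite lee_fin divr_ge0// sqr_ge0.
  exact: le_lt_trans lim1 (ltry _).
have mU : measurable (\bigcup_N A N) by exact: bigcup_measurable.
apply: (@le_trans _ _ (P (\bigcup_N A N))); first by apply: le_measure => //; rewrite inE.
have cv := nondecreasing_cvg_mu (mu := P) mA mU ndA.
rewrite -(cvg_lim _ cv)//; apply: lime_le; first exact: (cvgP _ cv).
by apply: nearW => N; exact: PA.
Qed.

End square_integrable_paths.

Lemma expR_opp_diff_le {R : realType} (x y : R) : 0 <= x -> 0 <= y ->
  `|expR (- x) - expR (- y)| <= `|x - y|.
Proof.
wlog xy : x y / x <= y => [H x0 y0|x0 y0].
  have [xy|/ltW yx] := leP x y; first exact: H.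
  by rewrite distrC [leRHS]distrC; exact: H.
rewrite ger0_norm; last by rewrite subr_ge0 ler_expR lerN2.
rewrite ler0_norm ?subr_le0// opprB.
have e1 : expR (- y) = expR (- x) * expR (- (y - x)) by rewrite -expRD; congr expR; ring.
have h1 := expR_ge1Dx (- (y - x)).
have h2 : expR (- x) <= 1 by rewrite -[leRHS]expR0 ler_expR oppr_le0.
have h3 := expR_ge0 (- x).
rewrite e1 -[X in X - _]mulr1 -mulrBr.
rewrite (@le_trans _ _ (1 * (1 - expR (- (y - x)))))//; last by rewrite mul1r; lra.
rewrite ler_wpM2r// subr_ge0 -[leRHS]expR0 ler_expR oppr_le0 subr_ge0//.
Qed.

(** * The characteristic function of the integrated trawl process *)

Section halo_energy.
Context {R : realType}.
Variable nu : {measure set R -> \bar R}.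
Hypothesis hnu : symmetric_levy_measure nu.
Local Notation psi := (levy_exponent nu).
Local Notation mu := (@lebesgue_measure R).
Local Notation lam2 := (@lebesgue_measure R \x @lebesgue_measure R)%E.
Hypothesis psi_sqr : forall e : R, 0 < e ->
  exists2 D : R, 0 < D & forall v, psi v <= e + D * v ^+ 2.
Hypothesis mpsi : measurable_fun setT psi.
Variables (gamma : R) (g : R -> R).
Hypotheses (hgamma : 0 < gamma) (hg : trawl_function gamma g).
Variables (tau : R) (tau0 : 0 <= tau).

Definition supported_on_halo (f : R * R -> R) :=
  forall p, p.2 != 0 -> ~ trawl_halo g tau p -> f p = 0.

(** A real integral over a region of finite area, where bounded functions are integrable, whereas
    [energy] is extended-real over the whole plane. For functions supported on the halo the two
    agree. *)
Definition halo_energy (f : R * R -> R) : R :=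
  \int[lam2]_(p in trawl_halo g tau) psi (f p).

Let mH : measurable (trawl_halo g tau).
Proof. exact: (measurable_trawl_halo hg). Qed.

Let fH := finite_area_trawl_halo hgamma hg tau0.

Lemma halo_integrable (f : R * R -> R) : bdm f ->
  lam2.-integrable (trawl_halo g tau) (EFin \o f).
Proof.
move=> [mf [M fM]]; apply: measurable_bounded_integrable => //.
- exact: fH.2.
- exact: measurable_funTS.
- exists M; split=> [|x Mx p _]; first exact: num_real.
  exact: (le_trans (fM p) (ltW Mx)).
Qed.

Lemma bdm_levy_exponent (f : R * R -> R) : bdm f -> bdm (fun p => psi (f p)).
Proof.
move=> [mf [M fM]]; split; first exact: measurableT_comp.
have [D D0 hD] := psi_sqr ltr01; exists (1 + D * M ^+ 2) => p.
rewrite ger0_norm ?levy_exponent_ge0// (le_trans (hD _))// lerD2l ler_pM2l//.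
by rewrite -(real_normK (num_real (f p))) ler_sqr ?nnegrE// (le_trans _ (fM p)).
Qed.

Lemma halo_energyE (f : R * R -> R) : measurable_fun setT f -> supported_on_halo f ->
  fine (energy nu f) = halo_energy f.
Proof.
move=> mf sf; rewrite /halo_energy /Rintegral; congr fine.
have mE : measurable_fun setT (fun p => (psi (f p))%:E).
  by apply/measurable_EFinP; exact: measurableT_comp.
rewrite /energy [RHS]integral_mkcond; apply: ae_eq_integral => //.
- by apply/(measurable_restrictT _ mH); exact: measurable_funTS.
- apply: (@ae_off_axis R) => p p0 _; rewrite /patch; case: ifPn => //.
  by rewrite notin_setE => nH; rewrite sf// levy_exponent0.
Qed.

Lemma halo_energy_ge0 f : 0 <= halo_energy f.
Proof. by apply: Rintegral_ge0 => p _; exact: levy_exponent_ge0. Qed.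

Lemma halo_Rintegral_cst (c : R) :
  \int[lam2]_(p in trawl_halo g tau) c = c * fine (area (trawl_halo g tau)).
Proof. by rewrite Rintegral_cst. Qed.

Lemma halo_RintegralD (f h : R * R -> R) : bdm f -> bdm h ->
  \int[lam2]_(p in trawl_halo g tau) (f p + h p) =
  \int[lam2]_(p in trawl_halo g tau) f p + \int[lam2]_(p in trawl_halo g tau) h p.
Proof. by move=> bf bh; rewrite RintegralD//; exact: halo_integrable. Qed.

Lemma halo_energy_close (f h : R * R -> R) (e : R) : bdm f -> bdm h -> 0 <= e ->
  (forall p, p.2 != 0 -> `|psi (f p) - psi (h p)| <= e) ->
  `|halo_energy f - halo_energy h| <= e * fine (area (trawl_halo g tau)).
Proof.
move=> bf bh e0 H.
have i1 := halo_integrable (bdm_levy_exponent bf).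
have i2 := halo_integrable (bdm_levy_exponent bh).
rewrite /halo_energy -RintegralB// -halo_Rintegral_cst.
have i3 : lam2.-integrable (trawl_halo g tau) (EFin \o (fun p => psi (f p) - psi (h p))).
  by apply: integrable_subr.
rewrite (le_trans (le_normr_Rintegral _ i3))//.
apply: le_Rintegral => //; first exact: integrable_normr.
  by apply: halo_integrable; exact: bdm_cst.
move=> p Hp; apply: H.
by have := trawl_halo_y hg (tau := tau) (x := p.1) (y := p.2); case: p Hp => x y Hp /(_ Hp) /andP[/gt_eqF ->].
Qed.

Lemma halo_energy_le_sqr (f : R * R -> R) (e D : R) : bdm f ->
  (forall v, psi v <= e + D * v ^+ 2) ->
  halo_energy f <= \int[lam2]_(p in trawl_halo g tau) (e + D * f p ^+ 2).
Proof.
move=> bf H; apply: le_Rintegral => //; apply: halo_integrable.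
- exact: bdm_levy_exponent.
- by apply: bdmD; [exact: bdm_cst|apply: bdmM; [exact: bdm_cst|exact: bdmX]].
Qed.

End halo_energy.

Section trawl_process_charf.
Context {R : realType}.
Variable nu : {measure set R -> \bar R}.
Hypothesis hnu : symmetric_levy_measure nu.
Context d (Om : measurableType d) (P : probability Om R).
Variable Lambda : set (R * R) -> {RV P >-> R}.
Hypothesis hLambda : levy_basis nu Lambda.
Local Notation psi := (levy_exponent nu).
Local Notation mu := (@lebesgue_measure R).
Local Notation lam2 := (@lebesgue_measure R \x @lebesgue_measure R)%E.
Hypothesis psi_sqr : forall e : R, 0 < e ->
  exists2 D : R, 0 < D & forall v, psi v <= e + D * v ^+ 2.
Hypothesis mpsi : measurable_fun setT psi.
Variables (gamma : R) (g : R -> R).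
Hypotheses (hgamma : 0 < gamma) (hg : trawl_function gamma g).
Variables (X : R -> Om -> R) (hX : trawl_process Lambda g X).
Variables (tau : R) (tau0 : 0 < tau).
Local Notation H := (trawl_halo g tau).
Let tau_ge0 := ltW tau0.

(** Joint measurability of [X] is granted for nonnegative times only, while sampling needs a
    measurable function on the full product; the value 0 outside [[0, tau]] provides it. *)
Definition truncated_process (tau : R) (p : R * Om) : R :=
  if 0 <= p.1 <= tau then X p.1 p.2 else 0.

Lemma measurable_truncated_process t : measurable_fun setT (truncated_process t).
Proof.
have mD : measurable [set p : R * Om | 0 <= p.1 <= t].
  rewrite (_ : [set _ | _] = (`[0, t] : set R) `*` (setT : set Om)).
    exact: measurableX.
  by apply/seteqP; split => -[x w] /=; rewrite in_itv/=; [|case].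
rewrite (_ : truncated_process t = (fun p => X p.1 p.2) \_ [set p : R * Om | 0 <= p.1 <= t]).
  apply/(measurable_restrictT (fun p : R * Om => X p.1 p.2) mD).
  have mE : measurable [set p : R * Om | 0 <= p.1].
    rewrite (_ : [set _ | _] = (`[0, +oo[ : set R) `*` (setT : set Om)).
      exact: measurableX.
    by apply/seteqP; split => -[x w] /=; rewrite in_itv/= andbT; [|case].
  apply: (measurable_funS mE _ (trawl_process_measurable hX)).
  by move=> p /= /andP[].
apply/funext => p; rewrite /truncated_process /patch.
by case: (boolP (0 <= p.1 <= t)) => h; [rewrite mem_set|rewrite memNset//; exact/negP].
Qed.

Let V := truncated_process tau.

(** The kernel whose integral against the Levy basis is formally the value of [V] at time [s]. *)
Let chi (s : R) (p : R * R) : R := (0 <= s <= tau)%R%:R * \1_(trawl_set g s) p.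

Let bchi s : bdm (chi s).
Proof.
apply: bdmM; first exact: bdm_cst.
by apply: bdm_indic; exact: (measurable_trawl_set hg).
Qed.

Let chi_supp s : supported_on_halo g tau (chi s).
Proof.
move=> p p0 nH; rewrite /chi; case: (boolP (0 <= s <= tau)) => st; last by rewrite mul0r.
rewrite indicE memNset ?mulr0// => A; apply: nH; exact: (trawl_set_halo hg st p0 A).
Qed.

Let chi01 s p : 0 <= chi s p <= 1.
Proof.
by rewrite /chi indicE; case: (0 <= s <= tau); case: (p \in _);
  rewrite /= ?mul0r ?mulr0 ?mulr1 ?lexx ?ler01.
Qed.

Lemma truncated_process_charf (J : finType) (s b : J -> R) (a : R) :
  \int[P]_w cos (a + \sum_j b j * V (s j, w)) =
  cos a * expR (- halo_energy nu g tau (fun p => \sum_j b j * chi (s j) p)).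
Proof.
(* Times outside [[0, tau]] are moved to 0 with coefficient 0, so that every trawl set involved has
   finite area and [trawl_process_version] applies. *)
pose s' j := if 0 <= s j <= tau then s j else 0.
pose b' j := b j * (0 <= s j <= tau)%R%:R.
have s'0 j : 0 <= s' j by rewrite /s'; case: ifPn => // /andP[].
rewrite -(halo_energyE mpsi hg)//; last 2 first.
- by apply: (bdm_measurable (bdm_sum _ _)) => j; apply: bdmM => //; exact: bdm_cst.
- by move=> p p0 nH; rewrite big1// => j _; rewrite chi_supp// mulr0.
have -> : (fun p => \sum_j b j * chi (s j) p) = (fun p => \sum_j b' j * \1_(trawl_set g (s' j)) p).
  apply/funext => p; apply: eq_bigr => j _; rewrite /chi /b' /s' mulrA.
  by case: (0 <= s j <= tau); rewrite ?mulr1// !mulr0 !mul0r.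
rewrite -(levy_basis_simple_charf hLambda (fun j => finite_area_trawl_set hgamma hg (s'0 j))).
have mXs t : measurable_fun setT (fun w => V (t, w)).
  exact: (measurableT_comp (measurable_truncated_process tau) (pair1_measurable t)).
apply: expect_ae_eq.
- apply: (bdm_measurable (bdm_cos _)); apply: measurable_funD => //.
  by apply: measurable_sum => j; exact: measurable_funM.
- apply: (bdm_measurable (bdm_cos _)); apply: measurable_funD => //.
  by apply: measurable_sum => j; exact: measurable_funM.
have [l lJ] : exists l : seq J, forall j, j \in l by exists (enum J) => j; rewrite mem_enum.
suff : {ae P, forall w, forall j, j \in l -> X (s' j) w = Lambda (trawl_set g (s' j)) w}.
  apply: filterS => w Hw; congr (cos (_ + _)); apply: eq_bigr => j _.
  rewrite -(Hw j (lJ j)) /b' /s' /V /truncated_process/=.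
  by case: (0 <= s j <= tau); rewrite ?mulr1// !mulr0 mul0r.
elim: (l) => [|i r ih]; first by apply: aeW.
apply: filterS2 ih (trawl_process_version hX (s'0 i)) => w H1 H2 j.
by rewrite inE => /predU1P[->//|]; exact: H1.
Qed.

(* [cos x ^+ 2 = (1 + cos (2 x)) / 2] turns each squared factor into an average of
   shifted frequencies, so the induction generates only characteristic functions. *)
Lemma truncated_process_cos2_ge (N : nat) (s : 'I_N -> R) (c e D : R) :
  (forall v, psi v <= e + D * v ^+ 2) -> 0 <= D ->
  forall (r : seq 'I_N) (b : 'I_N -> R),
  1 - \int[lam2]_(p in H) (e + D * ((\sum_j b j * chi (s j) p) ^+ 2 + 2 * (size r)%:R * c ^+ 2)) <=
  \int[P]_w (cos (\sum_j b j * V (s j, w)) * \prod_(k <- r) cos (c * V (s k, w)) ^+ 2).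
Proof.
move=> hD D0.
have bh b : bdm (fun p => \sum_j b j * chi (s j) p).
  by apply: bdm_sum => j; apply: bdmM => //; exact: bdm_cst.
have mXs t : measurable_fun setT (fun w => V (t, w)).
  exact: (measurableT_comp (measurable_truncated_process tau) (pair1_measurable t)).
have mS b : measurable_fun setT (fun w => \sum_j b j * V (s j, w)).
  by apply: measurable_sum => j; exact: measurable_funM.
have bP r : bdm (fun w => \prod_(k <- r) cos (c * V (s k, w)) ^+ 2).
  by apply: bdm_prod => k; apply: bdmX; apply: bdm_cos; exact: measurable_funM.
have iH f : bdm f -> lam2.-integrable H (EFin \o f) by exact: (halo_integrable hgamma hg tau_ge0).
have bB b m : bdm (fun p => e + D * ((\sum_j b j * chi (s j) p) ^+ 2 + m)).
  apply: bdmD; first exact: bdm_cst.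
  apply: bdmM; first exact: bdm_cst.
  by apply: bdmD; [exact: bdmX|exact: bdm_cst].
elim=> [|k r ih] b.
  under [X in _ <= X]eq_Rintegral do rewrite big_nil mulr1 -[X in cos X]add0r.
  rewrite truncated_process_charf cos0 mul1r (le_trans _ (expR_ge1Dx _))// lerD2l lerN2.
  have := halo_energy_le_sqr psi_sqr mpsi hgamma hg tau_ge0 (bh b) hD.
  move/le_trans; apply; apply: ler_of_eq.
  by apply: eq_Rintegral => p _; rewrite mulr0 mul0r addr0.
pose bp j := b j + (j == k)%:R * (2 * c); pose bm j := b j - (j == k)%:R * (2 * c).
have sumE (F : 'I_N -> R) : \sum_j (j == k)%:R * (2 * c) * F j = 2 * c * F k.
  rewrite (bigD1 k)//= eqxx mul1r big1 ?addr0// => j /negbTE ->.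
  by rewrite !mul0r.
have bpE F : \sum_j bp j * F j = \sum_j b j * F j + 2 * c * F k.
  by rewrite -sumE -big_split/=; apply: eq_bigr => j _; rewrite mulrDl.
have bmE F : \sum_j bm j * F j = \sum_j b j * F j - 2 * c * F k.
  by rewrite -sumE -sumrB/=; apply: eq_bigr => j _; rewrite mulrBl.
have -> : \int[P]_w (cos (\sum_j b j * V (s j, w)) * \prod_(i <- k :: r) cos (c * V (s i, w)) ^+ 2) =
   2^-1 * \int[P]_w (cos (\sum_j b j * V (s j, w)) * \prod_(i <- r) cos (c * V (s i, w)) ^+ 2) +
   (4^-1 * \int[P]_w (cos (\sum_j bp j * V (s j, w)) * \prod_(i <- r) cos (c * V (s i, w)) ^+ 2) +
   4^-1 * \int[P]_w (cos (\sum_j bm j * V (s j, w)) * \prod_(i <- r) cos (c * V (s i, w)) ^+ 2)).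
  have bb b0 : bdm (fun w => cos (\sum_j b0 j * V (s j, w)) * \prod_(i <- r) cos (c * V (s i, w)) ^+ 2).
    by apply: bdmM => //; exact: bdm_cos.
  have bbM q b0 : bdm (fun w => q * (cos (\sum_j b0 j * V (s j, w)) * \prod_(i <- r) cos (c * V (s i, w)) ^+ 2)).
    by apply: bdmM => //; exact: bdm_cst.
  rewrite -!expectZl// -expectD// -expectD//; last exact: bdmD.
  apply: eq_Rintegral => w _; rewrite big_cons bpE bmE cosD cosB.
  have -> : cos (2 * c * V (s k, w)) = 2 * cos (c * V (s k, w)) ^+ 2 - 1.
    rewrite (_ : 2 * c * V (s k, w) = (c * V (s k, w)) *+ 2) ?cos_mulr2n; last by ring.
    by ring.
  by field.
have h0 := ih b; have h1 := ih bp; have h2 := ih bm.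
have bMB b0 m q : bdm (fun p => q * (e + D * ((\sum_j b0 j * chi (s j) p) ^+ 2 + m))).
  by apply: bdmM => //; exact: bdm_cst.
set m := 2 * (size r)%:R * c ^+ 2 in h0 h1 h2.
have key : 2^-1 * \int[lam2]_(p in H) (e + D * ((\sum_j b j * chi (s j) p) ^+ 2 + m)) +
  (4^-1 * \int[lam2]_(p in H) (e + D * ((\sum_j bp j * chi (s j) p) ^+ 2 + m)) +
  4^-1 * \int[lam2]_(p in H) (e + D * ((\sum_j bm j * chi (s j) p) ^+ 2 + m))) <=
  \int[lam2]_(p in H) (e + D * ((\sum_j b j * chi (s j) p) ^+ 2 + 2 * (size (k :: r))%:R * c ^+ 2)).
  have mH : measurable H by exact: (measurable_trawl_halo hg).
  have ZE q b0 : q * \int[lam2]_(p in H) (e + D * ((\sum_j b0 j * chi (s j) p) ^+ 2 + m)) =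
      \int[lam2]_(p in H) (q * (e + D * ((\sum_j b0 j * chi (s j) p) ^+ 2 + m))).
    by rewrite RintegralZl//; exact: (iH _ (bB b0 m)).
  rewrite !ZE.
  rewrite -(halo_RintegralD hgamma hg tau_ge0 (bMB bp m 4^-1) (bMB bm m 4^-1)).
  have b4 := bdmD (bMB bp m 4^-1) (bMB bm m 4^-1).
  rewrite -(halo_RintegralD hgamma hg tau_ge0 (bMB b m 2^-1) b4).
  have i5 := iH _ (bdmD (bMB b m 2^-1) b4).
  apply: le_Rintegral => //; first exact: (iH _ (bB b _)).
  move=> p _; rewrite bpE bmE /=.
  set hb := \sum_j _; have /andP[c0 c1] := chi01 (s k) p.
  rewrite (_ : 2 * (size r).+1%:R * c ^+ 2 = m + 2 * c ^+ 2); last by rewrite /m -(natr1 (size r)); ring.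
  (* Parallelogram identity: the weights 1/2, 1/4, 1/4 on the squares of [hb] and [hb] plus or minus
     [2 * c * chi] give [hb ^+ 2 + 2 * c ^+ 2 * chi ^+ 2], and [chi ^+ 2 <= 1]. *)
  rewrite (_ : 2^-1 * _ + _ = e + D * (hb ^+ 2 + m + 2 * c ^+ 2 * chi (s k) p ^+ 2)); last by field.
  have cc : 0 <= 2 * c ^+ 2 by apply: mulr_ge0 => //; exact: sqr_ge0.
  by rewrite lerD2l ler_wpM2l// addrA lerD2l ler_piMr// exprn_ile1.
by lra.
Qed.

Lemma truncated_process_square_integrable :
  {ae P, forall w, (uniform_prob tau0).-integrable setT (EFin \o (fun u => V (u, w) ^+ 2))}.
Proof.
apply: square_integrable_paths; first exact: measurable_truncated_process.
move=> e e0; pose A := fine (area H).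
have A0 : 0 <= A by rewrite fine_ge0.
have A1 : 0 < A + 1 by rewrite ltr_wpDl.
(* Each of the [N.+1] factors costs [2 * c ^+ 2] with [c ^+ 2 = th ^+ 2 / N.+1], so [N] cancels, and
   [th] is chosen to make [D * (2 * th ^+ 2) = e']. The loss is then [2 * e' * A <= e]; the [+ 1]
   avoids dividing by a zero area. *)
pose e' := e / 2 / (A + 1).
have e'0 : 0 < e' by rewrite !divr_gt0.
have [D D0 hD] := psi_sqr e'0.
pose th := Num.sqrt (e' / (2 * D)).
have th2 : th ^+ 2 = e' / (2 * D) by rewrite sqr_sqrtr// divr_ge0 ?ltW// mulr_gt0.
exists th; first by rewrite sqrtr_gt0 divr_gt0// mulr_gt0.
move=> N s; set c := th / _.
have := truncated_process_cos2_ge (fun k : 'I_N.+1 => s k) c hD (ltW D0) (enum 'I_N.+1) (fun=> 0).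
move=> h; apply: (le_trans (le_trans _ h)).
  rewrite lerD2l lerN2.
  have -> : \int[lam2]_(p in H) (e' + D * ((\sum_(j < N.+1) 0 * chi (s j) p) ^+ 2 +
      2 * (size (enum 'I_N.+1))%:R * c ^+ 2)) = (e' + D * (2 * th ^+ 2)) * A.
    rewrite -(halo_Rintegral_cst hg).
    apply: eq_Rintegral => p _; rewrite big1 ?expr0n ?add0r/=; last by move=> j _; rewrite mul0r.
    congr (_ + _ * _); rewrite size_enum_ord /c expr_div_n th2 sqr_sqrtr//.
    by field; rewrite gt_eqF//= pnatr_eq0.
  rewrite th2 (_ : D * _ = e'); last by field; rewrite gt_eqF.
  rewrite (_ : e' + e' = e / (A + 1)); last by rewrite /e'; field; rewrite gt_eqF.
  by rewrite mulrAC ler_pdivrMr// ler_pM2l// lerDl.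
apply: ler_of_eq; apply: eq_Rintegral => w _.
rewrite big1 => [|j _]; first by rewrite cos0 mul1r big_enum.
by rewrite mul0r.
Qed.

End trawl_process_charf.

(** * Uniform laws on intervals and integrals with a parameter *)

Section uniform_averages.
Context {R : realType}.
Local Notation mu := (@lebesgue_measure R).

Lemma bdm_itv_integrable (a b : R) (f : R -> R) : bdm f ->
  mu.-integrable `[a, b] (EFin \o f).
Proof.
move=> [mf [M fM]]; apply: measurable_bounded_integrable => //.
- rewrite /= lebesgue_measure_itv/= lte_fin; case: ifP => _; last exact: ltry.
  by rewrite -EFinD ltry.
- exact: measurable_funTS.
- exists M; split=> [|y My x _]; first exact: num_real.
  exact: (le_trans (fM x) (ltW My)).
Qed.

Lemma bdm_step_powR (alpha : R) (n : nat) (theta t : 'I_n -> R) : 0 <= alpha ->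
  bdm (fun s : R => `|\sum_i theta i * (s <= t i)%R%:R| `^ alpha).
Proof.
move=> a0.
have mc : measurable_fun setT (fun s : R => \sum_i theta i * (s <= t i)%R%:R).
  apply: measurable_sum => i; apply: measurable_funM => //.
  by apply: (bdm_measurable (bdm_boolr _)); exact: measurable_fun_ler.
split; first by apply: (measurableT_comp (measurable_powR alpha)); exact: measurableT_comp.
exists ((\sum_i `|theta i|) `^ alpha) => s; rewrite ger0_norm ?powR_ge0//.
apply: ge0_ler_powR; rewrite ?nnegrE ?sumr_ge0//.
rewrite (le_trans (ler_norm_sum _ _ _))// ler_sum// => i _.
by rewrite normrM; case: (s <= t i); rewrite ?normr1 ?mulr1// normr0 mulr0.
Qed.

Lemma uniform_integrableP (a b : R) (ab : a < b) (f : R -> R) : measurable_fun setT f ->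
  (uniform_prob ab).-integrable setT (EFin \o f) <-> mu.-integrable `[a, b] (EFin \o f).
Proof.
move=> mf; have mf' D : measurable_fun D (EFin \o f) by apply: measurable_funTS; apply/measurable_EFinP.
have E : (\int[uniform_prob ab]_x `|(EFin \o f) x| = (b - a)^-1%:E * \int[mu]_(x in `[a, b]) `|(EFin \o f) x|)%E.
  rewrite integral_uniform//; apply: measurableT_comp => //; exact: (mf' setT).
have ba : 0 < (b - a)^-1 by rewrite invr_gt0 subr_gt0.
split=> /integrableP[_ h]; apply/integrableP; split; try exact: mf'.
- move: h; rewrite E; have : (0 <= \int[mu]_(x in `[a, b]) `|(EFin \o f) x|)%E by apply: integral_ge0.
  case: (integral _ _ _) => [r||]//= _; last by rewrite gt0_muley// lte_fin.
  by rewrite !ltry.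
- by rewrite E lte_mul_pinfty// lee_fin ltW.
Qed.

Lemma uniform_Rintegral (a b : R) (ab : a < b) (f : R -> R) : measurable_fun setT f ->
  mu.-integrable `[a, b] (EFin \o f) ->
  \int[uniform_prob ab]_x f x = (b - a)^-1 * \int[mu]_(x in `[a, b]) f x.
Proof.
move=> mf If; have mf' : measurable_fun setT (EFin \o f) by exact/measurable_EFinP.
have Iu := (uniform_integrableP ab mf).2 If.
rewrite /Rintegral integralE [in RHS]integralE.
rewrite !integral_uniform//; last 2 first.
- exact: measurable_funeneg.
- exact: measurable_funepos.
have fp : (\int[mu]_(x in `[a, b]) (EFin \o f)^\+ x)%E \is a fin_num.
  by apply: integrable_pos_fin_num.
have fn : (\int[mu]_(x in `[a, b]) (EFin \o f)^\- x)%E \is a fin_num.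
  by apply: integrable_neg_fin_num.
rewrite -(fineK fp) -(fineK fn) -!EFinM -!EFinB /=.
by rewrite mulrBr.
Qed.

Lemma Rintegral_telescope (f : R -> R) (u : nat -> R) (N n : nat) :
  {homo u : i j / (i <= j)%N >-> i <= j} -> (n <= N)%N ->
  mu.-integrable `[u 0%N, u N] (EFin \o f) ->
  \sum_(k < n) \int[mu]_(x in `[u k, u k.+1]) f x = \int[mu]_(x in `[u 0%N, u n]) f x.
Proof.
move=> ndu + If; elim: n => [_|n ih nN].
  by rewrite big_ord0 set_itv1 Rintegral_set1.
rewrite big_ord_recr/= ih ?(ltnW nN)//.
have nn1 : u n <= u n.+1 by exact: ndu.
have I1 : mu.-integrable `[u 0%N, u n.+1] (EFin \o f).
  by apply: integrableS If => //; apply: subset_itvl; rewrite bnd_simp; exact: ndu.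
rewrite -(@Rintegral_itv_obnd_cbnd _ (u n)).
  by rewrite -(Rintegral_itvB I1) ?bnd_simp ?ndu//; first by rewrite addrC subrK.
by apply: integrableS I1 => //; apply: subset_itvr; rewrite bnd_simp; exact: ndu.
Qed.

Lemma Rintegral_lincomb {d} (T : measurableType d) (m : {measure set T -> \bar R})
    (D : set T) (J : Type) (r : seq J) (c : J -> R) (f : J -> T -> R) : measurable D ->
  (forall j, m.-integrable D (EFin \o f j)) ->
  m.-integrable D (EFin \o (fun x => \sum_(j <- r) c j * f j x)) /\
  \int[m]_(x in D) (\sum_(j <- r) c j * f j x) = \sum_(j <- r) c j * \int[m]_(x in D) f j x.
Proof.
move=> mD If; elim: r => [|j r [ih1 ih2]].
  have -> : (fun x => \sum_(j <- [::]) c j * f j x) = cst 0 by apply/funext => x; rewrite big_nil.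
  by split; [exact: integrable0|rewrite big_nil Rintegral_cst// mul0r].
have -> : (fun x => \sum_(j <- j :: r) c j * f j x) = (fun x => c j * f j x + \sum_(j <- r) c j * f j x).
  by apply/funext => x; rewrite big_cons.
split; first by apply: integrable_addr => //; exact: integrable_mull.
rewrite RintegralD//; last exact: integrable_mull.
by rewrite RintegralZl// big_cons ih2.
Qed.

(** No integrability is assumed: the integrals of the positive and negative parts are measurable in
    [w] by Tonelli, and the integral is their difference in the extended reals. *)
Lemma measurable_Rintegral_param {d} (Om : measurableType d) (D : set R) (F : R * Om -> R) :
  measurable D -> measurable_fun setT F ->
  measurable_fun setT (fun w => \int[mu]_(s in D) F (s, w)).
Proof.
move=> mD mF; apply: measurableT_comp => //.
pose G (p : R * Om) := ((F p)%:E * (\1_D p.1)%:E)%E.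
have mG : measurable_fun setT G.
  apply: emeasurable_funM; first exact/measurable_EFinP.
  apply/measurable_EFinP; apply: (measurableT_comp (measurable_indic mD)).
  exact: measurable_fst.
have -> : (fun w => (\int[mu]_(s in D) (F (s, w))%:E)%E) =
   (fun w => (\int[mu]_s (G^\+ (s, w)) - \int[mu]_s (G^\- (s, w)))%E).
  apply/funext => w; rewrite integral_mkcond integralE.
  congr (_ - _)%E; apply: eq_integral => s _; rewrite ?funeposE ?funenegE /G /patch indicE/=.
    by case: (s \in D) => /=; rewrite -?EFinM ?mulr1 ?mulr0.
  by case: (s \in D) => /=; rewrite -?EFinM ?mulr1 ?mulr0.
apply: emeasurable_funB.
- by apply: (@measurable_fun_fubini_tonelli_G _ _ _ _ R mu (fun p => (G^\+ p)%E)) => //; exact: measurable_funepos.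
- by apply: (@measurable_fun_fubini_tonelli_G _ _ _ _ R mu (fun p => (G^\- p)%E)) => //; exact: measurable_funeneg.
Qed.

End uniform_averages.

Section integrated_trawl_charf.
Context {R : realType}.
Variable nu : {measure set R -> \bar R}.
Hypothesis hnu : symmetric_levy_measure nu.
Context d (Om : measurableType d) (P : probability Om R).
Variable Lambda : set (R * R) -> {RV P >-> R}.
Hypothesis hLambda : levy_basis nu Lambda.
Local Notation psi := (levy_exponent nu).
Local Notation mu := (@lebesgue_measure R).
Hypothesis psi_sqr : forall e : R, 0 < e ->
  exists2 D : R, 0 < D & forall v, psi v <= e + D * v ^+ 2.
Hypothesis mpsi : measurable_fun setT psi.
Variables (gamma : R) (g : R -> R).
Hypotheses (hgamma : 0 < gamma) (hg : trawl_function gamma g).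
Variables (X : R -> Om -> R) (hX : trawl_process Lambda g X).
Variables (tau : R) (tau0 : 0 < tau).
Variables (n : nat) (theta t : 'I_n -> R) (ht : forall i, 0 <= t i <= tau).
Let tau_ge0 := ltW tau0.

Let V := truncated_process X tau.
Let mV : measurable_fun setT V.
Proof. exact: (measurable_truncated_process hX). Qed.

(** Merges the horizons: the combination of the integrals over [[0, t i]] becomes one integral over
    [[0, tau]] of [c s * X s], to which a single grid applies. *)
Let c s : R := \sum_i theta i * (s <= t i)%R%:R.
Let B : R := \sum_i `|theta i|.
Let B_ge0 : 0 <= B. Proof. by apply: sumr_ge0. Qed.

Let mc : measurable_fun setT c.
Proof.
apply: measurable_sum => i; apply: measurable_funM => //.
by apply: (bdm_measurable (bdm_boolr _)); exact: measurable_fun_ler.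
Qed.

Let c_le s : `|c s| <= B.
Proof.
rewrite (le_trans (ler_norm_sum _ _ _))// ler_sum// => i _.
by rewrite normrM; case: (s <= t i); rewrite ?normr1 ?mulr1// normr0 mulr0.
Qed.

Let W (p : R * Om) := c p.1 * V p.
Let mW : measurable_fun setT W.
Proof. by apply: measurable_funM => //; exact: (measurableT_comp mc (@measurable_fst _ _ _ _)). Qed.

Let f (p : R * R) := \sum_i theta i * trawl_overlap g (t i) p.

Lemma bdm_overlap_sum : bdm f.
Proof.
apply: bdm_sum => i; apply: bdmM; first exact: bdm_cst.
split; first exact: (measurable_trawl_overlap hg).
by exists tau => p; have /andP[t0 tt] := ht i; rewrite ger0_norm ?trawl_overlap_ge0// (le_trans (trawl_overlap_le_tau _ _ _)).
Qed.

Let f_le p : `|f p| <= B * tau.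
Proof.
rewrite mulr_suml (le_trans (ler_norm_sum _ _ _))// ler_sum// => i _.
have /andP[t0 tt] := ht i.
by rewrite normrM ler_wpM2l// ger0_norm ?trawl_overlap_ge0// (le_trans (trawl_overlap_le_tau _ _ _)).
Qed.

Let good w := (uniform_prob tau0).-integrable setT (EFin \o (fun u => V (u, w) ^+ 2)).

Let mVw w : measurable_fun setT (fun u => V (u, w)).
Proof. exact: (measurableT_comp mV (pair2_measurable w)). Qed.

Let mWw w : measurable_fun setT (fun u => W (u, w)).
Proof. exact: (measurableT_comp mW (pair2_measurable w)). Qed.

Let good_V w : good w -> mu.-integrable `[0, tau] (EFin \o (fun u => V (u, w))).
Proof.
move=> gw; apply/(uniform_integrableP tau0 (mVw w)).
by apply: integrable_of_sqr; [exact: (mVw w)|exact: gw].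
Qed.

Let good_W2 w : good w -> mu.-integrable `[0, tau] (EFin \o (fun u => W (u, w) ^+ 2)).
Proof.
move=> gw.
have mV2 : measurable_fun setT (fun u => V (u, w) ^+ 2) by exact: measurable_funX.
have mW2 : measurable_fun setT (fun u => W (u, w) ^+ 2) by exact: measurable_funX.
have h1 : mu.-integrable `[0, tau] (EFin \o (fun u => V (u, w) ^+ 2)).
  by apply/(uniform_integrableP tau0 mV2); exact: gw.
have iV2 : mu.-integrable `[0, tau] (EFin \o (fun u => B ^+ 2 * V (u, w) ^+ 2)) by exact: integrable_mull.
apply: (le_integrable _ _ _ iV2) => //; first by apply: measurable_funTS; exact/measurable_EFinP.
move=> u _; rewrite /= lee_fin ger0_norm ?sqr_ge0// ger0_norm; last by apply: mulr_ge0; exact: sqr_ge0.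
rewrite /W exprMn ler_wpM2r ?sqr_ge0// -(real_normK (num_real (c _))) ler_sqr ?nnegrE//.
Qed.

Let integral_W w : good w ->
  mu.-integrable `[0, tau] (EFin \o (fun u => W (u, w))) /\
  \int[mu]_(s in `[0, tau]) W (s, w) = \sum_i theta i * \int[mu]_(s in `[0, t i]) X s w.
Proof.
move=> gw; have iV := good_V gw.
pose h i s := (s <= t i)%R%:R * V (s, w).
have ih i : mu.-integrable `[0, tau] (EFin \o h i).
  apply: (le_integrable _ _ _ iV) => //.
    apply: measurable_funTS; apply/measurable_EFinP; apply: measurable_funM; last exact: (mVw w).
    by apply: (bdm_measurable (bdm_boolr _)); exact: measurable_fun_ler.
  by move=> u _; rewrite /= lee_fin /h; case: (u <= t i); rewrite ?mul1r// mul0r normr0.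
have [i1 i2] : mu.-integrable `[0, tau] (EFin \o (fun u => \sum_i theta i * h i u)) /\
    \int[mu]_(u in `[0, tau]) (\sum_i theta i * h i u) =
    \sum_i theta i * \int[mu]_(u in `[0, tau]) h i u.
  by apply: Rintegral_lincomb.
have WE : (fun u => W (u, w)) = (fun u => \sum_i theta i * h i u).
  by apply/funext => u; rewrite /W /c mulr_suml; apply: eq_bigr => i _; rewrite mulrA.
rewrite WE; split => //; rewrite i2; apply: eq_bigr => i _; congr (_ * _).
rewrite Rintegral_mkcond [RHS]Rintegral_mkcond; congr Rintegral; apply/funext => s.
rewrite /patch /h /V /truncated_process/= !mem_setE !in_itv/=.
have /andP[t0 tt] := ht i.
case: (boolP (0 <= s)) => //= s0; case: (leP s (t i)) => st /=.
  by rewrite (le_trans st tt)/= mul1r.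
by case: ifP => // _; rewrite mul0r.
Qed.

Lemma measurable_integrated_trawl s : measurable_fun setT (fun w => \int[mu]_(u in `[0, s]) X u w).
Proof.
have -> : (fun w => \int[mu]_(u in `[0, s]) X u w) =
    (fun w => \int[mu]_(u in `[0, s]) truncated_process X s (u, w)).
  by apply/funext => w; apply: eq_Rintegral => u; rewrite inE/= in_itv/= /truncated_process/= => ->.
by apply: measurable_Rintegral_param => //; exact: (measurable_truncated_process hX).
Qed.

Let delta N : R := tau / N.+1%:R.
Let delta_gt0 N : 0 < delta N. Proof. by rewrite divr_gt0. Qed.
Let deltaN N : delta N * N.+1%:R = tau. Proof. by rewrite divfK// pnatr_eq0. Qed.
Let lt_cell N k : delta N * k%:R < delta N * k.+1%:R.
Proof. by rewrite ltr_pM2l// ltr_nat. Qed.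

Let cell_sub N k x : (k < N.+1)%N -> delta N * k%:R <= x <= delta N * k.+1%:R -> 0 <= x <= tau.
Proof.
move=> kN /andP[x1 x2]; apply/andP; split.
  by apply: le_trans x1; rewrite mulr_ge0// ltW.
by apply: (le_trans x2); rewrite -(deltaN N) ler_pM2l// ler_nat.
Qed.

Let Q N k := uniform_prob (lt_cell N k).
(** [avg_cos_expectation] asks for a bound valid for every sequence of reals. Clipping forces the
    points into their cells and changes nothing under the uniform law of the cell. *)
Let clip N k (u : R) := Num.max (delta N * k%:R) (Num.min u (delta N * k.+1%:R)).

Let clip_bounds N k u : delta N * k%:R <= clip N k u <= delta N * k.+1%:R.
Proof.
rewrite le_max lexx/= ge_max ltW//= ge_min lexx orbT//.
Qed.

Let clip_id N k u : delta N * k%:R <= u <= delta N * k.+1%:R -> clip N k u = u.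
Proof. by move=> /andP[u1 u2]; rewrite /clip (min_idPl _)// (max_idPr _). Qed.

Let mclip N k : measurable_fun setT (clip N k).
Proof. by apply: measurable_maxr => //; exact: measurable_minr. Qed.

Let Vk N k (p : R * Om) := W (clip N k p.1, p.2).

Let mVk N k : measurable_fun setT (Vk N k).
Proof.
apply: (measurableT_comp mW); apply/measurable_fun_pairP; split => /=.
  exact: (measurableT_comp (mclip N k) (@measurable_fst _ _ _ _)).
exact: measurable_snd.
Qed.

Let sum_cells N (h : R -> R) : measurable_fun setT h ->
  mu.-integrable `[0, tau] (EFin \o h) ->
  delta N * \sum_(k < N.+1) \int[Q N k]_u h (clip N k u) = \int[mu]_(s in `[0, tau]) h s.
Proof.
move=> mh ih; have := @Rintegral_telescope _ h (fun k => delta N * k%:R) N.+1 N.+1 _ (leqnn _).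
rewrite /= mulr0 deltaN => <-//; last by move=> i j ij; rewrite ler_wpM2l ?ler_nat// ltW.
rewrite mulr_sumr; apply: eq_bigr => k _.
have sub : [set` `[delta N * k%:R, delta N * k.+1%:R]] `<=` [set` `[0, tau]].
  by move=> x /=; rewrite !in_itv/=; exact: cell_sub.
have e1 : mu.-integrable `[delta N * k%:R, delta N * k.+1%:R] (EFin \o (fun u => h (clip N k u))).
  have : mu.-integrable `[delta N * k%:R, delta N * k.+1%:R] (EFin \o h) by exact: integrableS ih.
  apply: eq_integrable => // u; rewrite inE/= in_itv/= => uI; by rewrite clip_id.
rewrite /Q uniform_Rintegral//; last exact: measurableT_comp.
rewrite -mulrBr -natrB// subSnn mulr1 mulrA divff ?mul1r ?gt_eqF//.
by apply: eq_Rintegral => u; rewrite inE/= in_itv/= => uI; rewrite clip_id.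
Qed.

Let cells_integrable N k h : (k < N.+1)%N -> measurable_fun setT h ->
  mu.-integrable `[0, tau] (EFin \o h) -> (Q N k).-integrable setT (EFin \o (fun u => h (clip N k u))).
Proof.
move=> kN mh ih; apply/uniform_integrableP; first exact: measurableT_comp.
have sub : [set` `[delta N * k%:R, delta N * k.+1%:R]] `<=` [set` `[0, tau]].
  by move=> x /=; rewrite !in_itv/=; exact: cell_sub.
have : mu.-integrable `[delta N * k%:R, delta N * k.+1%:R] (EFin \o h) by exact: integrableS ih.
by apply: eq_integrable => // u; rewrite inE/= in_itv/= => uI; rewrite clip_id.
Qed.

Let avg N a w := avg_cos (Q N) (Vk N) (delta N) N.+1 a w.

Let avg_cvg a w : good w ->
  avg N a w @[N --> \oo] --> cos (a + \sum_i theta i * \int[mu]_(s in `[0, t i]) X s w).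
Proof.
move=> gw; have [iW <-] := integral_W gw; have iW2 := good_W2 gw.
pose I2 := \int[mu]_(s in `[0, tau]) (W (s, w) ^+ 2).
have bound N : `|avg N a w - cos (a + \int[mu]_(s in `[0, tau]) W (s, w))| <= 4 * delta N * I2.
  have := @avg_cos_pathwise _ _ _ _ _ (Q N) (Vk N) (mVk N) (delta N) N.+1 a w _.
  rewrite (sum_cells N (mWw w) iW).
  rewrite expr2 mulrA -[X in _ <= X]mulrA (sum_cells N _ iW2); last exact: measurable_funX.
  apply=> k kN; have mW2 : measurable_fun setT (fun u => W (u, w) ^+ 2) by exact: measurable_funX.
  exact: (cells_integrable kN mW2 iW2).
apply/cvgrPdist_le => e e0.
have d0 : 4 * delta N * I2 @[N --> \oo] --> (0 : R).
  rewrite (_ : (fun N => _) = (fun N => 4 * tau * I2 * harmonic N)); last first.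
    by apply/funext => N; rewrite /delta /harmonic/=; ring.
  by rewrite -[X in _ --> X](mulr0 (4 * tau * I2)); apply: cvgMr; exact: cvg_harmonic.
move/cvgrPdist_le : d0 => /(_ e e0); apply: filterS => N; rewrite sub0r normrN => h.
by rewrite distrC (le_trans (bound N))// (le_trans _ h)// ler_norm.
Qed.

Let sample_energy N (u : nat -> R) p : p.2 != 0 ->
  `|\sum_(k < N.+1) delta N * c (clip N k (u k)) *
       ((0 <= clip N k (u k) <= tau)%R%:R * \1_(trawl_set g (clip N k (u k))) p) - f p| <= 2 * delta N * B.
Proof.
move=> p0; pose s k := clip N k (u k).
have s01 k : (k < N.+1)%N -> 0 <= s k <= tau.
  by move=> kN; exact: (cell_sub kN (clip_bounds N k (u k))).
rewrite (eq_bigr (fun k : 'I_N.+1 => \sum_i theta i * (delta N * ((s k <= t i)%R%:R * \1_(trawl_set g (s k)) p)))); last first.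
  move=> k _; rewrite -/(s k) s01// mul1r /c mulr_sumr mulr_suml; apply: eq_bigr => i _; ring.
rewrite exchange_big/= /f -sumrB /B mulr_sumr (le_trans (ler_norm_sum _ _ _))// ler_sum// => i _.
rewrite -mulr_sumr -mulrBr normrM [leRHS]mulrC ler_wpM2l// -mulr_sumr.
apply: (trawl_overlap_riemann hg (delta := delta N) (n := N.+1) (u := s)) => //.
  by move=> k _; exact: clip_bounds.
by rewrite deltaN.
Qed.

(** The expectations of [avg N] have two limits. Pathwise convergence to the cosine of the integral
    gives one by bounded convergence. The other is [T0], because for every choice of sample points
    the kernel [fN] is within [2 * delta N * B] of [f] off the axis. *)
Lemma integrated_trawl_charf a :
  \int[P]_w cos (a + \sum_i theta i * \int[mu]_(s in `[0, t i]) X s w) =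
  cos a * expR (- halo_energy nu g tau f).
Proof.
set T0 := cos a * _; pose A := fine (area (trawl_halo g tau)).
have A0 : 0 <= A by rewrite fine_ge0.
have close e : 0 < e -> \forall N \near \oo, `|\int[P]_w avg N a w - T0| <= e.
  move=> e0; pose e' := e / (A + 1); have e'0 : 0 < e' by rewrite divr_gt0// ltr_wpDl.
  (* The radius covers [f], bounded by [B * tau], and the sampled kernel, further off by at most
     [2 * delta N * B <= 2 * tau * B]. *)
  have [eta eta0 Heta] := levy_exponent_uniform hnu psi_sqr (B * tau + 2 * tau * B) e'0.
  have d0 : 2 * delta N * B @[N --> \oo] --> (0 : R).
    rewrite (_ : (fun N => _) = (fun N => 2 * tau * B * harmonic N)); last first.
      by apply/funext => N; rewrite /delta /harmonic/=; ring.
    by rewrite -[X in _ --> X](mulr0 (2 * tau * B)); apply: cvgMr; exact: cvg_harmonic.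
  move/cvgrPdist_le : d0 => /(_ eta eta0); apply: filterS => N; rewrite sub0r normrN => Nh.
  have {}Nh := le_trans (ler_norm _) Nh.
  have delta_le : delta N <= tau by rewrite ler_pdivrMr// ler_pMr// ler1n.
  apply: (avg_cos_expectation (Q N) (mVk N)) => u.
  pose s (k : 'I_N.+1) := clip N k (u k).
  pose fN (p : R * R) := \sum_k delta N * c (s k) * ((0 <= s k <= tau)%R%:R * \1_(trawl_set g (s k)) p).
  have := truncated_process_charf hLambda mpsi hgamma hg hX tau s (fun k => delta N * c (s k)) a.
  rewrite -/fN => E; rewrite (_ : \int[P]_w _ = cos a * expR (- halo_energy nu g tau fN)); last first.
    rewrite -E; apply: eq_Rintegral => w _; congr (cos (_ + _)); rewrite mulr_sumr.
    by apply: eq_bigr => k _; rewrite /Vk /W/= mulrA.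
  have bfN : bdm fN.
    apply: bdm_sum => k; apply: bdmM; first exact: bdm_cst.
    by apply: bdmM; [exact: bdm_cst|apply: bdm_indic; exact: (measurable_trawl_set hg)].
  rewrite /T0 -mulrBr normrM (@le_trans _ _ (1 * (e' * A)))//; last first.
    by rewrite mul1r /e' mulrAC ler_pdivrMr ?ltr_wpDl// ler_pM2l// lerDl.
  apply: ler_pM => //; first by rewrite ler_norml cos_geN1 cos_le1.
  rewrite (le_trans (expR_opp_diff_le _ _)) ?halo_energy_ge0//.
  apply: (halo_energy_close psi_sqr mpsi hgamma hg tau_ge0) => //.
  - exact: bdm_overlap_sum.
  - exact: ltW.
  move=> p p0; have hs := sample_energy N u p0.
  have hf := f_le p.
  apply: Heta; last exact: (le_trans hs Nh).
    rewrite -[X in `|X|](subrK (f p)) addrC (le_trans (ler_normD _ _))// lerD//.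
    by rewrite (le_trans hs)// ler_wpM2r// ler_pM2l.
  by rewrite (le_trans hf)// lerDl !mulr_ge0.
have lim : \int[P]_w avg N a w @[N --> \oo] -->
    \int[P]_w cos (a + \sum_i theta i * \int[mu]_(s in `[0, t i]) X s w).
  apply: (@expect_bounded_cvg _ _ _ _ _ _ 1).
  - move=> N; apply: bdm_measurable; have h := measurable_avg_cos P (Q N) (mVk N).
    exact: (h _ _ (fun=> a)).
  - apply: (bdm_measurable (bdm_cos _)); apply: measurable_funD => //.
    by apply: measurable_sum => i; apply: measurable_funM => //; exact: measurable_integrated_trawl.
  - by move=> N w; exact: (avg_cos_le1 (Q N) (mVk N)).
  - have := truncated_process_square_integrable hLambda psi_sqr mpsi hgamma hg hX tau0.
    by apply: filterS => w gw; exact: avg_cvg.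
have lim2 : \int[P]_w avg N a w @[N --> \oo] --> T0.
  by apply/cvgrPdist_le => e e0; apply: filterS (close e e0) => N; rewrite distrC.
exact: (cvg_unique _ lim lim2).
Qed.

End integrated_trawl_charf.

(** Lebesgue measure is [T] times its image under [u |-> T * u], by uniqueness from the lengths of
    the intervals []a, b]]. *)
Lemma integral_dilation {R : realType} (T : R) (f : R -> \bar R) : 0 < T ->
  measurable_fun setT f -> (forall x, (0 <= f x)%E) ->
  (\int[@lebesgue_measure R]_x f x = T%:E * \int[@lebesgue_measure R]_u f (T * u)%R)%E.
Proof.
move=> T0 mf f0; pose k : {nonneg R} := NngNum (ltW T0).
pose phi : R -> measurableTypeR R := fun u => T * u.
have mphi : measurable_fun setT phi by exact: measurable_funM.
pose phi_mixin := isMeasurableFun.Build _ _ _ _ _ mphi.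
pose phi' : {mfun _ >-> _} := HB.pack phi phi_mixin.
pose m0 : {measure set (measurableTypeR R) -> \bar R} := mscale k (pushforward (@lebesgue_measure R) phi').
pose m := m0 mphi.
have E A : measurable A -> @lebesgue_measure R A = m A.
  apply: lebesgue_measure_unique => _ [[a b]] _ <-.
  change (@lebesgue_measure R `]a, b] = (T%:E * @lebesgue_measure R (phi @^-1` `]a, b]))%E).
  have -> : phi @^-1` `]a, b] = [set` `]a / T, b / T]].
    by apply/seteqP; split=> u /=; rewrite !in_itv/= /phi ltr_pdivrMr// ler_pdivlMr// [u * T]mulrC.
  rewrite !lebesgue_measure_itv/= !lte_fin ltr_pM2r ?invr_gt0//.
  case: ifPn => _; last by rewrite mule0.
  rewrite -!EFinD -EFinM; congr EFin; field; exact: lt0r_neq0.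
rewrite (eq_measure_integral m); last by move=> A mA _; exact: E.
rewrite ge0_integral_mscale//; congr (_ * _)%E.
by rewrite ge0_integral_pushforward.
Qed.

(** * The long-time limit *)

Section long_time_limit.
Context {R : realType}.
Variable nu : {measure set R -> \bar R}.
Hypothesis hnu : symmetric_levy_measure nu.
Local Notation psi := (levy_exponent nu).
Local Notation mu := (@lebesgue_measure R).
Hypothesis mpsi : measurable_fun setT psi.
Variables (alpha Calpha q D : R).
Hypothesis halpha : 0 < alpha.
Hypothesis Calpha0 : 0 <= Calpha.
Hypotheses (q1 : 1 <= q) (aq : alpha <= q) (D0 : 0 < D).
Hypothesis scaled_le : forall T z, 1 <= T ->
  T * psi ((T `^ alpha^-1)^-1 * z) <= D * (`|z| `^ alpha + `|z| `^ q).
Hypothesis scaled_cvg : forall (T z : R ^nat) (l : R),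
  T n @[n --> \oo] --> +oo -> z n @[n --> \oo] --> l ->
  T n * psi ((T n `^ alpha^-1)^-1 * z n) @[n --> \oo] --> Calpha * `|l| `^ alpha.
Variables (gamma : R) (g : R -> R).
Hypotheses (hgamma : 0 < gamma) (hg : trawl_function gamma g) (hq : q < 1 + gamma).
Local Notation rho := (trawl_inv g).
Variables (tau : R) (tau0 : 0 < tau).
Variables (n : nat) (theta t : 'I_n -> R) (ht : forall i, 0 <= t i <= tau).

Let L (T : R) (p : R * R) := \sum_i theta i * trawl_overlap g (T * t i) p.
Let c s : R := \sum_i theta i * (s <= t i)%R%:R.
Let B : R := \sum_i `|theta i|.
Let B_ge0 : 0 <= B. Proof. by apply: sumr_ge0. Qed.
Let h (T : R) (p : R * R) := psi ((T `^ alpha^-1)^-1 * L T p).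

Let mh T : measurable_fun setT (h T).
Proof.
apply: measurableT_comp => //; apply: measurable_funM => //.
by apply: measurable_sum => i; apply: measurable_funM => //; exact: (measurable_trawl_overlap hg).
Qed.

Let h_ge0 T p : 0 <= h T p. Proof. exact: levy_exponent_ge0. Qed.

Let L_le_inv T p : `|L T p| <= B * rho p.2.
Proof.
rewrite mulr_suml (le_trans (ler_norm_sum _ _ _))// ler_sum// => i _.
by rewrite normrM ler_wpM2l// ger0_norm ?trawl_overlap_ge0// (trawl_overlap_le_inv hg).
Qed.

Let L_le_time T p : 0 <= T -> `|L T p| <= B * (T * tau).
Proof.
move=> T0; rewrite mulr_suml (le_trans (ler_norm_sum _ _ _))// ler_sum// => i _.
have /andP[t0 tt] := ht i.
rewrite normrM ler_wpM2l// ger0_norm ?trawl_overlap_ge0//.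
by rewrite (le_trans (trawl_overlap_le_tau _ _ (mulr_ge0 T0 t0)))// ler_wpM2l.
Qed.

Let L_right T x y : 0 <= T -> T * tau < x -> L T (x, y) = 0.
Proof.
move=> T0 Tx; apply: big1 => i _; have /andP[t0 tt] := ht i.
rewrite /trawl_overlap (max_idPl _) ?mulr0//= subr_le0 ge_min le_max; apply/orP; left; apply/orP; right.
by rewrite (le_trans _ (ltW Tx))// ler_wpM2l.
Qed.

Let L_left T x y : x < - rho y -> L T (x, y) = 0.
Proof.
move=> xr; apply: big1 => i _.
rewrite /trawl_overlap (max_idPl _) ?mulr0//= subr_le0 ge_min [X in _ || X]le_max; apply/orP; right; apply/orP; left.
by rewrite -lerBrDr sub0r ltW.
Qed.

Let L_out T x y : rho y = 0 -> L T (x, y) = 0.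
Proof. by move=> r0; apply/eqP; rewrite -normr_le0 (le_trans (L_le_inv T (x, y)))//= r0 mulr0. Qed.

Let negpart T y := (\int[mu]_(x in `]-oo, 0%R[) (h T (x, y))%:E)%E.
Let pospart T y := (\int[mu]_(u in `[0%R, tau]) (T * h T ((T * u)%R, y))%:E)%E.

Let mhx T y : measurable_fun setT (fun x => h T (x, y)).
Proof. exact: (measurableT_comp (mh T) (pair2_measurable y)). Qed.

Lemma measurable_integral_section (A : set R) (F : R * R -> R) : measurable A ->
  measurable_fun setT F -> (forall p, 0 <= F p) ->
  measurable_fun setT (fun y => (\int[mu]_(x in A) (F (x, y))%:E)%E).
Proof.
move=> mA mF F0.
have -> : (fun y => (\int[mu]_(x in A) (F (x, y))%:E)%E) =
    (fun y => (\int[mu]_x (F (x, y) * \1_A x)%:E)%E).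
  apply/funext => y; rewrite integral_mkcond; apply: eq_integral => x _.
  by rewrite /patch indicE; case: (x \in A); rewrite ?mulr1 ?mulr0.
apply: (@measurable_fun_fubini_tonelli_G _ _ _ _ R mu (fun p => (F p * \1_A p.1)%:E)) => //.
  apply/measurable_EFinP; apply: measurable_funM => //.
  by apply: (measurableT_comp (measurable_indic mA)); exact: measurable_fst.
by move=> p; rewrite lee_fin mulr_ge0// indicE.
Qed.

Let measurable_negpart T : measurable_fun setT (negpart T).
Proof. exact: measurable_integral_section. Qed.

Let measurable_pospart T : 0 <= T -> measurable_fun setT (pospart T).
Proof.
move=> T0; apply: (@measurable_integral_section `[0, tau] (fun p => T * h T (T * p.1, p.2))) => //.
- apply: measurable_funM => //; apply: (measurableT_comp (mh T)).
  apply/measurable_fun_pairP; split => /=; last exact: measurable_snd.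
  by apply: measurable_funM => //; exact: measurable_fst.
- by move=> p; rewrite mulr_ge0.
Qed.

(** The two half-lines scale differently. For [x >= 0] the substitution [x = T * u] supplies the
    factor [T] that [scaled_cvg] needs. For [x < 0] only [x >= - rho y] contributes, a range that
    does not grow with [T], so this part is left unscaled and dies out. *)
Lemma energy_split T : 0 < T ->
  energy nu (fun p => (T `^ alpha^-1)^-1 * L T p) =
  (\int[mu]_(y in `]0%R, g 0%R]) (negpart T y + pospart T y))%E.
Proof.
move=> T0; rewrite /energy fubini_tonelli2//; last 2 first.
- by apply/measurable_EFinP; exact: (mh T).
- by move=> p; rewrite lee_fin; exact: (h_ge0 T).
rewrite [RHS]integral_mkcond; apply: eq_integral => y _; rewrite patchE /fubini_G/=.
rewrite -/(h T); case: ifPn => [_|ny]; last first.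
  rewrite (eq_integral (cst 0%E)); first by rewrite integral_cst// mul0e.
  move=> x _; rewrite L_out ?mulr0 ?levy_exponent0//; apply: trawl_inv_out.
  by apply: contra ny => yg; rewrite inE/= in_itv.
have mC : measurable (~` `]-oo, 0%R[%classic : set R) by exact: measurableC.
have mE A : measurable_fun A (fun x => (h T (x, y))%:E).
  by apply: measurable_funTS; apply/measurable_EFinP.
rewrite -(setUv (`]-oo, 0%R[%classic : set R)) ge0_integral_setU//; try exact: mE; try exact: measurableC; last 2 first.
- by move=> x _; rewrite lee_fin; exact: (h_ge0 T (x, y)).
- exact/disj_setPCl.
congr (_ + _)%E.
rewrite integral_mkcond (integral_dilation T0); last 2 first.
- by apply/(measurable_restrictT _ mC); exact: mE.
- by move=> x; apply: erestrict_ge0 => z _; rewrite lee_fin; exact: (h_ge0 T (z, y)).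
rewrite /pospart [in RHS]integral_mkcond -ge0_integralZl_EFin ?ltW//; last 2 first.
- by move=> x _; apply: erestrict_ge0 => z _; rewrite lee_fin; exact: (h_ge0 T (z, y)).
- apply: (@measurableT_comp _ _ _ _ _ _ (_ \_ _)); last exact: measurable_funM.
  by apply/(measurable_restrictT _ mC); exact: mE.
apply: eq_integral => u _; rewrite !patchE in_setC !mem_setE !in_itv/= -leNgt pmulr_rge0//.
case: (leP 0 u) => u0 /=; last by rewrite mule0.
case: ifPn => [_|]; first by rewrite EFinM.
by rewrite -ltNge => tu; rewrite /h L_right ?ltW ?ltr_pM2l// mulr0 levy_exponent0 mule0.
Qed.

Let powR_alpha_le x : 0 <= x -> x `^ alpha <= 1 + x `^ q.
Proof.
move=> x0; have [x1|/ltW x1] := leP x 1.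
  rewrite (@le_trans _ _ 1)// ?lerDl ?powR_ge0//.
  have e1 : (1 : R) = 1 `^ alpha by rewrite powR1.
  by rewrite [leRHS]e1 ge0_ler_powR ?nnegrE// ltW.
by rewrite (@le_trans _ _ (x `^ q)) ?lerDr// ler_powR.
Qed.

Let q0 : 0 <= q. Proof. exact: le_trans q1. Qed.

Let bound_ge0 x : 0 <= D * (1 + 2 * x `^ q).
Proof. by apply: mulr_ge0; [exact: ltW|apply: addr_ge0 => //; apply: mulr_ge0 => //; exact: powR_ge0]. Qed.

Let h_le T p : 1 <= T -> h T p <= T^-1 * (D * (1 + 2 * `|L T p| `^ q)).
Proof.
move=> T1; have T0 : 0 < T := lt_le_trans ltr01 T1.
rewrite ler_pdivlMl// (le_trans (scaled_le _ T1))// ler_pM2l//.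
by have := powR_alpha_le (normr_ge0 (L T p)); lra.
Qed.

Let negpart_le T y : 1 <= T ->
  (negpart T y <= (rho y * (T^-1 * (D * (1 + 2 * (B * Num.min (rho y) (T * tau)) `^ q))))%:E)%E.
Proof.
move=> T1; have T0 : 0 < T := lt_le_trans ltr01 T1.
have r0 : 0 <= rho y := trawl_inv_ge0 hg y.
set M := T^-1 * _.
have M0 : 0 <= M.
  by rewrite mulr_ge0// invr_ge0 ltW.
have hM x : h T (x, y) <= M * \1_(`[- rho y, 0]%classic) x + (0 < x)%R%:R * h T (x, y).
  have [x0|x0] := ltP 0 x; first by rewrite mul1r lerDr mulr_ge0.
  rewrite mul0r addr0 indicE mem_setE in_itv/= x0 andbT.
  have [xr|xr] := leP (- rho y) x; last by rewrite /h L_left// mulr0 levy_exponent0// mulr0.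
  rewrite mulr1 (le_trans (h_le _ T1))// ler_pM2l ?invr_gt0// ler_pM2l// lerD2l ler_pM2l//.
  have m0 : 0 <= Num.min (rho y) (T * tau) by rewrite le_min r0 mulr_ge0 ?ltW.
  apply: ge0_ler_powR => //; rewrite ?nnegrE ?mulr_ge0//.
  rewrite minEle; case: ifP => _; first exact: (L_le_inv T (x, y)).
  by rewrite (le_trans (L_le_time _ (ltW T0))).
apply: (@le_trans _ _ (\int[mu]_(x in `]-oo, 0%R[) (M * \1_(`[- rho y, 0]%classic) x)%:E)%E).
  apply: ge0_le_integral => //.
  - by move=> x _; rewrite lee_fin; exact: (h_ge0 T (x, y)).
  - by apply: measurable_funTS; apply/measurable_EFinP; exact: (mhx T y).
  - by apply: measurable_funTS; apply/measurable_EFinP; exact: measurable_funM.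
  - move=> x /=; rewrite in_itv/= => x0; rewrite lee_fin (le_trans (hM x))//.
    by rewrite (le_gtF (ltW x0)) mul0r addr0.
rewrite (@le_trans _ _ (\int[mu]_x (M * \1_(`[- rho y, 0]%classic) x)%:E)%E)//.
  apply: ge0_subset_integral => //.
    by apply/measurable_EFinP; exact: measurable_funM.
  by move=> x _; rewrite lee_fin mulr_ge0.
under eq_integral do rewrite EFinM.
rewrite ge0_integralZl_EFin//; last exact/measurable_EFinP/measurable_indic.
rewrite integral_indic// setIT /= lebesgue_measure_itv/= lte_fin.
case: ifPn => _; last by rewrite mule0 lee_fin mulr_ge0.
by rewrite -EFinD -EFinM lee_fin opprK add0r mulrC.
Qed.

(** Bounding the overlap by [rho y] alone gives [rho^(q + 1) / T], whose exponent need not be below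
    [1 + gamma]. Spending the cap [T * tau] on one factor, [m^q = m * m^(q - 1) <= T * tau * rho^(q
    - 1)], cancels [1 / T] and leaves [rho^q]; [1 <= q] makes the exponent [q - 1] monotone. *)
Let negpart_dom T y : 1 <= T ->
  (negpart T y <= (D * (rho y + 2 * (B `^ q * (tau * rho y `^ q))))%:E)%E.
Proof.
move=> T1; have T0 : 0 < T := lt_le_trans ltr01 T1.
have r0 : 0 <= rho y := trawl_inv_ge0 hg y.
apply: (le_trans (negpart_le y T1)); rewrite lee_fin.
set m := Num.min _ _.
have m0 : 0 <= m by rewrite le_min r0 mulr_ge0 ?ltW.
rewrite powRM//.
have key : rho y * T^-1 * m `^ q <= tau * rho y `^ q.
  have mq : m `^ q <= T * tau * rho y `^ (q - 1).
    have -> : m `^ q = m * m `^ (q - 1).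
      have [->|mn0] := eqVneq m 0; first by rewrite mul0r powR0// gt_eqF// (lt_le_trans ltr01).
      rewrite -{2}(powRr1 m0) -powRD ?mn0 ?implybT//; congr powR; ring.
    apply: ler_pM => //; rewrite ?powR_ge0//; first by rewrite ge_min lexx orbT.
    by rewrite ge0_ler_powR ?nnegrE ?subr_ge0// ge_min lexx.
  have rT : 0 <= rho y * T^-1 by rewrite mulr_ge0// invr_ge0 ltW.
  apply: (le_trans (ler_wpM2l rT mq)).
  have [->|rn0] := eqVneq (rho y) 0; first by rewrite !mul0r mulr_ge0 ?powR_ge0 ?(ltW tau0).
  have -> : rho y `^ q = rho y * rho y `^ (q - 1).
    by rewrite -{2}(powRr1 r0) -powRD ?rn0 ?implybT//; congr powR; ring.
  apply: ler_of_eq; field; exact: lt0r_neq0.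
rewrite (_ : rho y * _ = D * (rho y * T^-1 + 2 * (B `^ q * (rho y * T^-1 * m `^ q)))); last by ring.
rewrite ler_pM2l// lerD//; first by rewrite ler_piMr// invf_le1.
by rewrite ler_pM2l// ler_wpM2l// powR_ge0.
Qed.

Let negpart_cvg (T : R ^nat) y : (forall k, 1 <= T k) -> T k @[k --> \oo] --> +oo ->
  negpart (T k) y @[k --> \oo] --> 0%E.
Proof.
move=> T1 Too; have r0 : 0 <= rho y := trawl_inv_ge0 hg y.
pose M := rho y * (D * (1 + 2 * (B * rho y) `^ q)).
have M0 : 0 <= M by exact: mulr_ge0.
apply: (@squeeze_cvge _ _ _ _ (fun=> 0%E) _ (fun k => ((T k)^-1 * M)%:E)).
- apply: nearW => k; rewrite integral_ge0//=; last by move=> x _; rewrite lee_fin.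
  have T0 : 0 < T k := lt_le_trans ltr01 (T1 k).
  apply: (le_trans (negpart_le y (T1 k))); rewrite lee_fin mulrCA ler_pM2l ?invr_gt0//.
  rewrite ler_wpM2l// ler_pM2l// lerD2l ler_pM2l// ge0_ler_powR ?nnegrE//.
  + by rewrite mulr_ge0// le_min r0 mulr_ge0 ?ltW.
  + by rewrite mulr_ge0.
  + by rewrite ler_wpM2l// ge_min lexx.
- exact: cvg_cst.
- apply: cvg_EFin; first by apply: nearW.
  rewrite -(mul0r M); apply: cvgMl.
  by apply/gtr0_cvgV0 => //; apply: nearW => k; exact: lt_le_trans (T1 k).
Qed.

Let pospart_le_pt T u y : 1 <= T ->
  T * h T (T * u, y) <= D * ((B * rho y) `^ alpha + (B * rho y) `^ q).
Proof.
move=> T1; rewrite (le_trans (scaled_le _ T1))// ler_pM2l//.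
have := L_le_inv T (T * u, y) => /= hL.
have r0 : 0 <= rho y := trawl_inv_ge0 hg y.
by rewrite lerD// ge0_ler_powR ?nnegrE// ?mulr_ge0// ltW.
Qed.

(** The sequence is eventually constant: for [u < t i] the overlap is [rho y] once
    [T k * (t i - u) >= rho y], and for [u > t i] it is 0. At [u = t i] the limit would differ, but
    these times form a null set. *)
Let overlap_cvg (T : R ^nat) u y i : (forall k, 1 <= T k) -> T k @[k --> \oo] --> +oo ->
  0 <= u -> u != t i ->
  trawl_overlap g (T k * t i) (T k * u, y) @[k --> \oo] --> (u <= t i)%R%:R * rho y.
Proof.
move=> T1 Too u0 ut; have r0 : 0 <= rho y := trawl_inv_ge0 hg y.
have Tp k : 0 < T k := lt_le_trans ltr01 (T1 k).
apply: cvg_near_cst; have [tu|ut'] := ltP (t i) u.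
  apply: nearW => k; rewrite mul0r /trawl_overlap/=; apply/max_idPl.
  rewrite subr_le0 ge_min le_max; apply/orP; left; apply/orP; right.
  by rewrite ler_pM2l// ltW.
have {ut' ut} ut : 0 < t i - u by rewrite subr_gt0 lt_neqAle ut.
move/cvgryPge : Too => /(_ (rho y / (t i - u))); apply: filterS => k.
rewrite ler_pdivrMr// => hk; rewrite mul1r /trawl_overlap/=.
rewrite (max_idPr (_ : 0 <= T k * u)); last by rewrite mulr_ge0// ltW.
rewrite (min_idPr _); last by rewrite -lerBrDl -mulrBr.
by rewrite addrC addKr (max_idPr _).
Qed.

Let limit_height u y := Calpha * `|c u * rho y| `^ alpha.

Let h_cvg (T : R ^nat) u y : (forall k, 1 <= T k) -> T k @[k --> \oo] --> +oo ->
  0 <= u -> (forall i, u != t i) ->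
  T k * h (T k) (T k * u, y) @[k --> \oo] --> limit_height u y.
Proof.
move=> T1 Too u0 ut; apply: scaled_cvg => //.
rewrite /L /c mulr_suml; apply: cvg_big => [|i _]; first exact: add_continuous.
rewrite -mulrA; apply: cvgMr.
exact: overlap_cvg.
Qed.

Let mc : measurable_fun setT c.
Proof.
apply: measurable_sum => i; apply: measurable_funM => //.
by apply: (bdm_measurable (bdm_boolr _)); exact: measurable_fun_ler.
Qed.

Let I := \int[mu]_(u in `[0, tau]) (`|c u| `^ alpha).

Let powR_c_integrable : mu.-integrable `[0, tau] (EFin \o (fun u => `|c u| `^ alpha)).
Proof. by apply/bdm_itv_integrable/bdm_step_powR; exact: ltW. Qed.

Let ae_neq_times : {ae mu, forall u, forall i, u != t i}.
Proof.
apply: filter_forall => i; exists [set t i]; split => //; first exact: lebesgue_measure_set1.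
by move=> u /= /negP; rewrite negbK => /eqP.
Qed.

Let pospart_cvg (T : R ^nat) y : (forall k, 1 <= T k) -> T k @[k --> \oo] --> +oo ->
  pospart (T k) y @[k --> \oo] --> (Calpha * I * rho y `^ alpha)%:E.
Proof.
move=> T1 Too; have r0 : 0 <= rho y := trawl_inv_ge0 hg y.
have -> : (Calpha * I * rho y `^ alpha)%:E = (\int[mu]_(u in `[0%R, tau]) (limit_height u y)%:E)%E.
  have E u : limit_height u y = Calpha * rho y `^ alpha * `|c u| `^ alpha.
    by rewrite /limit_height normrM powRM// (ger0_norm r0) mulrAC mulrA.
  under eq_integral do rewrite E EFinM.
  have fn : (\int[mu]_(u in `[0%R, tau]) (`|c u| `^ alpha)%:E)%E \is a fin_num.
    exact: (integrable_fin_num _ powR_c_integrable).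
  rewrite ge0_integralZl_EFin//; last 2 first.
  - apply: measurable_funTS; apply/measurable_EFinP.
    by apply: (measurableT_comp (measurable_powR alpha)); exact: measurableT_comp.
  - by rewrite mulr_ge0 ?powR_ge0.
  rewrite -(fineK fn).
  by rewrite -EFinM -/I mulrAC.
pose M : R := D * ((B * rho y) `^ alpha + (B * rho y) `^ q).
have [|||||_ _ H] := @dominated_convergence _ _ _ mu `[0%R, tau] (measurable_itv _)
  (fun k u => (T k * h (T k) (T k * u, y))%:E) (fun u => (limit_height u y)%:E) (fun=> M%:E).
- move=> k; apply: measurable_funTS; apply/measurable_EFinP; apply: measurable_funM => //.
  by apply: (measurableT_comp (mhx (T k) y)); exact: measurable_funM.
- apply: measurable_funTS; apply/measurable_EFinP; apply: measurable_funM => //.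
  apply: (measurableT_comp (measurable_powR alpha)).
  by apply: measurableT_comp => //; exact: measurable_funM.
- have [N [mN N0 sub]] := ae_neq_times; exists N; split => // u /= nH; apply: sub => /= ut; apply: nH.
  rewrite in_itv/= => /andP[u0 _].
  by apply: cvg_EFin; [exact: nearW|exact: h_cvg].
- apply/integrableP; split => //; rewrite integral_cst//= lebesgue_measure_itv/= lte_fin tau0.
  by rewrite -EFinD -EFinM ltry.
- apply: aeW => u k _; rewrite lee_fin ger0_norm; last by rewrite mulr_ge0// (le_trans ler01).
  exact: pospart_le_pt.
- exact: H.
Qed.

Let rho_integrable p (M : R) : 0 <= p -> p < 1 + gamma ->
  mu.-integrable `]0, g 0] (EFin \o (fun y => M * rho y `^ p)).
Proof.
move=> p0 p1.
have mr : measurable_fun setT (fun y => rho y `^ p).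
  by apply: (measurableT_comp (measurable_powR p)); exact: (measurable_trawl_inv hg).
apply: integrable_mull => //; apply/integrableP; split.
  by apply: measurable_funTS; exact/measurable_EFinP.
under eq_integral do rewrite /= ger0_norm ?powR_ge0//.
exact: (trawl_inv_powR_lty hgamma hg).
Qed.

(** Dominated convergence in the height [y]. The dominating function combines the powers 1, [alpha]
    and [q] of [rho], all with exponent below [1 + gamma], and only [pospart] survives. *)
Lemma energy_cvg (T : R ^nat) : (forall k, 1 <= T k) -> T k @[k --> \oo] --> +oo ->
  energy nu (fun p => (T k `^ alpha^-1)^-1 * L (T k) p) @[k --> \oo] -->
  (Calpha * I * fine (\int[mu]_(y in `]0%R, g 0%R]) (rho y `^ alpha)%:E))%:E.
Proof.
move=> T1 Too; have Tp k : 0 < T k := lt_le_trans ltr01 (T1 k).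
have a1 : alpha < 1 + gamma := le_lt_trans aq hq.
under eq_fun do rewrite energy_split//.
have -> : (Calpha * I * fine (\int[mu]_(y in `]0%R, g 0%R]) (rho y `^ alpha)%:E))%:E =
    (\int[mu]_(y in `]0%R, g 0%R]) (Calpha * I * rho y `^ alpha)%:E)%E.
  under [RHS]eq_integral do rewrite EFinM.
  have i1 := rho_integrable 1 (ltW halpha) a1.
  have i2 : mu.-integrable `]0, g 0] (EFin \o (fun y => rho y `^ alpha)).
    by apply: eq_integrable i1 => // y _; rewrite /= mul1r.
  by rewrite integralZl// EFinM fineK//; apply: integrable_fin_num.
pose G y := D * (rho y + 2 * (B `^ q * (tau * rho y `^ q))) +
  tau * (D * ((B * rho y) `^ alpha + (B * rho y) `^ q)).
have [|||||_ _ H] := @dominated_convergence _ _ _ mu `]0%R, g 0%R] (measurable_itv _)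
  (fun k y => negpart (T k) y + pospart (T k) y)%E (fun y => (Calpha * I * rho y `^ alpha)%:E)
  (fun y => (G y)%:E).
- move=> k; apply: measurable_funTS; apply: emeasurable_funD; first exact: measurable_negpart.
  by apply: measurable_pospart; exact: ltW.
- apply: measurable_funTS; apply/measurable_EFinP; apply: measurable_funM => //.
  by apply: (measurableT_comp (measurable_powR alpha)); exact: (measurable_trawl_inv hg).
- apply: aeW => y _; rewrite -[X in _ --> X]add0e; apply: cvgeD => //.
  + exact: negpart_cvg.
  + exact: pospart_cvg.
- have GE : G = (fun y => (D * rho y `^ 1 + (2 * D * B `^ q * tau) * rho y `^ q) +
     ((tau * D * B `^ alpha) * rho y `^ alpha + (tau * D * B `^ q) * rho y `^ q)).
    apply/funext => y; have r0 : 0 <= rho y := trawl_inv_ge0 hg y.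
    rewrite /G !powRM// powRr1//; ring.
  rewrite (_ : (fun y => (G y)%:E) = EFin \o G)// GE.
  by apply: integrable_addr => //; apply: integrable_addr => //; apply: rho_integrable => //;
    rewrite ?ltrDl//; exact: ltW.
- apply: aeW => y k _.
  have np : (0 <= negpart (T k) y)%E by apply: integral_ge0 => x _; rewrite lee_fin; exact: (h_ge0 (T k) (x, y)).
  have pp : (0 <= pospart (T k) y)%E.
    by apply: integral_ge0 => x _; rewrite lee_fin mulr_ge0// ltW.
  rewrite gee0_abs; last exact: adde_ge0.
  rewrite (_ : (G y)%:E = (D * (rho y + 2 * (B `^ q * (tau * rho y `^ q))))%:E +
    (tau * (D * ((B * rho y) `^ alpha + (B * rho y) `^ q)))%:E)%E//.
  apply: leeD; first exact: negpart_dom.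
  apply: (@le_trans _ _ (\int[mu]_(u in `[0%R, tau]) (D * ((B * rho y) `^ alpha + (B * rho y) `^ q))%:E)%E).
    apply: ge0_le_integral => //.
    + by move=> x _; rewrite lee_fin mulr_ge0// ltW.
    + apply: measurable_funTS; apply/measurable_EFinP; apply: measurable_funM => //.
      by apply: (measurableT_comp (mhx (T k) y)); exact: measurable_funM.
    + by move=> x _; rewrite lee_fin; exact: pospart_le_pt.
  by rewrite integral_cst//= lebesgue_measure_itv/= lte_fin tau0 sube0 -EFinM lee_fin mulrC.
- exact: H.
Qed.

End long_time_limit.

(** * Finite-dimensional laws of the stable process *)

Lemma same_law_expect {R : realType} d (Om : measurableType d) (P : probability Om R)
    (X Y : Om -> R) (f : R -> R) : measurable_fun setT X -> measurable_fun setT Y ->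
  same_law P X Y -> bdm f -> \int[P]_w f (X w) = \int[P]_w f (Y w).
Proof.
move=> mX mY XY bf; congr fine.
have E (Z : Om -> R) : measurable_fun setT Z ->
   (\int[P]_w (f (Z w))%:E = \int[pushforward P Z]_x (f x)%:E)%E.
  move=> mZ; rewrite integral_pushforward//.
  - by apply/measurable_EFinP; exact: bdm_measurable bf.
  - have bZ : bdm (fun w => f (Z w)) by exact: (bdm_comp bf mZ).
    exact: (bdm_integrable P measurableT bZ).
rewrite (E _ mX) (E _ mY).
by apply: eq_measure_integral => A mA _; exact: XY.
Qed.

Section stable_process_charf.
Context {R : realType} {d : measure_display} {Om : measurableType d} (Q : probability Om R).
Variables (alpha : R) (halpha : 0 < alpha) (xi : R -> {RV Q >-> R}).
Hypothesis hxi : symmetric_stable_levy_process alpha xi.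
Local Notation mu := (@lebesgue_measure R).

Let xi_cos t c : 0 <= t -> \int[Q]_w cos (c * xi t w) = expR (- (t * `|c| `^ alpha)).
Proof.
move=> t0; have := hxi.2 t c t0.
by rewrite /charf unlock => /eqP; rewrite eq_complex /= => /andP[/eqP<-].
Qed.

Let xi_sin t c : 0 <= t -> \int[Q]_w sin (c * xi t w) = 0.
Proof.
move=> t0; have := hxi.2 t c t0.
by rewrite /charf unlock => /eqP; rewrite eq_complex /= => /andP[_ /eqP<-].
Qed.

Variables (tau : R) (tau0 : 0 < tau).
Variables (n : nat) (theta t : 'I_n -> R) (ht : forall i, 0 <= t i <= tau).

Let L : seq R := sort <=%O (0 :: codom t).
(** The default [tau] closes the grid: [u (size L) = tau], and the sequence is constant from there
    on, which yields the infinite nondecreasing sequence that [levy_process_indep] asks for.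
    Including 0 in the list makes it start at 0. *)
Let u (k : nat) := nth tau L k.

Let mem_L x : x \in L = (x \in 0 :: codom t). Proof. exact: mem_sort. Qed.

Let L_bounds x : x \in L -> 0 <= x <= tau.
Proof.
rewrite mem_L inE => /predU1P[->|/codomP[i ->]]; last exact: ht.
by rewrite lexx ltW.
Qed.

Let u_bounds k : 0 <= u k <= tau.
Proof.
have [kL|kL] := ltnP k (size L); first exact/L_bounds/mem_nth.
by rewrite /u nth_default// lexx andbT ltW.
Qed.

Let u_homo : {homo u : i j / (i <= j)%N >-> i <= j}.
Proof.
move=> i j ij; have [jL|jL] := ltnP j (size L).
  apply: (sorted_leq_nth le_trans le_refl) => //; first exact: sort_le_sorted.
  by rewrite inE (leq_ltn_trans ij).
by rewrite {2}/u nth_default//; have /andP[] := u_bounds i.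
Qed.

Let j (i : 'I_n) := index (t i) L.

Let u_j i : u (j i) = t i.
Proof. by rewrite /u nth_index// mem_L inE codom_f orbT. Qed.

Let u0 : u 0%N = 0.
Proof.
have /andP[h _] := u_bounds 0%N; apply/eqP; rewrite eq_le h andbT.
have <- : u (index 0 L) = 0 by rewrite /u nth_index// mem_L mem_head.
exact: u_homo.
Qed.

Let m := size L.

Let um : u m = tau. Proof. by rewrite /u nth_default. Qed.

Let j_le i : (j i <= m)%N. Proof. exact: index_size. Qed.

Let D k w := xi (u k.+1) w - xi (u k) w.
(** Abel summation: the increment over cell [k] enters every [xi (t i)] with [k < j i]. The same
    number is the value of the step function [c] on that cell. *)
Let C k : R := \sum_i theta i * (k < j i)%N%:R.

Let mD k : measurable_fun setT (D k).
Proof. exact: measurable_funB. Qed.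

Let D_law k : same_law Q (D k) (xi (u k.+1 - u k)).
Proof. by apply: (levy_process_stationary hxi.1) => //; [case/andP: (u_bounds k)|exact: u_homo]. Qed.

Let D_cos k : \int[Q]_w cos (C k * D k w) = expR (- ((u k.+1 - u k) * `|C k| `^ alpha)).
Proof.
rewrite (same_law_expect (f := fun x => cos (C k * x)) (mD k) _ (D_law k))//; last exact: bdm_cosZ.
by rewrite xi_cos// subr_ge0 u_homo.
Qed.

Let D_sin k : \int[Q]_w sin (C k * D k w) = 0.
Proof.
rewrite (same_law_expect (f := fun x => sin (C k * x)) (mD k) _ (D_law k))//; last exact: bdm_sinZ.
by rewrite xi_sin// subr_ge0 u_homo.
Qed.

Let sum_increments w : xi 0 w = 0 ->
  \sum_i theta i * xi (t i) w = \sum_(k <- index_iota 0 m) C k * D k w.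
Proof.
move=> xi0.
have E i : xi (t i) w = \sum_(k <- index_iota 0 m) (k < j i)%N%:R * D k w.
  transitivity (\sum_(0 <= k < j i) D k w).
    by rewrite telescope_sumr// u_j u0 xi0 subr0.
  rewrite (big_cat_nat (leq0n _) (j_le i))/=.
  have -> : \sum_(j i <= k < m) (k < j i)%N%:R * D k w = 0.
    by rewrite big_nat_cond big1 => // k; rewrite andbT => /andP[jk _]; rewrite ltnNge jk mul0r.
  rewrite addr0.
  rewrite !big_nat; apply: eq_bigr => k /andP[_ kj]; rewrite kj mul1r//.
under eq_bigr do rewrite E mulr_sumr.
rewrite exchange_big/=; apply: eq_bigr => k _; rewrite /C mulr_suml.
by apply: eq_bigr => i _; rewrite mulrA.
Qed.

Let c s : R := \sum_i theta i * (s <= t i)%R%:R.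

Let c_cell k s : u k < s <= u k.+1 -> c s = C k.
Proof.
move=> /andP[ks sk]; apply: eq_bigr => i _; congr (_ * (nat_of_bool _)%:R).
rewrite -u_j; apply/idP/idP => [sj|kj]; last by rewrite (le_trans sk)// u_homo.
by rewrite ltnNge; apply/negP => jk; have := lt_le_trans ks sj; rewrite ltNge u_homo.
Qed.

Let integral_cells : \int[mu]_(s in `[0, tau]) (`|c s| `^ alpha) =
  \sum_(k < m) (u k.+1 - u k) * `|C k| `^ alpha.
Proof.
have Ic a b : mu.-integrable `[a, b] (EFin \o (fun s => `|c s| `^ alpha)).
  by apply/bdm_itv_integrable/bdm_step_powR; exact: ltW.
have := Rintegral_telescope u_homo (leqnn m) (Ic (u 0%N) (u m)); rewrite u0 um => <-.
apply: eq_bigr => k _; have uk : u k <= u k.+1 by exact: u_homo.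
(* [c] jumps just after the times [t i], so it is constant on cells open at the left end. *)
rewrite -Rintegral_itv_obnd_cbnd; last first.
  by apply: integrableS (Ic (u k) (u k.+1)) => //; exact: subset_itv_oc_cc.
have -> : \int[mu]_(x in `]u k, u k.+1]) (`|c x| `^ alpha) = \int[mu]_(x in `]u k, u k.+1]) (`|C k| `^ alpha).
  by apply: eq_Rintegral => s; rewrite inE/= in_itv/= => sk; rewrite (c_cell sk).
rewrite Rintegral_cst// mulrC; congr (_ * _).
rewrite /= lebesgue_measure_itv/= lte_fin; case: ltP => [_|ku]/=; first by [].
by apply/esym/eqP; rewrite subr_eq0 eq_le ku uk.
Qed.

Lemma stable_process_charf a :
  \int[Q]_w cos (a + \sum_i theta i * xi (t i) w) =
  cos a * expR (- \int[mu]_(s in `[0, tau]) (`|c s| `^ alpha)).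
Proof.
have hI := levy_process_indep hxi.1 (t := u); rewrite u0 lexx in hI.
have {}hI := hI isT u_homo.
transitivity (\int[Q]_w cos (a + \sum_(k <- index_iota 0 m) C k * D k w)).
  apply: expect_ae_eq.
  - apply: (bdm_measurable (bdm_cos _)); apply: measurable_funD => //.
    by apply: measurable_sum => i; exact: measurable_funM.
  - apply: (bdm_measurable (bdm_cos _)); apply: measurable_funD => //.
    by apply: measurable_sum => i; exact: measurable_funM.
  by apply: filterS (levy_process_start hxi.1) => w w0; rewrite sum_increments.
rewrite (sum_charf mD hI D_cos D_sin) ?iota_uniq//; congr (_ * _).
rewrite -expR_sum integral_cells -sumrN; congr expR.
by rewrite big_mkord.
Qed.

End stable_process_charf.

(** * The continuity theorem *)

Section trigonometric_polynomials.
Context {R : realType} (n : nat).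
Implicit Types (x y theta : 'I_n -> R) (h : ('I_n -> R) -> R).

(** The span of cosines of affine forms. The free phase supplies sines and constants, so convergence
    of the expected cosines for all phases extends to every element by linearity. *)
Inductive trig_poly : (('I_n -> R) -> R) -> Prop :=
| trig_cos a theta : trig_poly (fun x => cos (a + \sum_i theta i * x i))
| trig_add h1 h2 : trig_poly h1 -> trig_poly h2 -> trig_poly (fun x => h1 x + h2 x)
| trig_scale c h : trig_poly h -> trig_poly (fun x => c * h x).

Lemma trig_cst c : trig_poly (fun=> c).
Proof.
have -> : (fun=> c) = (fun x : 'I_n -> R => c * cos (0 + \sum_i 0 * x i)).
  by apply/funext => x; rewrite big1 ?addr0 ?cos0 ?mulr1// => i _; rewrite mul0r.
exact/trig_scale/trig_cos.
Qed.

Lemma trig_mul_cos b theta h : trig_poly h ->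
  trig_poly (fun x => cos (b + \sum_i theta i * x i) * h x).
Proof.
elim=> [a eta|h1 h2 _ ih1 _ ih2|c h0 _ ih].
- have -> : (fun x => cos (b + \sum_i theta i * x i) * cos (a + \sum_i eta i * x i)) =
     (fun x => 2^-1 * (cos ((b + a) + \sum_i (theta i + eta i) * x i) +
                       cos ((b - a) + \sum_i (theta i - eta i) * x i))).
    apply/funext => x.
    have -> : b + a + \sum_i (theta i + eta i) * x i =
        (b + \sum_i theta i * x i) + (a + \sum_i eta i * x i).
      by rewrite addrACA -big_split/=; congr (_ + _); apply: eq_bigr => i _; rewrite mulrDl.
    have -> : b - a + \sum_i (theta i - eta i) * x i =
        (b + \sum_i theta i * x i) - (a + \sum_i eta i * x i).
      rewrite opprD addrACA -sumrB/=; congr (_ + _); apply: eq_bigr => i _; rewrite mulrBl//.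
    by move: (b + _) (a + _) => u v; rewrite cosD cosB; field.
  by apply: trig_scale; apply: trig_add; exact: trig_cos.
- rewrite (_ : (fun x => _) = (fun x => cos (b + \sum_i theta i * x i) * h1 x +
    cos (b + \sum_i theta i * x i) * h2 x)); first exact: trig_add.
  by apply/funext => x; rewrite mulrDr.
- rewrite (_ : (fun x => _) = (fun x => c * (cos (b + \sum_i theta i * x i) * h0 x))); first exact: trig_scale.
  by apply/funext => x; rewrite mulrCA.
Qed.

Lemma trig_poly_bdm d (T : measurableType d) (Y : 'I_n -> T -> R) h :
  (forall i, measurable_fun setT (Y i)) -> trig_poly h -> bdm (fun w => h (Y ^~ w)).
Proof.
move=> mY; elim=> [a theta|h1 h2 _ ih1 _ ih2|c h0 _ ih].
- apply: bdm_cos; apply: measurable_funD => //.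
  by apply: measurable_sum => i; exact: measurable_funM.
- exact: bdmD.
- by apply: bdmM => //; exact: bdm_cst.
Qed.

Definition bump (k : 'I_n -> nat) (i j : 'I_n) : nat := (k j + (j == i))%N.

(* The mean of [G] after a walk taking the steps listed in [l], the step along
   [i] being accepted with probability [p i]. *)
Fixpoint walk_mean (p : 'I_n -> R) (l : seq 'I_n) (G : ('I_n -> nat) -> R) (k : 'I_n -> nat) : R :=
  if l is i :: l' then p i * walk_mean p l' G (bump k i) + (1 - p i) * walk_mean p l' G k
  else G k.

Variable p : 'I_n -> R.
Hypothesis p01 : forall i, 0 <= p i <= 1.

Lemma walk_mean_le l G1 G2 k : (forall k, G1 k <= G2 k) -> walk_mean p l G1 k <= walk_mean p l G2 k.
Proof.
move=> G12; elim: l k => [|i l ih] k //=; have /andP[p0 p1] := p01 i.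
by rewrite lerD// ler_wpM2l// subr_ge0.
Qed.

Lemma walk_mean_affine l a b G k : walk_mean p l (fun k => a + b * G k) k = a + b * walk_mean p l G k.
Proof. by elim: l k => [//|i l ih] k /=; rewrite !ih; ring. Qed.

Lemma walk_mean_sum l (J : Type) (r : seq J) (G : J -> ('I_n -> nat) -> R) k :
  walk_mean p l (fun k => \sum_(j <- r) G j k) k = \sum_(j <- r) walk_mean p l (G j) k.
Proof.
elim: l k => [//|i l ih] k /=; rewrite !ih !mulr_sumr -big_split/=.
by [].
Qed.

(** Variance plus squared bias: coordinate [j] is [k j] plus a binomial count over the occurrences
    of [j] in [l]. *)
Lemma walk_mean_square l j (c : R) k :
  walk_mean p l (fun k => ((k j)%:R - c) ^+ 2) k =
  (count_mem j l)%:R * (p j * (1 - p j)) + ((k j)%:R + (count_mem j l)%:R * p j - c) ^+ 2.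
Proof.
elim: l k => [|i l ih] k /=; first by rewrite !mul0r addr0 add0r.
rewrite !ih /bump eq_sym; case: eqVneq => [->|_] /=.
  by rewrite add1n addn1 -!natr1; ring.
by rewrite add0n addn0; ring.
Qed.

End trigonometric_polynomials.

Section approximation.
Context {R : realType} (n : nat).
Variables (f : 'rV[R]_n -> R) (cf : continuous f) (M : R) (fM : forall v, `|f v| <= M).
Variables (L : R) (L0 : 0 < L).

(** Brings [lam * y] into [[- 1/2, 1/2]] for [|y| <= L], a range where [sin] is injective and stays
    away from 1 and -1. *)
Let lam : R := (2 * L)^-1.
Let lam0 : 0 < lam. Proof. by rewrite invr_gt0 mulr_gt0. Qed.
Let s0 : R := sin 2^-1.

Let half_pihalf : (2^-1 : R) < pi / 2.
Proof. have := @pi_ge2 R; lra. Qed.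

Let s0_gt0 : 0 < s0.
Proof. by apply: sin_gt0_pi; have := @pi_ge2 R; lra. Qed.

Let s0_lt1 : s0 < 1.
Proof.
by rewrite -(sin_pihalf R) ltr_sin// in_itv/=; have := @pi_ge2 R; lra.
Qed.

Let phi (y : R) := (1 + sin (lam * y)) / 2.
(** Clipping at [s0 = sin (1/2) < 1] keeps the argument in the open interval where [asin] is
    continuous, so [node] is continuous on the whole line and still inverts [phi] on [[- L, L]]. *)
Let clip (s : R) := Num.max (- s0) (Num.min s0 (2 * s - 1)).
Let node (s : R) := lam^-1 * asin (clip s).

Let phi01 y : 0 <= phi y <= 1.
Proof. by have := sin_geN1 (lam * y); have := sin_le1 (lam * y); rewrite /phi; lra. Qed.

Let clip_bounds s : - s0 <= clip s <= s0.
Proof. by rewrite /clip le_max lexx/= ge_max ge_min lexx/= andbT; have := s0_gt0; lra. Qed.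

Let node_phi y : `|y| <= L -> node (phi y) = y.
Proof.
rewrite ler_norml => /andP[y1 y2].
have ly : - 2^-1 <= lam * y <= 2^-1.
  have e1 : lam * L = 2^-1 by rewrite /lam; field; rewrite gt_eqF.
  by rewrite -e1 -mulrN !ler_pM2l// y1.
have /andP[l1 l2] := ly.
have e : 2 * phi y - 1 = sin (lam * y) by rewrite /phi; field.
have pi2 := @pi_ge2 R.
have hs1 : sin (lam * y) <= s0 by rewrite leNgt /s0 ltr_sin -?leNgt// in_itv/=; lra.
have hs2 : - s0 <= sin (lam * y) by rewrite leNgt /s0 -sinN ltr_sin -?leNgt// in_itv/=; lra.
rewrite /node /clip e (min_idPr hs1) (max_idPr hs2) sinK ?mulKf ?gt_eqF//.
rewrite in_itv/=; have := half_pihalf; lra.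
Qed.

Let node_continuous s : {for s, continuous node}.
Proof.
apply: continuousM; first exact: cvg_cst.
apply: (@continuous_comp _ _ _ clip asin).
  apply: continuous_max; first exact: cvg_cst.
  apply: continuous_min; first exact: cvg_cst.
  apply: continuousB; last exact: cvg_cst.
  by apply: continuousM; [exact: cvg_cst|exact: cvg_id].
apply: continuous_asin; have := clip_bounds s; have := s0_lt1; lra.
Qed.

Let F (s : 'I_n -> R) := f (\row_i node (s i)).

Let F_continuous (s : 'I_n -> R) (e : R) : 0 < e ->
  exists2 r : R, 0 < r & forall s', (forall i, `|s' i - s i| < r) -> `|F s' - F s| < e.
Proof.
move=> e0; have := @cf (\row_i node (s i)); move/cvgrPdist_lt => /(_ e e0).
rewrite -nbhs_ballE => -[r1 /= r10 hr1].
have : \forall r \near (0:R)^'+, forall i, forall y, `|y - s i| < r -> `|node y - node (s i)| < r1.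
  apply: filter_forall => i.
  have := @node_continuous (s i); move/cvgrPdist_lt => /(_ r1 r10).
  rewrite -nbhs_ballE => -[r2 /= r20 hr2].
  apply: filterS (nbhs_right_lt r20) => r rr2 y yr; rewrite distrC; apply: hr2.
  by rewrite /ball/= distrC (lt_trans yr).
move=> H; have [r [r0 Hr]] : exists r : R, 0 < r /\ forall i, forall y, `|y - s i| < r -> `|node y - node (s i)| < r1.
  near (0:R)^'+ => r; exists r; split; last by near: r.
  by near: r; exact: nbhs_right_gt.
exists r => // s' hs'; rewrite distrC; apply: hr1.
by split => // i j; rewrite !mxE /ball/= distrC; exact: Hr.
Unshelve. all: by end_near. Qed.

(** Compactness of the unit cube makes the modulus of continuity uniform in the base point [p]; the
    neighbour [s] may lie outside the cube. *)
Let F_modulus (e : R) : 0 < e -> exists2 eta : R, 0 < eta &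
  forall p s : 'I_n -> R, (forall i, 0 <= p i <= 1) -> (forall i, `|s i - p i| < eta) -> `|F s - F p| <= e.
Proof.
move=> e0.
pose K := [set v : 'rV[R]_n | forall i, `[0, 1]%classic (v ord0 i)].
have cK : compact K by exact: (@rV_compact R n (fun=> `[0, 1]%classic) (fun i => @segment_compact R 0 1)).
pose G (v : 'rV[R]_n) := fun i => v ord0 i.
pose Q (eta : R) (v : 'rV[R]_n) := forall s : 'I_n -> R, (forall i, `|s i - G v i| < eta) -> `|F s - F (G v)| <= e.
have : \forall eta \near (0:R)^'+, K `<=` Q eta.
  apply: ((compact_near_coveringP K).1 cK) => v Kv.
  have e2 : 0 < e / 2 by rewrite divr_gt0.
  have [r r0 hr] := F_continuous (G v) e2.
  have near_v : \forall v' \near v, forall i, `|G v i - G v' i| < r / 2.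
    apply/nbhs_ballP; exists (r / 2); rewrite /= ?divr_gt0// => v' [_ hv'] i.
    exact: (hv' ord0 i).
  near=> v' eta => s hs.
  have vv' i : `|G v' i - G v i| < r / 2.
    rewrite distrC; move: i; near: v'; exact: near_v.
  have eta2 : eta < r / 2 by near: eta; apply: nbhs_right_lt; rewrite divr_gt0.
  have h1 : `|F s - F (G v)| < e / 2.
    apply: hr => i; rewrite (le_lt_trans (ler_distD (G v' i) _ _))// [ltRHS](splitr r) ltrD//.
    exact: lt_trans (hs i) eta2.
  have h2 : `|F (G v') - F (G v)| < e / 2.
    by apply: hr => i; rewrite (lt_trans (vv' i))//; have := r0; lra.
  rewrite (le_trans (ler_distD (F (G v)) _ _))// [leRHS](splitr e) lerD//; first exact: ltW.
  by rewrite distrC ltW.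
move=> H; have [eta [eta0 He]] : exists eta : R, 0 < eta /\ K `<=` Q eta.
  near (0:R)^'+ => eta; exists eta; split; last by near: eta.
  by near: eta; exact: nbhs_right_gt.
exists eta => // p s p01 hs.
have pE : p = G (\row_i p i) by apply/funext => i; rewrite /G mxE.
rewrite pE; apply: He => [i|i]; last by rewrite -pE.
by rewrite mxE/= in_itv/=.
Unshelve. all: by end_near.
Qed.

Let phi_mul_trig i h : trig_poly h -> trig_poly (fun x : 'I_n -> R => phi (x i) * h x).
Proof.
move=> th.
have -> : (fun x => phi (x i) * h x) = (fun x => 2^-1 * h x + 2^-1 *
    (cos (- (pi / 2) + \sum_j (if j == i then lam else 0) * x j) * h x)).
  apply/funext => x; rewrite (bigD1 i)//= eqxx big1 => [|j /negbTE ->]; last by rewrite mul0r.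
  by rewrite addr0 [- _ + _]addrC cosBpihalf /phi; field.
by apply: trig_add; apply: trig_scale => //; exact: trig_mul_cos.
Qed.

Let walk_trig l G k : trig_poly (fun x : 'I_n -> R => walk_mean (fun i => phi (x i)) l G k).
Proof.
elim: l k => [|i l ih] k /=; first exact: trig_cst.
set h1 := fun x : 'I_n -> R => walk_mean (fun i => phi (x i)) l G (bump k i).
set h2 := fun x : 'I_n -> R => walk_mean (fun i => phi (x i)) l G k.
have -> : (fun x : 'I_n -> R => phi (x i) * walk_mean (fun i => phi (x i)) l G (bump k i) +
    (1 - phi (x i)) * walk_mean (fun i => phi (x i)) l G k) =
    (fun x => phi (x i) * h1 x + (h2 x + (-1) * (phi (x i) * h2 x))).
  by apply/funext => x; rewrite /h1 /h2; ring.
have t1 : trig_poly h1 by exact: ih.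
have t2 : trig_poly h2 by exact: ih.
apply: trig_add; first exact: phi_mul_trig.
by apply: trig_add => //; apply: trig_scale; exact: phi_mul_trig.
Qed.

(* The Bernstein operator, with success probabilities [(1 + sin (lam * x_i)) / 2],
   maps [f] to a trigonometric polynomial. *)
Lemma trig_approximation (e : R) : 0 < e -> exists T, [/\ trig_poly T,
  (forall x, `|T x| <= M) & forall x : 'I_n -> R, (forall i, `|x i| <= L) -> `|T x - f (\row_i x i)| <= e].
Proof.
move=> e0; have e2 : 0 < e / 2 by rewrite divr_gt0.
have [eta eta0 Heta] := F_modulus e2.
have M0 : 0 <= M by exact: le_trans (fM 0).
(* Chebyshev's constant: if some coordinate of [k / m] is at least [eta] away from [p], then
   [S k >= (m * eta) ^+ 2], so [C / m ^+ 2 * S k] reaches [2 * M], the largest possible error. The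
   mean of [S] is at most [m * n], which leaves [C * n / m] and fixes [m]. *)
pose C := 2 * M / eta ^+ 2.
have C0 : 0 <= C by apply: divr_ge0; [exact: mulr_ge0|exact: sqr_ge0].
have [m' hm'] := exists_nat_gt (2 * (C * n%:R) / e); pose m := m'.+1.
have m0 : 0 < m%:R :> R by [].
have hm : C * n%:R / m%:R <= e / 2.
  rewrite ler_pdivrMr//; rewrite ltr_pdivrMr// in hm'.
  have : m'%:R * e <= m%:R * e by rewrite ler_pM2r// ler_nat.
  lra.
pose l := flatten (nseq m (enum 'I_n)).
have cl j : count_mem j l = m.
  by rewrite count_flatten map_nseq sumn_nseq count_uniq_mem ?enum_uniq// mem_enum mul1n.
pose G (k : 'I_n -> nat) := F (fun i => (k i)%:R / m%:R).
pose T (x : 'I_n -> R) := walk_mean (fun i => phi (x i)) l G (fun=> 0%N).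
have FM s : `|F s| <= M by exact: fM.
exists T; split.
- exact: walk_trig.
- move=> x; have px i := phi01 (x i); rewrite ler_norml /T; apply/andP; split.
    have := walk_mean_le px l (G1 := fun k => - M + 0 * G k) (G2 := G) (fun=> 0%N) _.
    by rewrite walk_mean_affine mul0r addr0; apply=> k; rewrite mul0r addr0; have := FM (fun i => (k i)%:R / m%:R); rewrite ler_norml => /andP[].
  have := walk_mean_le px l (G1 := G) (G2 := fun k => M + 0 * G k) (fun=> 0%N) _.
  by rewrite walk_mean_affine mul0r addr0; apply=> k; rewrite mul0r addr0; have := FM (fun i => (k i)%:R / m%:R); rewrite ler_norml => /andP[].
move=> x xL; pose p i := phi (x i); have px i : 0 <= p i <= 1 := phi01 (x i).
have -> : f (\row_i x i) = F p.
  by congr f; apply/rowP => i; rewrite !mxE /p node_phi.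
pose S (k : 'I_n -> nat) := \sum_i ((k i)%:R - m%:R * p i) ^+ 2.
have S0 k : 0 <= S k by apply: sumr_ge0 => i _; exact: sqr_ge0.
have ptw k : `|G k - F p| <= e / 2 + C / m%:R ^+ 2 * S k.
  have [near_p|] := pselect (forall i, `|(k i)%:R / m%:R - p i| < eta).
    rewrite (le_trans (Heta _ _ px near_p))// lerDl mulr_ge0// divr_ge0// sqr_ge0//.
  move=> /existsNP[i /negP]; rewrite -leNgt => far.
  rewrite (@le_trans _ _ (2 * M))//.
    rewrite (le_trans (ler_normB _ _))// (le_trans (lerD (FM _) (FM _)))//; lra.
  rewrite (@le_trans _ _ (C / m%:R ^+ 2 * S k))//; last by rewrite lerDr ltW.
  have hS : (m%:R * eta) ^+ 2 <= S k.
    rewrite /S (bigD1 i)//= -[leLHS]addr0 lerD//; last by apply: sumr_ge0 => j _; exact: sqr_ge0.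
    rewrite (_ : (k i)%:R - m%:R * p i = m%:R * ((k i)%:R / m%:R - p i)); last by field; rewrite gt_eqF.
    rewrite !exprMn ler_pM2l ?exprn_gt0// -[leRHS](real_normK (num_real _)).
    by rewrite ler_sqr ?nnegrE// ltW.
  rewrite (le_trans _ (ler_wpM2l _ hS))//; last by rewrite divr_ge0// sqr_ge0.
  apply: ler_of_eq; rewrite /C; field.
  by rewrite !gt_eqF.
have meanS : walk_mean p l S (fun=> 0%N) <= m%:R * n%:R.
  rewrite /S walk_mean_sum (@le_trans _ _ (\sum_(i < n) m%:R))//; last first.
    by rewrite sumr_const card_ord mulr_natr.
  apply: ler_sum => i _; rewrite walk_mean_square cl add0r subrr expr0n addr0.
  rewrite -[leRHS]mulr1 ler_wpM2l//; have /andP[p0 p1] := px i; nra.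
have mean_err : C / m%:R ^+ 2 * walk_mean p l S (fun=> 0%N) <= e / 2.
  have Cm : 0 <= C / m%:R ^+ 2 by apply: divr_ge0 => //; exact: sqr_ge0.
  apply: (le_trans (ler_wpM2l Cm meanS)).
  rewrite (le_trans _ hm)// le_eqVlt; apply/orP; left; apply/eqP; field.
  by rewrite gt_eqF.
rewrite ler_norml; apply/andP; split.
  have := walk_mean_le px l (G1 := fun k => (F p - e / 2) + (- (C / m%:R ^+ 2)) * S k) (G2 := G) (fun=> 0%N) _.
  rewrite walk_mean_affine => H; have {}H := H _; rewrite -/(T x) in H.
  suff : F p - e / 2 + - (C / m%:R ^+ 2) * walk_mean p l S (fun=> 0%N) <= T x by lra.
  by apply: H => k; have := ptw k; rewrite ler_norml => /andP[]; lra.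
have := walk_mean_le px l (G1 := G) (G2 := fun k => (F p + e / 2) + (C / m%:R ^+ 2) * S k) (fun=> 0%N) _.
rewrite walk_mean_affine => H.
suff : T x <= F p + e / 2 + (C / m%:R ^+ 2) * walk_mean p l S (fun=> 0%N) by lra.
by apply: H => k; have := ptw k; rewrite ler_norml => /andP[]; lra.
Qed.

End approximation.

(** * Tails controlled by characteristic functions *)

Section tail_bound.
Context {R : realType}.
Local Notation mu := (@lebesgue_measure R).

Lemma integral_cosM (u y : R) : 0 < u -> y != 0 ->
  \int[mu]_(t in `[0, u]) cos (t * y) = sin (u * y) / y.
Proof.
move=> u0 y0; rewrite /Rintegral.
have dF (x : R) : is_derive x 1 (fun t => sin (t * y) / y) (cos (x * y)).
  have h1 : is_derive x 1 (fun t => t * y) y.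
    by apply: is_derive_eq; rewrite scaler0 add0r /GRing.scale/= mulr1.
  apply: is_derive_eq; rewrite ?scaler0 ?add0r /GRing.scale/=; field; exact: y0.
have cF : continuous (fun t : R => sin (t * y) / y).
  by move=> x; apply/differentiable_continuous/derivable1_diffP; case: (dF x).
rewrite (@continuous_FTC2 _ (fun t => cos (t * y)) (fun t => sin (t * y) / y))//.
- by rewrite mul0r sin0 mul0r sube0.
- apply: continuous_subspaceT => x.
  have c1 : {for x, continuous (fun t : R => t * y)}.
    by apply: continuousM; [exact: cvg_id|exact: cvg_cst].
  exact: (continuous_comp c1 (@continuous_cos R (x * y))).
- split.
  + by move=> x _; case: (dF x).
  + by apply: cvg_at_right_filter; exact: cF.
  + by apply: cvg_at_left_filter; exact: cF.
- by move=> x _; rewrite derive1E; case: (dF x).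
Qed.

Variables (u : R) (u0 : 0 < u).
Let U := uniform_prob u0.

(** Equal to [1 - sin (u * y) / (u * y)] for [y != 0]. It is at least [1/2] when [|y| >= 2 / u], and
    its expectation is an average of [1 - E cos (t * Y)]: this is Levy's truncation inequality. *)
Definition tail_weight (y : R) : R := \int[U]_t (1 - cos (t * y)).

Let b1 y : bdm (fun t : R => 1 - cos (t * y)).
Proof. by apply: bdmB; [exact: bdm_cst|apply: bdm_cos; exact: measurable_funM]. Qed.

Let I1 y : mu.-integrable `[0, u] (EFin \o (fun t : R => 1 - cos (t * y))).
Proof. exact: bdm_itv_integrable. Qed.

Let Icos y : mu.-integrable `[0, u] (EFin \o (fun t : R => cos (t * y))).
Proof. by apply/bdm_itv_integrable/bdm_cos; exact: measurable_funM. Qed.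

Let mass : fine (mu `[0, u]) = u.
Proof. by rewrite /= lebesgue_measure_itv/= lte_fin u0 sube0. Qed.

Let tail_weightE y : tail_weight y = u^-1 * \int[mu]_(t in `[0, u]) (1 - cos (t * y)).
Proof. by rewrite /tail_weight /U uniform_Rintegral ?subr0//; exact: bdm_measurable (b1 y). Qed.

Lemma tail_weight_ge0 y : 0 <= tail_weight y.
Proof. by apply: Rintegral_ge0 => t _; exact: one_minus_cos_ge0. Qed.

Lemma tail_weight_le2 y : tail_weight y <= 2.
Proof. by rewrite -[leRHS](expect_cst U); apply: le_expect; [exact: b1|exact: bdm_cst|move=> t; exact: one_minus_cos_le2]. Qed.

Lemma tail_weight_ge y : 2 / u <= `|y| -> 2^-1 <= tail_weight y.
Proof.
move=> uy; have y0 : 0 < `|y| by rewrite (lt_le_trans _ uy)// divr_gt0.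
have yn0 : y != 0 by rewrite -normr_gt0.
have I0 : mu.-integrable `[0, u] (EFin \o (fun=> 1 : R)) by exact/bdm_itv_integrable/bdm_cst.
rewrite tail_weightE RintegralB// integral_cosM// Rintegral_cst// mass mul1r.
have h1 : `|sin (u * y) / y| <= u / 2.
  rewrite normrM normfV ler_pdivrMr//.
  rewrite ler_pdivrMr// in uy.
  have : `|sin (u * y)| <= 1 by rewrite ler_norml sin_geN1 sin_le1.
  lra.
rewrite ler_pdivlMl//; have := ler_norm (sin (u * y) / y); lra.
Qed.

(** As [u] tends to 0 the weight vanishes at each fixed [y]; bounded convergence then makes its
    expectation small for the limit variable. *)
Lemma tail_weight_le y : tail_weight y <= u ^+ 2 * y ^+ 2.
Proof.
rewrite tail_weightE ler_pdivrMl//.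
apply: (@le_trans _ _ (\int[mu]_(t in `[0, u]) (u ^+ 2 * y ^+ 2))); last first.
  by rewrite Rintegral_cst// mass mulrC.
apply: le_Rintegral => //.
  exact/bdm_itv_integrable/bdm_cst.
move=> t; rewrite /= in_itv/= => /andP[t0 tu].
rewrite (le_trans (one_minus_cos_le _))// exprMn.
have h : t ^+ 2 <= u ^+ 2 by rewrite ler_sqr ?nnegrE// ltW.
have := sqr_ge0 t; have := sqr_ge0 y; nra.
Qed.

Section random_variable.
Context d (Om : measurableType d) (P : probability Om R) (Y : Om -> R).
Hypothesis mY : measurable_fun setT Y.

Let bjoint : bdm (fun p : R * Om => 1 - cos (p.1 * Y p.2)).
Proof.
apply: bdmB; first exact: bdm_cst.
apply: bdm_cos; apply: measurable_funM; first exact: measurable_fst.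
exact: (measurableT_comp mY (@measurable_snd _ _ _ _)).
Qed.

Lemma bdm_tail_weight : bdm (fun w => tail_weight (Y w)).
Proof. exact: (bdm_average U P bjoint). Qed.

Lemma expect_tail_weight :
  \int[P]_w tail_weight (Y w) = \int[U]_t (1 - \int[P]_w cos (t * Y w)).
Proof.
rewrite (fubini_bounded U P bjoint); apply: eq_Rintegral => t _ /=.
by rewrite expectB ?expect_cst//; [exact: bdm_cst|apply: bdm_cos; exact: measurable_funM].
Qed.

Lemma tail_le_weight :
  \int[P]_w (2 / u < `|Y w|)%R%:R <= 2 * \int[P]_w tail_weight (Y w).
Proof.
rewrite -expectZl; last exact: bdm_tail_weight.
apply: le_expect.
- by apply: bdm_boolr; apply: measurable_fun_ltr => //; exact: measurableT_comp.
- by apply: bdmM; [exact: bdm_cst|exact: bdm_tail_weight].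
- move=> w; case: ltP => [/ltW/tail_weight_ge|_] /=; first lra.
  by rewrite mulr_ge0// tail_weight_ge0.
Qed.

End random_variable.
End tail_bound.

Section continuous_statistics.
Context {R : realType} (n : nat).
Variables (f : 'rV[R]_n -> R) (cf : continuous f) (M : R) (fM : forall v, `|f v| <= M).
Context d (T : measurableType d) (X : 'I_n -> T -> R).
Hypothesis mX : forall i, measurable_fun setT (X i).

(** Measurability comes from a pointwise limit of trigonometric polynomials: at fixed [w], the
    approximation on [[- k.+1, k.+1]^n] with error [1 / k.+1] applies once [k] exceeds all
    [|X i w|]. *)
Lemma bdm_continuous_row : bdm (fun w => f (\row_i X i w)).
Proof.
split; last by exists M => w.
have /choice[h hh] : forall k : nat, exists h, [/\ trig_poly h, (forall x, `|h x| <= M) &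
    forall x : 'I_n -> R, (forall i, `|x i| <= k.+1%:R) -> `|h x - f (\row_i x i)| <= k.+1%:R^-1].
  by move=> k; apply: trig_approximation; rewrite ?invr_gt0.
apply: (measurable_fun_cvg (h := fun k w => h k (X ^~ w))).
  by move=> k; have [tk _ _] := hh k; exact: bdm_measurable (trig_poly_bdm mX tk).
move=> w _; apply/cvgrPdist_le => e e0.
have : \forall k \near \oo, forall i, `|X i w| <= k.+1%:R.
  apply: filter_forall => i; have [K hK] := exists_nat_gt `|X i w|.
  by exists K => // k /= Kk; rewrite (le_trans (ltW hK))// ler_nat (leq_trans Kk).
have [K hK] := exists_nat_gt e^-1.
have : \forall k \near \oo, (K <= k)%N by exists K.
apply: filterS2 => k Kk Xk; have [_ _ hk] := hh k.
rewrite distrC (le_trans (hk _ Xk))// invf_ple ?posrE// (le_trans (ltW hK))// ler_nat.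
exact: leq_trans Kk _.
Qed.

(** Off the box, which is left only if some coordinate exceeds [L], both functions are bounded by
    [M]; this is why the approximant must inherit the bound of [f]. *)
Lemma trig_approximation_expect (P : probability T R) (L e : R) (h : ('I_n -> R) -> R) :
  trig_poly h -> (forall x, `|h x| <= M) ->
  (forall x : 'I_n -> R, (forall i, `|x i| <= L) -> `|h x - f (\row_i x i)| <= e) -> 0 <= e ->
  `|\int[P]_w h (X ^~ w) - \int[P]_w f (\row_i X i w)| <=
  e + 2 * M * \sum_i \int[P]_w (L < `|X i w|)%R%:R.
Proof.
move=> th hM he e0; have bh := trig_poly_bdm mX th; have bf := bdm_continuous_row.
have M0 : 0 <= M by exact: le_trans (fM 0).
have bi i : bdm (fun w => (L < `|X i w|)%R%:R : R).
  by apply: bdm_boolr; apply: measurable_fun_ltr => //; exact: measurableT_comp.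
have bs : bdm (fun w => \sum_i (L < `|X i w|)%R%:R : R) by exact: bdm_sum.
have bs2 : bdm (fun w => 2 * M * \sum_i (L < `|X i w|)%R%:R : R).
  by apply: bdmM => //; exact: bdm_cst.
rewrite -expectB// (le_trans (le_norm_expect _ (bdmB bh bf)))//.
rewrite -expect_sum// -expectZl// -[X in X + _](expect_cst P) -expectD//; last exact: bdm_cst.
apply: le_expect; first exact/bdm_abs/bdmB.
  by apply: bdmD => //; exact: bdm_cst.
move=> w; have S0 : 0 <= \sum_i (L < `|X i w|)%R%:R :> R by apply: sumr_ge0.
have [XL|] := pselect (forall i, `|X i w| <= L).
  by rewrite (le_trans (he _ XL))// lerDl !mulr_ge0.
move=> /existsNP[i /negP]; rewrite -ltNge => Xi.
rewrite (le_trans (ler_normB _ _))// (le_trans (lerD (hM _) (fM _)))//.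
have : 1 <= \sum_i (L < `|X i w|)%R%:R :> R.
  by rewrite (bigD1 i)//= Xi lerDl sumr_ge0.
nra.
Qed.

End continuous_statistics.

Section continuity_theorem.
Context {R : realType} {d1 d2 : measure_display} {Om1 : measurableType d1} {Om2 : measurableType d2}.
Variables (P : probability Om1 R) (Q : probability Om2 R) (n : nat).
Variables (Y : nat -> 'I_n -> Om1 -> R) (Z : 'I_n -> Om2 -> R).
Hypotheses (mY : forall k i, measurable_fun setT (Y k i)) (mZ : forall i, measurable_fun setT (Z i)).
Hypothesis charf_cvg : forall (a : R) (theta : 'I_n -> R),
  \int[P]_w cos (a + \sum_i theta i * Y k i w) @[k --> \oo] -->
  \int[Q]_w cos (a + \sum_i theta i * Z i w).

Let trig_cvg h : trig_poly h ->
  \int[P]_w h (Y k ^~ w) @[k --> \oo] --> \int[Q]_w h (Z ^~ w).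
Proof.
elim=> [a theta|h1 h2 t1 ih1 t2 ih2|c h0 t0 ih]; first exact: charf_cvg.
- rewrite expectD; [|exact: trig_poly_bdm|exact: trig_poly_bdm].
  under eq_fun => k do rewrite (expectD _ (trig_poly_bdm (mY k) t1) (trig_poly_bdm (mY k) t2)).
  exact: cvgD.
- rewrite expectZl; last exact: trig_poly_bdm.
  under eq_fun => k do rewrite (expectZl _ _ (trig_poly_bdm (mY k) t0)).
  exact: cvgMr.
Qed.

Let coord_cvg i t : \int[P]_w cos (t * Y k i w) @[k --> \oo] --> \int[Q]_w cos (t * Z i w).
Proof.
have := @charf_cvg 0 (fun j => if j == i then t else 0).
have E (x : 'I_n -> R) : 0 + \sum_j (if j == i then t else 0) * x j = t * x i.
  by rewrite add0r (bigD1 i)//= eqxx big1 ?addr0// => j /negbTE ->; rewrite mul0r.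
under eq_Rintegral do rewrite E.
by under eq_fun do under eq_Rintegral do rewrite E.
Qed.

Let weight_cvg i (u : R) (u0 : 0 < u) :
  \int[P]_w tail_weight u0 (Y k i w) @[k --> \oo] --> \int[Q]_w tail_weight u0 (Z i w).
Proof.
rewrite expect_tail_weight//; under eq_fun do rewrite expect_tail_weight//.
have bc (d : measure_display) (T : measurableType d) (P0 : probability T R) (X : T -> R) : measurable_fun setT X ->
    bdm (fun t : R => 1 - \int[P0]_w cos (t * X w)).
  move=> mX; apply: bdmB; first exact: bdm_cst.
  apply: (@bdm_average _ _ _ _ _ P0 (uniform_prob u0) (fun p : T * R => cos (p.2 * X p.1))).
  apply: bdm_cos; apply: measurable_funM; first exact: measurable_snd.
  exact: (measurableT_comp mX (@measurable_fst _ _ _ _)).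
apply: (@expect_bounded_cvg _ _ _ _ _ _ 2).
- by move=> k; exact: bdm_measurable (bc _ _ _ _ (mY k i)).
- exact: bdm_measurable (bc _ _ _ _ (mZ i)).
- move=> k t; rewrite ger0_norm.
    have : -1 <= \int[P]_w cos (t * Y k i w); last lra.
    rewrite -[leLHS](expect_cst P); apply: le_expect; first exact: bdm_cst.
      by apply: bdm_cos; exact: measurable_funM.
    by move=> w; exact: cos_geN1.
  rewrite subr_ge0 -[leRHS](expect_cst P); apply: le_expect.
  - by apply: bdm_cos; exact: measurable_funM.
  - exact: bdm_cst.
  - by move=> w; exact: cos_le1.
- by apply: aeW => t; apply: cvgB; [exact: cvg_cst|exact: coord_cvg].
Qed.

Let scale (j : nat) : R := j.+1%:R^-1.
Let scale_gt0 j : 0 < scale j. Proof. by rewrite invr_gt0. Qed.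

Let weight_small i (e : R) : 0 < e -> \forall j \near \oo, \int[Q]_w tail_weight (scale_gt0 j) (Z i w) < e.
Proof.
move=> e0.
have lim0 : \int[Q]_w tail_weight (scale_gt0 j) (Z i w) @[j --> \oo] --> \int[Q]_w (0 : R).
  apply: (@expect_bounded_cvg _ _ _ _ _ _ 2).
  - by move=> j; exact: bdm_measurable (bdm_tail_weight _ Q (mZ i)).
  - exact: measurable_cst.
  - by move=> j w; rewrite ger0_norm ?tail_weight_ge0// tail_weight_le2.
  - apply: aeW => w; apply: (@squeeze_cvgr _ _ _ _ (fun=> 0) (fun j => scale j ^+ 2 * Z i w ^+ 2)).
    + by apply: nearW => j; rewrite tail_weight_ge0 tail_weight_le.
    + exact: cvg_cst.
    + have h : scale j @[j --> \oo] --> (0 : R) by exact: cvg_harmonic.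
      rewrite -[X in _ --> X](mul0r (Z i w ^+ 2)); apply: cvgMl.
      under eq_fun do rewrite expr2.
      have hh := cvgM h h; rewrite mulr0 in hh; exact: hh.
move: lim0; rewrite expect_cst => /cvgrPdist_lt/(_ e e0); apply: filterS => j.
by rewrite sub0r normrN => /(le_lt_trans (ler_norm _)).
Qed.

(** Tightness: at a small scale the expected weight of each [Z i] is below [e / 4], convergence puts
    that of [Y k i] below [e / 2] eventually, and [tail_le_weight] doubles it. *)
Lemma tails_small (e : R) : 0 < e -> exists2 L : R, 0 < L &
  (forall i, \int[Q]_w (L < `|Z i w|)%R%:R <= e) /\
  \forall k \near \oo, forall i, \int[P]_w (L < `|Y k i w|)%R%:R <= e.
Proof.
move=> e0; have e2 : 0 < e / 4 by rewrite divr_gt0.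
have [j hj] : exists j, forall i, \int[Q]_w tail_weight (scale_gt0 j) (Z i w) < e / 4.
  have : \forall j \near \oo, forall i, \int[Q]_w tail_weight (scale_gt0 j) (Z i w) < e / 4.
    by apply: filter_forall => i; exact: weight_small.
  by case=> N _ hN; exists N; apply: hN => /=.
exists (2 / scale j); first by rewrite divr_gt0.
split.
  move=> i; apply: (le_trans (tail_le_weight (scale_gt0 j) Q (mZ i))); have := hj i; lra.
apply: filter_forall => i; have := @weight_cvg i _ (scale_gt0 j).
move/cvgrPdist_lt => /(_ _ e2); apply: filterS => k hk.
apply: (le_trans (tail_le_weight (scale_gt0 j) P (mY k i))).
have := hj i; have := ler_norm (\int[P]_w tail_weight (scale_gt0 j) (Y k i w) - \int[Q]_w tail_weight (scale_gt0 j) (Z i w)).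
rewrite distrC in hk; lra.
Qed.

Lemma continuity_theorem (f : 'rV[R]_n -> R) (M : R) : continuous f -> (forall v, `|f v| <= M) ->
  \int[P]_w f (\row_i Y k i w) @[k --> \oo] --> \int[Q]_w f (\row_i Z i w).
Proof.
move=> cf fM; have M0 : 0 <= M by exact: le_trans (fM 0).
apply/cvgrPdist_le => e e0; have e8 : 0 < e / 8 by rewrite divr_gt0.
(* Gives [2 * M * n * eta <= e / 8], with [+ 1] guarding against a zero denominator. Two
   approximation errors, two tail terms and one limit make five terms of size [e / 8]. *)
pose eta := e / 8 / (2 * M * n%:R + 1).
have D0 : 0 < 2 * M * n%:R + 1 by rewrite ltr_wpDl// !mulr_ge0.
have eta0 : 0 < eta by rewrite divr_gt0.
have [L L0 [tZ tY]] := tails_small eta0.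
have [h [th hM hf]] := trig_approximation cf fM L0 e8.
have tail_bound (S : 'I_n -> R) : (forall i, S i <= eta) -> 2 * M * \sum_i S i <= e / 8.
  move=> hS; have : \sum_i S i <= n%:R * eta.
    rewrite (@le_trans _ _ (\sum_(i < n) eta)) ?ler_sum//.
    by rewrite sumr_const card_ord mulr_natl lexx.
  move=> h1; rewrite (@le_trans _ _ (2 * M * (n%:R * eta)))//; first by rewrite ler_wpM2l// mulr_ge0.
  rewrite mulrA /eta mulrA ler_pdivrMr// mulrC ler_pM2l// lerDl//.
have aZ := trig_approximation_expect cf fM mZ Q th hM hf (ltW e8).
have bZ := tail_bound _ tZ.
have := trig_cvg th; move/cvgrPdist_le => /(_ _ e8).
move: tY; apply: filterS2 => k tYk hk.
have aY := trig_approximation_expect cf fM (mY k) P th hM hf (ltW e8).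
have bY := tail_bound _ tYk.
move: aZ aY hk bZ bY.
move: (\int[Q]_w f _) (\int[P]_w f _) (\int[Q]_w h _) (\int[P]_w h _) => fz fy hz hy.
rewrite !ler_norml => /andP[? ?] /andP[? ?] /andP[? ?] ? ?; apply/andP; split; lra.
Qed.

End continuity_theorem.

(** [trawl_inv g] is at least 1 on []0, g 1]], so the integral is at least [g 1 > 0]; the positivity
    of [K] rests on this. *)
Lemma trawl_inv_powR_mass {R : realType} (gamma : R) (g : R -> R) (p : R) :
  0 < gamma -> trawl_function gamma g -> 0 <= p -> p < 1 + gamma ->
  0 < fine (\int[@lebesgue_measure R]_(y in `]0%R, g 0%R]) (trawl_inv g y `^ p)%:E).
Proof.
move=> hgamma hg p0 p1; set I := integral _ _ _.
have g1 : 0 < g 1 by apply: (trawl_gt0 hg); exact: ler01.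
have g10 : g 1 < g 0 := trawl_decreasing hg (lexx 0) ltr01.
have If : I \is a fin_num.
  rewrite ge0_fin_numE; first exact: (trawl_inv_powR_lty hgamma hg).
  by apply: integral_ge0 => y _; rewrite lee_fin powR_ge0.
rewrite -lte_fin fineK//; apply: (@lt_le_trans _ _ (g 1)%:E); first by rewrite lte_fin.
have mr : measurable_fun setT (fun y => (trawl_inv g y `^ p)%:E).
  apply/measurable_EFinP; apply: (measurableT_comp (measurable_powR p)).
  exact: (measurable_trawl_inv hg).
apply: (@le_trans _ _ (\int[@lebesgue_measure R]_(y in `]0%R, g 1%R]) (trawl_inv g y `^ p)%:E)%E); last first.
  apply: ge0_subset_integral => //.
  - exact: measurable_funTS.
  - by move=> y _; rewrite lee_fin powR_ge0.
  - by apply: subset_itvl; rewrite bnd_simp ltW.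
apply: (@le_trans _ _ (\int[@lebesgue_measure R]_(y in `]0%R, g 1%R]) (1 : R)%:E)%E).
  by rewrite integral_cst//= lebesgue_measure_itv/= lte_fin g1 sube0 mul1e.
apply: ge0_le_integral => //; first exact: measurable_funTS.
move=> y; rewrite /= in_itv/= => /andP[y0 yg]; rewrite lee_fin.
have r1 : 1 <= trawl_inv g y.
  by rewrite (trawl_invP hg)//; rewrite y0 (le_trans yg)// ltW.
have e1 : (1 : R) = 1 `^ p by rewrite powR1.
by rewrite [leLHS]e1 ge0_ler_powR ?nnegrE// (le_trans ler01).
Qed.

Lemma expectationE {R : realType} d (T : measurableType d) (P : probability T R) (f : T -> R) :
  bdm f -> ('E_P[f])%E = (\int[P]_w f w)%:E.
Proof.
move=> bf; rewrite unlock /Rintegral fineK//.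
exact: (integrable_fin_num measurableT (bdm_integrable P measurableT bf)).
Qed.

Unset Implicit Arguments.

Theorem theorem2p9 (R : realType)
  (nu : {measure set R -> \bar R}) (hnu : symmetric_levy_measure nu)
  (d : measure_display) (Om : measurableType d) (P : probability Om R)
  (Lambda : set (R * R) -> {RV P >-> R}) (hLambda : levy_basis nu Lambda)
  (gamma : R) (hgamma0 : 0 < gamma) (hgamma1 : gamma < 1)
  (g : R -> R) (hg : trawl_function gamma g)
  (X : R -> Om -> R) (hX : trawl_process Lambda g X)
  (alpha : R) (halpha0 : 0 < alpha) (halpha1 : alpha < 1 + gamma)
  (Calpha : R) (hCalpha : 0 < Calpha)
  (hpsi0 : levy_exponent nu x / `|x| `^ alpha @[x --> 0^'] --> Calpha)
  (C kappa : R) (hC : 0 < C) (hkappa0 : 0 <= kappa) (hkappa1 : kappa < 1 + gamma)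
  (hpsi : forall u, levy_exponent nu u <= C * Num.max 1 (`|u| `^ kappa)) :
  exists K : R, 0 < K /\
    forall (d' : measure_display) (Om' : measurableType d')
           (Q : probability Om' R) (xi : R -> {RV Q >-> R}),
      symmetric_stable_levy_process alpha xi ->
      cvg_fdd P (integrated_process X (fun T => T `^ alpha^-1))
              Q (fun t w => K * xi t w).
Proof.
have kappa2 : kappa < 2 by lra.
have psi_sqr := levy_exponent_le_sqr halpha0 hCalpha hpsi0 hC hkappa0 hpsi kappa2.
have mpsi := levy_exponent_measurable hnu halpha0 hCalpha hpsi0 hC hkappa0 hpsi kappa2.
have scaled_cvg := levy_exponent_scaled_cvg halpha0 hpsi0.
(* The entry 1 serves the domination of the part [x < 0], [alpha] the scaling factor
   [T^(1 - q / alpha)], and [kappa] the growth of the exponent at infinity. *)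
pose q := Num.max 1 (Num.max alpha kappa).
have q1 : 1 <= q by rewrite le_max lexx.
have aq : alpha <= q by rewrite !le_max lexx orbT.
have kq : kappa <= q by rewrite !le_max lexx !orbT.
have hq : q < 1 + gamma by rewrite !gt_max halpha1 hkappa1 ltrDl hgamma0.
have [D D0 scaled_le] := levy_exponent_scaled_le halpha0 hCalpha hpsi0 hC hkappa0 hpsi kq aq.
set S := fine (\int[@lebesgue_measure R]_(y in `]0%R, g 0%R]) (trawl_inv g y `^ alpha)%:E).
have S0 : 0 < S by exact: (trawl_inv_powR_mass hgamma0 hg (ltW halpha0) halpha1).
have CS0 : 0 < Calpha * S by exact: mulr_gt0.
pose K := (Calpha * S) `^ alpha^-1.
have K0 : 0 < K by rewrite powR_gt0.
have Kalpha : K `^ alpha = Calpha * S.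
  by rewrite /K -powRrM mulVf ?powRr1 ?gt_eqF// ltW.
exists K; split => // d' Om' Q xi hxi n t f t0 cf [M fM].
have mY T i : measurable_fun setT (integrated_process X (fun T => T `^ alpha^-1) T (t i)).
  by apply: measurable_funM => //; exact: (measurable_integrated_trawl hX).
have mZ i : measurable_fun setT (fun w => K * xi (t i) w) by exact: measurable_funM.
rewrite expectationE; last exact: (bdm_continuous_row cf fM mZ).
under eq_fun => T do rewrite (expectationE P (bdm_continuous_row cf fM (mY T))).
apply: cvg_EFin; first exact: nearW.
apply/cvg_pinftyP => u u_oo.
(* The scaled bound is stated for [1 <= T]; a sequence tending to infinity eventually agrees with
   its maximum with 1. *)
pose T k := Num.max 1 (u k).
have T1 k : 1 <= T k by rewrite le_max lexx.
have uT : \forall k \near \oo, u k = T k.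
  by move/cvgryPge : u_oo => /(_ 1); apply: filterS => k hk; rewrite /T (max_idPr hk).
have T_oo : T k @[k --> \oo] --> +oo.
  by apply: cvg_trans u_oo; apply: near_eq_cvg; exact: uT.
suff : \int[P]_w f (\row_i integrated_process X (fun T => T `^ alpha^-1) (T k) (t i) w) @[k --> \oo] -->
    \int[Q]_w f (\row_i (K * xi (t i) w)).
  apply: cvg_trans; apply: near_eq_cvg; apply: filterS uT => k ->.
  by [].
apply: (continuity_theorem (fun k => mY (T k)) mZ _ cf fM) => a theta.
(* A common horizon for all times, positive even if they all vanish or there are none. *)
pose tau := 1 + \sum_i t i.
have tau0 : 0 < tau by rewrite ltr_pwDl// sumr_ge0.
have ht i : 0 <= t i <= tau.
  rewrite t0/= /tau (bigD1 i)//= addrCA lerDl addr_ge0// sumr_ge0//.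
pose I := \int[@lebesgue_measure R]_(s in `[0, tau]) (`|\sum_i theta i * (s <= t i)%R%:R| `^ alpha).
have -> : \int[Q]_w cos (a + \sum_i theta i * (K * xi (t i) w)) = cos a * expR (- (Calpha * I * S)).
  under eq_Rintegral do under eq_bigr do rewrite mulrA.
  rewrite (stable_process_charf halpha0 hxi tau0 (fun i => theta i * K) ht).
  congr (_ * expR (- _)).
  transitivity (\int[@lebesgue_measure R]_(s in `[0, tau])
      (K `^ alpha * `|\sum_i theta i * (s <= t i)%R%:R| `^ alpha)).
    apply: eq_Rintegral => s _; rewrite -powRM// ?ltW//; congr (_ `^ _).
    rewrite -{2}(gtr0_norm K0) -normrM; congr (`|_|); rewrite mulr_sumr.
    by apply: eq_bigr => i _; rewrite mulrAC [K * _]mulrC.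
  have Ic := bdm_itv_integrable 0 tau (bdm_step_powR theta t (ltW halpha0)).
  rewrite RintegralZl; [|exact: measurable_itv|exact: Ic].
  by rewrite Kalpha -/I mulrAC.
pose L k (p : R * R) := (T k `^ alpha^-1)^-1 * \sum_i theta i * trawl_overlap g (T k * t i) p.
have charfE k : \int[P]_w cos (a + \sum_i theta i * integrated_process X (fun T => T `^ alpha^-1) (T k) (t i) w) =
    cos a * expR (- fine (energy nu (L k))).
  have Tk0 : 0 < T k := lt_le_trans ltr01 (T1 k).
  have htk i : 0 <= T k * t i <= T k * tau.
    have /andP[h1 h2] := ht i; apply/andP; split; last by rewrite ler_pM2l.
    by apply: mulr_ge0 => //; exact: ltW.
  have := integrated_trawl_charf hnu hLambda psi_sqr mpsi hgamma0 hg hX (mulr_gt0 Tk0 tau0)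
    (fun i => theta i * (T k `^ alpha^-1)^-1) htk a.
  rewrite /integrated_process => E.
  under eq_Rintegral do under eq_bigr do rewrite mulrA.
  rewrite E; congr (_ * expR (- _)).
  have LE : (fun p => \sum_i theta i * (T k `^ alpha^-1)^-1 * trawl_overlap g (T k * t i) p) = L k.
    by apply/funext => p; rewrite /L mulr_sumr; apply: eq_bigr => i _; rewrite mulrAC [RHS]mulrC.
  rewrite LE -(halo_energyE mpsi hg)//.
    apply: measurable_funM => //; apply: measurable_sum => i; apply: measurable_funM => //.
    exact: (measurable_trawl_overlap hg).
  move=> p _ nH; rewrite /L big1 ?mulr0// => i _.
  by rewrite (trawl_overlap_out hg _ nH) ?mulr0//; have /andP[] := htk i.
under eq_fun do rewrite charfE.
apply: cvgMr.
have := energy_cvg mpsi halpha0 (ltW hCalpha) q1 aq D0 scaled_le scaled_cvg hgamma0 hg hq tau0 (theta := theta) ht T1 T_oo.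
move=> /fine_cvg h.
apply: (@continuous_cvg _ _ _ _ _ _ expR); first exact: continuous_expR.
apply: cvgN; exact: h.
Qed.
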